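(* Let $\Omega$ be a bounded domain in $\mathbb{C}^n$ with $\mathcal{C}^2$-smooth boundary. Suppose that either (1) $\Omega$ satisfies the $(1,\epsilon)$-visibility property for some $\epsilon>0$; or (2) $\Omega$ satisfies the $(\lambda,0)$-visibility property for all $\lambda>1$. Then $\Omega$ is pseudoconvex.
   Context: Let $\Delta\subset\mathbb{C}$ be the open unit disc, and let $\mathcal{O}(\Delta,\Omega)$ denote the set of holomorphic maps from $\Delta$ to a domain $\Omega\subset\mathbb{C}^n$. Lempert function: for $z,w\in\Omega$, $l_\Omega(z,w):=\inf\{\tanh^{-1}|\alpha| : \exists\,\varphi\in\mathcal{O}(\Delta,\Omega)\text{ with }\varphi(0)=z,\ \varphi(\alpha)=w\}$ (here $\alpha\in\Delta$). Kobayashi pseudodistance: $k_\Omega$ is the largest pseudodistance on $\Omega$ that does not exceed $l_\Omega$. Kobayashi-Royden pseudometric: for $z\in\Omega$, $v\in\mathbb{C}^n$, $\kappa_\Omega(z;v):=\inf\{|\alpha| : \exists\,\varphi\in\mathcal{O}(\Delta,\Omega)\text{ with }\varphi(0)=z,\ \alpha\varphi'(0)=v\}$ (here $\alpha\in\mathbb{C}$). Kobayashi-Royden length: for an absolutely continuous curve $\gamma:[0,l]\to\Omega$, $l^\kappa_\Omega(\gamma):=\int_0^l\kappa_\Omega(\gamma(t);\gamma'(t))\,dt$; the length of a restriction $\gamma|_{[t_1,t_2]}$ is defined in the same way, by integrating over $[t_1,t_2]$. $(\lambda,\epsilon)$-geodesic: for $\lambda\ge 1$ and $\epsilon\ge 0$,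 an absolutely continuous curve $\gamma:[0,l]\to\Omega$ is a $(\lambda,\epsilon)$-geodesic if for all $t_1\le t_2$ in $[0,l]$, $l^\kappa_\Omega(\gamma|_{[t_1,t_2]})\le\lambda k_\Omega(\gamma(t_1),\gamma(t_2))+\epsilon$. $(\lambda,\epsilon)$-visibility property: a domain $\Omega\subset\mathbb{C}^n$ satisfies the $(\lambda,\epsilon)$-visibility property if for any pair of distinct points $p,q\in\partial\Omega$ there exist neighborhoods $U,V$ of $p,q$ respectively with $\overline{U}\cap\overline{V}=\emptyset$, and a compact set $K=K_{p,q,\lambda,\epsilon}\subset\Omega$, such that whenever $\gamma:[0,l]\to\Omega$ is a $(\lambda,\epsilon)$-geodesic with $\gamma(0)\in\Omega\cap U$ and $\gamma(l)\in\Omega\cap V$, one has $\gamma([0,l])\cap K\ne\emptyset$. *)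

(* Defs.v *)
(* C^n is ['rV[R[i]^o]_n]; [R[i]^o] is the field
   R[i] as a normed module over itself, so that row vectors over it carry the
   usual topology of C^n (given by the max norm). *)
From HB Require Import structures.
From mathcomp Require Import all_boot all_order all_algebra.
From mathcomp Require Import complex.
From mathcomp Require Import all_classical all_reals all_analysis.

Set Implicit Arguments.
Unset Strict Implicit.
Unset Printing Implicit Defensive.

Import Order.TTheory GRing.Theory Num.Theory numFieldNormedType.Exports.

Local Open Scope classical_set_scope.
Local Open Scope complex_scope.
Local Open Scope ring_scope.

Notation "''C^' n ( R )" := 'rV[(R[i])^o]_n
  (at level 8, n at level 2, format "''C^' n ( R )") : type_scope.

Section Defs.
Variables (R : realType) (n : nat).
Local Notation C := (R[i]^o).
Local Notation Cn := ('C^n(R)).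
Implicit Types (Omega U V K : set Cn) (z w v p q : Cn).

Definition domain Omega := [/\ open Omega, connected Omega & Omega !=set0].

Definition boundary Omega : set Cn := closure Omega `\` interior Omega.

Definition real_line (f : Cn -> R) v z : R -> R := fun t => f (z + t%:C *: v).

Definition real_derive (f : Cn -> R) v z : R := derive1 (real_line f v z) 0.

(* Directions range over all of C^n = R^2n, hence over both [\partial / \partial x_j]
   and [\partial / \partial y_j]. *)
Definition C1_on U (f : Cn -> R) := forall v z, U z ->
  derivable (real_line f v z) 0 1 /\ {for z, continuous (real_derive f v)}.

Definition C2_on U (f : Cn -> R) :=
  C1_on U f /\ forall v, C1_on U (real_derive f v).

(* local C^2 defining functions with nowhere vanishing differential *)
Definition C2_boundary Omega := forall p, boundary Omega p ->
  exists U (r : Cn -> R),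
    [/\ open U, U p, C2_on U r,
        Omega `&` U = [set z | U z /\ r z < 0] &
        forall z, U z -> exists v, real_derive r v z != 0].

Definition atanh (x : R) : R := ln ((1 + x) / (1 - x)) / 2.

Definition cmod (a : C) : R := complex.Re `|a|.

(* the set O(Delta, Omega); only the values on the unit disc matter *)
Definition hol_disc Omega (phi : C -> Cn) := forall a : C, `|a| < 1 ->
  derivable phi a 1 /\ Omega (phi a).

Definition lempert Omega z w : \bar R :=
  ereal_inf [set (atanh (cmod a))%:E | a in [set a : C | `|a| < 1 /\
    exists phi, [/\ hol_disc Omega phi, phi 0 = z & phi a = w]]].

Definition pseudodistance Omega (d : Cn -> Cn -> R) :=
  [/\ forall x y, Omega x -> Omega y -> 0 <= d x y,
      forall x, Omega x -> d x x = 0,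
      forall x y, Omega x -> Omega y -> d x y = d y x &
      forall x y z, Omega x -> Omega y -> Omega z -> d x z <= d x y + d y z].

(* The largest pseudodistance below [lempert Omega], as the pointwise supremum
   of all of them (which is again one). *)
Definition kobayashi Omega z w : \bar R :=
  ereal_sup [set (d z w)%:E | d in [set d | pseudodistance Omega d /\
    forall x y, Omega x -> Omega y -> ((d x y)%:E <= lempert Omega x y)%E]].

Definition kobayashi_royden Omega z v : \bar R :=
  ereal_inf [set (cmod a)%:E | a in [set a : C |
    exists phi, [/\ hol_disc Omega phi, phi 0 = z & a *: derive1 phi 0 = v]]].

(* Curves [0, l] -> C^n are functions on R of which only the restriction to
   [0, l] matters. *)
Definition abs_continuous (l : R) (g : R -> Cn) :=
  forall e : R, 0 < e -> exists2 d : R, 0 < d &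
    forall (m : nat) (a b : 'I_m -> R),
      (forall i, [/\ 0 <= a i, a i <= b i & b i <= l]) ->
      trivIset setT (fun i => `]a i, b i[%classic) ->
      \sum_i (b i - a i) < d -> \sum_i `|g (b i) - g (a i)| < e%:C.

(* Derivative with respect to the real parameter, computed on real and imaginary
   parts since C^n is a normed module over R[i] only.  The value is irrelevant on
   the null set where an absolutely continuous curve is not differentiable. *)
Definition velocity (g : R -> Cn) (t : R) : Cn :=
  \row_j (derive1 (fun s => complex.Re (g s 0 j)) t
          +i* derive1 (fun s => complex.Im (g s 0 j)) t).

Definition kr_length Omega (g : R -> Cn) (t1 t2 : R) : \bar R :=
  (\int[lebesgue_measure]_(t in `[t1, t2])
     kobayashi_royden Omega (g t) (velocity g t))%E.

Definition geodesic Omega (lambda eps l : R) (g : R -> Cn) :=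
  [/\ 0 <= l,
      forall t, t \in `[0, l] -> Omega (g t),
      abs_continuous l g &
      forall t1 t2, 0 <= t1 -> t1 <= t2 -> t2 <= l ->
        (kr_length Omega g t1 t2
           <= lambda%:E * kobayashi Omega (g t1) (g t2) + eps%:E)%E].

Definition visibility Omega (lambda eps : R) :=
  forall p q, boundary Omega p -> boundary Omega q -> p <> q ->
  exists U V K,
    [/\ nbhs p U, nbhs q V, closure U `&` closure V = set0,
        compact K /\ K `<=` Omega &
        forall l g, geodesic Omega lambda eps l g ->
          (Omega `&` U) (g 0) -> (Omega `&` V) (g l) ->
          g @` `[0, l] `&` K !=set0].

Definition expi (t : R) : C := cos t +i* sin t.

(* continuous plurisubharmonic: sub-mean value inequality on every closed
   affine disc contained in [Omega] *)
Definition continuous_psh Omega (u : Cn -> R) :=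
  (forall z, Omega z -> {for z, continuous u}) /\
  forall a b : Cn, (forall s : C, `|s| <= 1 -> Omega (a + s *: b)) ->
    u a <= (2 * pi)^-1 *
           \int[lebesgue_measure]_(t in `[0, 2 * pi]) u (a + expi t *: b).

Definition pseudoconvex Omega := exists2 u : Cn -> R, continuous_psh Omega u &
  forall c : R, compact [set z | Omega z /\ u z <= c].

End Defs.

(* Main.v *)
Require Import Defs.
From mathcomp Require Import all_boot all_order all_algebra.
From mathcomp Require Import complex.
From mathcomp Require Import all_classical all_reals all_analysis.
From mathcomp Require Import measurable_realfun.
From mathcomp Require Import ring lra.
Import Order.TTheory GRing.Theory Num.Theory numFieldNormedType.Exports.
Local Open Scope classical_set_scope.
Local Open Scope complex_scope.
Local Open Scope ring_scope.
Set Implicit Arguments.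
Unset Strict Implicit.
Unset Printing Implicit Defensive.

(* Let [u = - ln d], where [d] is the distance to the complement of [Omega] in the
   max norm.  It is continuous with compact sublevel sets, so it suffices that it
   satisfies the sub-mean value inequality on discs.  If that fails on a disc, then
   after subtraction of the real part of a polynomial [u] has a strict local maximum
   of quadratic type along a complex line at some [a'].  Let [p] be a nearest point
   of the complement to [a'].  Moving [p] along with [d] (through the quadratic Taylor
   polynomial of an exponential) gives a disc [p + s v + s^2 w], touching the boundary
   at [p], whose point of parameter [s] has a ball of radius [c |s|^2] around it
   contained in [Omega]: the Levi form is negative in the direction [v].
   Near such a point [p] the Kobayashi-Royden metric is bounded in complex tangential
   directions close to [v], uniformly up to the boundary.  Hence curves that follow
   these directions at arbitrarily small depth have length at most [L (t2 - t1)],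
   whereas [k_Omega] is at least [c |z - w|] because [Omega] is bounded.  Short curves
   of this kind are [(1, eps)]-geodesics, and they are [(lambda, 0)]-geodesics for
   large [lambda]; as their depth tends to zero they leave every compact subset of
   [Omega], while their ends approach two distinct boundary points, which contradicts
   visibility. *)

(** * Real-valued norms of complex vectors *)

(** The obstacle is uniformity: the length bound [L] and the duration [T] must be fixed before the
    depth of the curves tends to zero. So every point of a curve needs a disc of a radius that does
    not depend on its distance to the boundary. Negativity of the Levi form provides it, since a
    disc bent by the quadratic term [s^2 w] then makes the defining function rise by an arbitrarily
    small amount only. The field of tangential directions is merely chosen, with no regularity, so
    the curves are Euler polygons: a step [eta] changes the defining function by [O(eta^2)], in
    total by [O(eta)], which a fine subdivision makes small against the depth. Both visibility
    hypotheses serve through the single inequality [L s <= lam c2 c1 s + eps] for [0 <= s <= T],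
    reached by a small [T] in one case and a large [lam] in the other. The max norm is as good as
    any complex norm: moving [p] along with [d] relies on [|m x| = |m| |x|] for complex scalars [m].
    Holomorphy of arbitrary discs enters only through a Schwarz-type Lipschitz bound, obtained from
    Goursat's theorem in logarithmic polar coordinates. *)

Section Nrm.
Variables (R : realType) (V : normedModType R[i]).
Implicit Types x y z : V.

(* On an [R[i]]-module [`|x|] is itself an element of [R[i]]. *)
Definition nrm x : R := complex.Re `|x|.

Lemma nrmE x : `|x| = (nrm x)%:C.
Proof. by rewrite /nrm RRe_real// normr_real. Qed.

Lemma nrm_ge0 x : 0 <= nrm x.
Proof. by rewrite -lecR -nrmE normr_ge0. Qed.

Lemma nrm0 : nrm (0 : V) = 0.
Proof. by rewrite /nrm normr0. Qed.

Lemma nrm_eq0 x : (nrm x == 0) = (x == 0).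
Proof. by rewrite -(normr_eq0 x) nrmE -(inj_eq (@complexI R)). Qed.

Lemma nrm_gt0 x : (0 < nrm x) = (x != 0).
Proof. by rewrite lt_neqAle nrm_ge0 andbT eq_sym nrm_eq0. Qed.

Lemma nrmD x y : nrm (x + y) <= nrm x + nrm y.
Proof. by rewrite -lecR rmorphD/= -!nrmE ler_normD. Qed.

Lemma nrmN x : nrm (- x) = nrm x.
Proof. by rewrite /nrm normrN. Qed.

Lemma nrmB x y : nrm (x - y) = nrm (y - x).
Proof. by rewrite -nrmN opprB. Qed.

Lemma nrm_triangle y x z : nrm (x - z) <= nrm (x - y) + nrm (y - z).
Proof. by rewrite -[x - z](subrKA y) nrmD. Qed.

Lemma nrm_lb x y : nrm x - nrm y <= nrm (x + y).
Proof. by rewrite lerBlDr -{1}[x](addrK y) (le_trans (nrmD _ _))// nrmN. Qed.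

Lemma nrm_sum (I : Type) (s : seq I) (P : pred I) (F : I -> V) :
  nrm (\sum_(i <- s | P i) F i) <= \sum_(i <- s | P i) nrm (F i).
Proof.
elim/big_ind2 : _ => [|x a y b xa yb|//]; first by rewrite nrm0.
by rewrite (le_trans (nrmD _ _))// lerD.
Qed.

Lemma nbhs_nrmP x (U : set V) :
  nbhs x U <-> exists2 e : R, 0 < e & forall y, nrm (y - x) < e -> U y.
Proof.
split.
  move=> /nbhs_normP[e /= e0 eU]; exists (complex.Re e).
    by move: e0; rewrite ltcE/= => /andP[].
  move=> y yx; apply: eU; rewrite /ball_/= distrC nrmE.
  have : e \is Num.real by rewrite gtr0_real.
  by move=> /RRe_real <-; rewrite ltcR.
move=> [e e0 eU]; apply/nbhs_normP; exists e%:C => /=; first by rewrite ltcR.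
by move=> y; rewrite /ball_/= distrC nrmE ltcR => /eU.
Qed.

End Nrm.

Section NrmC.
Variables (R : realType).
Local Notation C := (R[i]^o).
Implicit Types (a b : C).

Lemma nrmZ (V : normedModType R[i]) (a : C) (x : V) : nrm (a *: x) = nrm a * nrm x.
Proof. by apply: (@complexI R); rewrite rmorphM/= -!nrmE normrZ. Qed.

Lemma nrmM a b : nrm (a * b) = nrm a * nrm b.
Proof. exact: nrmZ. Qed.

Lemma nrmX a k : nrm (a ^+ k) = nrm a ^+ k.
Proof.
elim: k => [|k ih]; first by rewrite !expr0 /nrm normr1.
by rewrite !exprS nrmM ih.
Qed.

Lemma nrm1 : nrm (1 : C) = 1.
Proof. by rewrite /nrm normr1. Qed.

Lemma nrmCE a : nrm a = Num.sqrt (complex.Re a ^+ 2 + complex.Im a ^+ 2).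
Proof. by rewrite /nrm normc_def. Qed.

Lemma sqr_nrm a : nrm a ^+ 2 = complex.Re a ^+ 2 + complex.Im a ^+ 2.
Proof. by rewrite nrmCE sqr_sqrtr// addr_ge0// sqr_ge0. Qed.

Lemma nrmR (x : R) : nrm (x%:C : C) = `|x|.
Proof. by rewrite nrmCE/= expr0n addr0 sqrtr_sqr. Qed.

Lemma nrmi : nrm ('i : C) = 1.
Proof. by rewrite nrmCE/= expr0n expr1n add0r sqrtr1. Qed.

Lemma Re_le_nrm a : `|complex.Re a| <= nrm a.
Proof.
rewrite -(@ler_pXn2r _ 2)// ?nnegrE ?nrm_ge0// sqr_nrm.
by rewrite real_normK ?num_real// lerDl sqr_ge0.
Qed.

Lemma Im_le_nrm a : `|complex.Im a| <= nrm a.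
Proof.
rewrite -(@ler_pXn2r _ 2)// ?nnegrE ?nrm_ge0// sqr_nrm.
by rewrite real_normK ?num_real// lerDr sqr_ge0.
Qed.

Lemma nrm_le_ReIm a : nrm a <= `|complex.Re a| + `|complex.Im a|.
Proof.
rewrite -(@ler_pXn2r _ 2)// ?nnegrE ?nrm_ge0 ?addr_ge0// sqr_nrm.
rewrite -[_ ^+ 2 in leLHS]real_normK ?num_real//.
rewrite -[X in _ + X <= _]real_normK ?num_real//.
have := normr_ge0 (complex.Re a); have := normr_ge0 (complex.Im a); nra.
Qed.

Lemma cplx_eq (a b : R[i]) :
  complex.Re a = complex.Re b -> complex.Im a = complex.Im b -> a = b.
Proof. by move: a b => [? ?] [? ?] /= -> ->. Qed.

(** A square is a continuous image of a product of two segments, and every bounded set of scalars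
    lies in one; Heine-Borel in C^n is reduced to this. *)
Lemma compact_cdisc (M : R) :
  compact [set a : C | `|complex.Re a| <= M /\ `|complex.Im a| <= M].
Proof.
have c2 : compact (`[- M, M]%classic `*` `[- M, M]%classic : set (R * R)).
  by apply: compact_setX; exact: segment_compact.
pose f (x : R * R) : C := x.1 +i* x.2.
rewrite (_ : [set _ | _] = f @` (`[- M, M]%classic `*` `[- M, M]%classic)).
  apply: continuous_compact c2; apply: continuous_subspaceT => -[x y].
  apply/cvgrPdist_lt => e; rewrite ltcE/= => /andP[/eqP e0 e1].
  near=> z; rewrite distrC nrmE ltcE/= e0 eqxx/=.
  apply: le_lt_trans (nrm_le_ReIm _) _.
  have -> : complex.Re (f z - f (x, y)) = z.1 - x by rewrite raddfB.
  have -> : complex.Im (f z - f (x, y)) = z.2 - y by rewrite raddfB.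
  rewrite (splitr (complex.Re e)) ltrD//.
    near: z; have : nbhs x [set x' | `|x' - x| < complex.Re e / 2].
      apply/nbhs_ballP; exists (complex.Re e / 2) => /=; first by rewrite divr_gt0.
      by move=> t; rewrite /ball/= distrC.
    by move=> H; exact: (@cvg_fst _ _ _ _ (nbhs_filter y) _ H).
  near: z; have : nbhs y [set x' | `|x' - y| < complex.Re e / 2].
    apply/nbhs_ballP; exists (complex.Re e / 2) => /=; first by rewrite divr_gt0.
    by move=> t; rewrite /ball/= distrC.
  by move=> H; exact: (@cvg_snd _ _ (nbhs x) _ _ _ H).
apply/seteqP; split=> [[x y] /= [] xM yM|_ [[x y] /= [] xM yM] <-].
  exists (x, y) => //; split; rewrite /= in_itv/=; by rewrite -ler_norml.
by split; rewrite /= ler_norml; move: xM yM; rewrite !in_itv/=.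
Unshelve. all: by end_near.
Qed.

End NrmC.

Section NrmV.
Variables (R : realType) (n : nat).
Local Notation C := (R[i]^o).
Local Notation Cn := ('C^n(R)).

Lemma nrm_coord (x : Cn) j : nrm (x 0 j : C) <= nrm x.
Proof.
rewrite -lecR -!nrmE [leRHS]/Num.norm/=.
rewrite mx_normE -[leLHS]nngE num_le.
by apply: (le_bigmax _ (fun i => `|x i.1 i.2|%:nng) (0, j)).
Qed.

Lemma nrm_le_coord (x : Cn) (M : R) : 0 <= M ->
  (forall j, nrm (x 0 j : C) <= M) -> nrm x <= M.
Proof.
move=> M0 xM; rewrite -lecR -nrmE [leLHS]/Num.norm/= mx_normE.
have M0' : 0 <= M%:C by rewrite ler0c.
have -> : M%:C = (NngNum M0')%:num by [].
rewrite num_le; apply/bigmax_leP; split => // -[i j] _ /=.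
by rewrite -num_le/= ord1 nrmE lecR.
Qed.

Lemma compact_bounded_closed (A : set Cn) (M : R) :
  (forall x, A x -> nrm x <= M) -> closed A -> compact A.
Proof.
move=> AM Acl.
have := @rV_compact C n _ (fun=> @compact_cdisc R M).
move=> H; apply: (subclosed_compact Acl H) => x Ax i /=.
split; [apply: le_trans (Re_le_nrm _) _|apply: le_trans (Im_le_nrm _) _];
  exact: le_trans (nrm_coord _ _) (AM _ Ax).
Qed.

End NrmV.

(** * Goursat's theorem and the Schwarz lemma *)

Section RealGoursat.
Variable R : realType.
Implicit Types (A B U V P Q : R -> R -> R) (f F : R -> R).

(** The intermediate point may be an end point, which admits the degenerate segment [a = b]. *)
Lemma mvt_segment (f df : R -> R) (a b : R) : a <= b ->
  (forall x, a <= x <= b -> is_derive x 1 f (df x)) ->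
  exists2 c, a <= c <= b & f b - f a = df c * (b - a).
Proof.
move=> ab fdf; have [||c cab ->] := @MVT_segment R f df a b ab.
- by move=> x /[!in_itv]/= /andP[ax xb]; apply: fdf; rewrite !ltW.
- apply: derivable_within_continuous => x /[!in_itv]/= xab.
  by have [] := fdf _ xab.
by exists c => //; move: cab; rewrite in_itv.
Qed.

Lemma antiderivative (f : R -> R) (a b : R) :
  (forall x, a <= x <= b -> {for x, continuous f}) ->
  exists F, forall x, a < x < b -> is_derive x 1 F (f x).
Proof.
move=> fc; exists (fun x => \int[lebesgue_measure]_(t in `[a, x]) f t) => x /andP[ax xb].
have fint : lebesgue_measure.-integrable `[a, b] (EFin \o f).
  apply: continuous_compact_integrable; first exact: segment_compact.
  apply/continuous_in_subspaceT => t; rewrite inE/= in_itv/=; exact: fc.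
have [|dF <-] := continuous_FTC1_closed xb fint ax.
  by apply: fc; rewrite !ltW.
by rewrite derive1E; exact: derivableP.
Qed.

(** Differentiability at the single point [(x, y)] with partial derivatives [p] and [q]. Nothing is
    said about continuity of the partial derivatives, as befits Goursat's theorem. *)
Definition lin_approx (f : R -> R -> R) (x y p q : R) :=
  forall e : R, 0 < e -> exists2 d : R, 0 < d & forall x' y',
    `|x' - x| < d -> `|y' - y| < d ->
    `|f x' y' - f x y - (p * (x' - x) + q * (y' - y))| <=
      e * (`|x' - x| + `|y' - y|).

Lemma lin_approx_contl (f : R -> R -> R) x y p q : lin_approx f x y p q ->
  {for x, continuous (f^~ y)}.
Proof.
move=> /(_ 1 ltr01) [d d0 H]; apply/cvgrPdist_lt => e e0.
have D0 : 0 < 1 + `|p| by rewrite ltr_pwDl.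
near=> x'; have x'd : `|x' - x| < d.
  rewrite distrC; near: x'; apply/nbhs_ballP; exists d => //.
have x'e : `|x' - x| < e / (1 + `|p|).
  rewrite distrC; near: x'; apply/nbhs_ballP; exists (e / (1 + `|p|)) => //=.
  by rewrite divr_gt0.
have := H x' y x'd; rewrite subrr normr0 => /(_ d0).
rewrite mulr0 !addr0 mul1r => H1; rewrite distrC.
rewrite -(subrK (p * (x' - x)) (f x' y - f x y)).
rewrite (le_lt_trans (ler_normD _ _))// (le_lt_trans (lerD H1 (lexx _)))//.
by rewrite normrM -{1}[`|x' - x|]mul1r -mulrDl mulrC -ltr_pdivlMr.
Unshelve. all: by end_near.
Qed.

Lemma lin_approx_contr (f : R -> R -> R) x y p q : lin_approx f x y p q ->
  {for y, continuous (f x)}.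
Proof.
move=> H; apply: (@lin_approx_contl (fun u v => f v u) y x q p) => e e0.
have [d d0 {}H] := H e e0; exists d => // y' x' y'd x'd.
by rewrite [q * _ + _]addrC [`|y' - y| + _]addrC; exact: H.
Qed.

(* [U] and [V] are partial primitives of the two coefficients of the closed form
   [A dx + B dy]; the conclusion says that its integral around a rectangle is 0. *)
Section goursat.
Variables (A B U V : R -> R -> R) (a b c d : R).
Hypothesis dU : forall x y, a < x < b -> c < y < d ->
  is_derive x 1 (U^~ y) (A x y).
Hypothesis dV : forall x y, a < x < b -> c < y < d ->
  is_derive y 1 (V x) (B x y).
Hypothesis AB : forall x y, a < x < b -> c < y < d ->
  exists p m q, lin_approx A x y p m /\ lin_approx B x y m q.

Let W x y := V x y - U x y.
(** The circulation of [A dx + B dy] around the rectangle with lower left corner [(x1, y1)] and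
    sides [w], [h]. As a second difference it is additive under subdivision. *)
Let D (x1 y1 w h : R) :=
  W (x1 + w) (y1 + h) - W (x1 + w) y1 - W x1 (y1 + h) + W x1 y1.

(** The mean value theorem expresses the circulation as an increment of [B] times [h] minus an
    increment of [A] times [w]. To first order these increments are [m * w] and [m * h], with the
    same [m] because the form is closed, so the main terms cancel. *)
Let small_rect (e x y : R) : 0 < e -> a < x < b -> c < y < d ->
  exists2 r : R, 0 < r & forall x1 y1 w h, 0 <= w < r -> 0 <= h < r ->
   a < x1 -> x1 + w < b -> c < y1 -> y1 + h < d ->
   x1 <= x <= x1 + w -> y1 <= y <= y1 + h ->
   `|D x1 y1 w h| <= e * (w + h) ^+ 2.
Proof.
move=> e0 xab ycd; have [p [m [q [HA HB]]]] := AB xab ycd.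
have e20 : 0 < e / 2 by rewrite divr_gt0.
have [r1 r10 {}HA] := HA _ e20; have [r2 r20 {}HB] := HB _ e20.
exists (Num.min r1 r2); first by rewrite lt_min r10 r20.
move=> x1 y1 w h; rewrite !lt_min => /and3P[w0 wr1 wr2] /and3P[h0 hr1 hr2].
move=> ax1 x1b cy1 y1d /andP[x1x xx1] /andP[y1y yy1].
have yh : c < y1 < d by rewrite cy1 (le_lt_trans _ y1d)// lerDl.
have yh' : c < y1 + h < d by rewrite y1d (lt_le_trans cy1)// lerDl.
have xw : a < x1 < b by rewrite ax1 (le_lt_trans _ x1b)// lerDl.
have xw' : a < x1 + w < b by rewrite x1b (lt_le_trans ax1)// lerDl.
have [||xi xiw EU] := @mvt_segment (fun t => U t (y1 + h) - U t y1)
    (fun t => A t (y1 + h) - A t y1) x1 (x1 + w).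
- by rewrite lerDl.
- by move=> t /andP[t1 t2]; apply: is_deriveB; apply: dU => //;
    rewrite (lt_le_trans ax1 t1) (le_lt_trans t2 x1b).
have [||yi yih EV] := @mvt_segment (fun t => V (x1 + w) t - V x1 t)
    (fun t => B (x1 + w) t - B x1 t) y1 (y1 + h).
- by rewrite lerDl.
- by move=> t /andP[t1 t2]; apply: is_deriveB; apply: dV => //;
    rewrite (lt_le_trans cy1 t1) (le_lt_trans t2 y1d).
have -> : D x1 y1 w h = (B (x1 + w) yi - B x1 yi) * h
                        - (A xi (y1 + h) - A xi y1) * w.
  have wE : x1 + w - x1 = w by ring.
  have hE : y1 + h - y1 = h by ring.
  move: EU EV; rewrite wE hE => <- <-.
  by rewrite /D /W; ring.
move/andP: xiw => [xi1 xi2]; move/andP: yih => [yi1 yi2].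
have bnd (t s l : R) : s <= t <= s + l -> forall t', s <= t' <= s + l -> `|t' - t| <= l.
  by move=> /andP[? ?] t' /andP[? ?]; rewrite ler_norml; lra.
have bA y' : y1 <= y' <= y1 + h ->
  `|A xi y' - A x y - (p * (xi - x) + m * (y' - y))| <= e / 2 * (w + h).
  move=> y'h; have b1 : `|xi - x| <= w by apply: (bnd _ x1); rewrite ?x1x ?xi1.
  have b2 : `|y' - y| <= h by apply: (bnd _ y1); rewrite ?y1y.
  apply: le_trans (HA _ _ (le_lt_trans b1 wr1) (le_lt_trans b2 hr1)) _.
  by rewrite ler_pM2l// lerD.
have bB x' : x1 <= x' <= x1 + w ->
  `|B x' yi - B x y - (m * (x' - x) + q * (yi - y))| <= e / 2 * (w + h).
  move=> x'h; have b1 : `|x' - x| <= w by apply: (bnd _ x1); rewrite ?x1x ?xi1.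
  have b2 : `|yi - y| <= h by apply: (bnd _ y1); rewrite ?y1y ?yi1.
  apply: le_trans (HB _ _ (le_lt_trans b1 wr2) (le_lt_trans b2 hr2)) _.
  by rewrite ler_pM2l// lerD.
have y1h : y1 <= y1 + h by rewrite lerDl.
have x1w : x1 <= x1 + w by rewrite lerDl.
move: (bA y1) (bA (y1 + h)) (bB x1) (bB (x1 + w)).
rewrite !lexx /= y1h x1w => /(_ isT) + /(_ isT) + /(_ isT) + /(_ isT).
rewrite !ler_norml => /andP[a1 a2] /andP[a3 a4] /andP[b1 b2] /andP[b3 b4].
set EA := A xi (y1 + h) - A xi y1; set EB := B (x1 + w) yi - B x1 yi.
have a5 : - (e * (w + h)) <= EA - m * h <= e * (w + h) by rewrite /EA; lra.
have b5 : - (e * (w + h)) <= EB - m * w <= e * (w + h) by rewrite /EB; lra.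
have -> : EB * h - EA * w = (EB - m * w) * h - (EA - m * h) * w by ring.
move: a5 b5 => /andP[a5 a6] /andP[b5 b6]; rewrite expr2; nra.
Qed.

(** Goursat's bisection: if the circulation is not zero, then some quarter carries at least a fourth
    of it, and so on. The nested rectangles shrink to a point, where [small_rect] bounds the
    circulation by an arbitrarily small multiple of the squared perimeter. *)
Lemma goursat x1 x2 y1 y2 : a < x1 -> x1 <= x2 -> x2 < b ->
  c < y1 -> y1 <= y2 -> y2 < d ->
  V x2 y2 - V x2 y1 - V x1 y2 + V x1 y1 =
  U x2 y2 - U x2 y1 - U x1 y2 + U x1 y1.
Proof.
move=> ax1 x12 x2b cy1 y12 y2d.
set w := x2 - x1; set h := y2 - y1.
have w0 : 0 <= w by rewrite subr_ge0.
have h0 : 0 <= h by rewrite subr_ge0.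
suff D0 : D x1 y1 w h = 0 by move: D0; rewrite /D /w /h /W !subrKC; lra.
have wk0 k : 0 <= w / 2 ^+ k by rewrite divr_ge0// exprn_ge0.
have hk0 k : 0 <= h / 2 ^+ k by rewrite divr_ge0// exprn_ge0.
have halve (l : R) k : l / 2 ^+ k = l / 2 ^+ k.+1 + l / 2 ^+ k.+1.
  by rewrite exprS; field; rewrite expf_neq0.
apply/eqP; rewrite -normr_le0; apply/ler_addgt0Pr => e e0; rewrite add0r.
rewrite leNgt; apply/negP => eD.
pose s := (w + h) ^+ 2 + 1.
have s0 : 0 < s by rewrite ltr_wpDl// sqr_ge0.
(* The threshold is divided by 4 at each bisection, so badness passes to a quarter. The factor
   [e / s] makes the initial rectangle bad, and the [+ 1] in [s] keeps it meaningful when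
   [w = h = 0]. *)
pose bad k (p : R * R) := e / s * (w / 2 ^+ k + h / 2 ^+ k) ^+ 2 <
  `|D p.1 p.2 (w / 2 ^+ k) (h / 2 ^+ k)|.
have step k (p : R * R) : {q : R * R | bad k p ->
   [/\ bad k.+1 q, p.1 <= q.1 <= p.1 + w / 2 ^+ k.+1 &
       p.2 <= q.2 <= p.2 + h / 2 ^+ k.+1]}.
  apply/cid; have [bkp|] := pselect (bad k p); last by exists p.
  set w' := w / 2 ^+ k.+1; set h' := h / 2 ^+ k.+1.
  have w'0 : 0 <= w' by exact: wk0.
  have h'0 : 0 <= h' by exact: hk0.
  have [q Hq qD] : exists2 q : R * R, p.1 <= q.1 <= p.1 + w' /\ p.2 <= q.2 <= p.2 + h' &
      `|D p.1 p.2 (w / 2 ^+ k) (h / 2 ^+ k)| <= 4 * `|D q.1 q.2 w' h'|.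
    rewrite !(halve _ k) -/w' -/h'.
    have -> : D p.1 p.2 (w' + w') (h' + h') = D p.1 p.2 w' h' +
      D (p.1 + w') p.2 w' h' + D p.1 (p.2 + h') w' h' + D (p.1 + w') (p.2 + h') w' h'.
      by rewrite /D /W !addrA; ring.
    set d1 := D p.1 _ _ _; set d2 := D (p.1 + w') _ _ _.
    set d3 := D p.1 (p.2 + h') _ _; set d4 := D (p.1 + w') (p.2 + h') _ _.
    have tri : `|d1 + d2 + d3 + d4| <= `|d1| + `|d2| + `|d3| + `|d4|.
      by rewrite !(le_trans (ler_normD _ _))// lerD// (le_trans (ler_normD _ _))//
        lerD// ler_normD.
    have [L1|L1] := leP `|d1 + d2 + d3 + d4| (4 * `|d1|).
      by exists (p.1, p.2) => //=; split; lra.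
    have [L2|L2] := leP `|d1 + d2 + d3 + d4| (4 * `|d2|).
      by exists (p.1 + w', p.2) => //=; split; lra.
    have [L3|L3] := leP `|d1 + d2 + d3 + d4| (4 * `|d3|).
      by exists (p.1, p.2 + h') => //=; split; lra.
    have [L4|L4] := leP `|d1 + d2 + d3 + d4| (4 * `|d4|).
      by exists (p.1 + w', p.2 + h') => //=; split; lra.
    by exfalso; lra.
  exists q => _; case: Hq => Hq1 Hq2; split => //.
  have := lt_le_trans bkp qD; rewrite /bad !(halve _ k) -/w' -/h' => H.
  rewrite -(ltr_pM2l (_ : 0 < 4))//; apply: le_lt_trans H.
  by rewrite le_eqVlt; apply/orP; left; apply/eqP; ring.
pose q := fix q k := if k is k'.+1 then sval (step k' (q k')) else (x1, y1).
have qbad k : bad k (q k).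
  elim: k => [|k ih]; last by have [] := svalP (step k (q k)) ih.
  rewrite /bad /= !expr0 !divr1; apply: le_lt_trans eD.
  rewrite mulrAC -mulrA ler_piMr ?(ltW e0)// ler_pdivrMr// mul1r.
  by rewrite /s lerDl.
have qs k := svalP (step k (q k)) (qbad k); rewrite -/(q _) in qs.
have qS k : (q k).1 <= (q k.+1).1 <= (q k).1 + w / 2 ^+ k.+1 by case: (qs k).
have qT k : (q k).2 <= (q k.+1).2 <= (q k).2 + h / 2 ^+ k.+1 by case: (qs k).
(* The term [- w / 2 ^+ (i + k)] records that the whole side of the later rectangle, not only its
   corner, lies in the earlier one; this is what the induction needs. *)
have q1 k i : (q k).1 <= (q (i + k)%N).1 <= (q k).1 + w / 2 ^+ k - w / 2 ^+ (i + k).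
  elim: i => [|i ih]; first by rewrite add0n addrK lexx.
  have := qS (i + k)%N; have := halve w (i + k)%N; rewrite addSn; lra.
have q2 k i : (q k).2 <= (q (i + k)%N).2 <= (q k).2 + h / 2 ^+ k - h / 2 ^+ (i + k).
  elim: i => [|i ih]; first by rewrite add0n addrK lexx.
  have := qT (i + k)%N; have := halve h (i + k)%N; rewrite addSn; lra.
have lim (u : nat -> R) (l : R) : 0 <= l ->
    (forall k i, u k <= u (i + k)%N <= u k + l / 2 ^+ k - l / 2 ^+ (i + k)) ->
    exists z, forall k, u k <= z <= u k + l / 2 ^+ k.
  move=> l0 Hu; exists (sup (range u)) => k.
  have lk0 i : 0 <= l / 2 ^+ i by rewrite divr_ge0// exprn_ge0.
  have ub i j : u j <= u i + l / 2 ^+ i.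
    have [ij|ji] := leqP i j.
      by have := Hu i (j - i)%N; rewrite subnK//; have := lk0 j; lra.
    by have := Hu j (i - j)%N; rewrite subnK 1?ltnW//; have := lk0 i; lra.
  have hs : has_sup (range u).
    by split; [exists (u 0%N); exists 0%N|exists (u 0%N + l / 2 ^+ 0) => _ [j _ <-]].
  apply/andP; split; first by apply: ub_le_sup; [case: hs|exists k].
  by apply: ge_sup; [case: hs|move=> _ [j _ <-]].
have [x Hx] := lim (fun k => (q k).1) w w0 q1.
have [y Hy] := lim (fun k => (q k).2) h h0 q2.
have wE : x1 + w = x2 by rewrite /w subrKC.
have hE : y1 + h = y2 by rewrite /h subrKC.
have xab : a < x < b by have := Hx 0%N; rewrite /= expr0 divr1; lra.
have ycd : c < y < d by have := Hy 0%N; rewrite /= expr0 divr1; lra.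
have es0 : 0 < e / s by rewrite divr_gt0.
have [r r0 Hr] := small_rect es0 xab ycd.
have [k wk hk] : exists2 k : nat, w / 2 ^+ k < r & h / 2 ^+ k < r.
  have [k kr] : exists k : nat, (w + h) / r < k%:R.
    have wh0 : 0 <= (w + h) / r by apply: divr_ge0; [exact: addr_ge0|exact: ltW].
    by have := archi_boundP wh0; exists (Num.bound ((w + h) / r)).
  exists k; rewrite ltr_pdivrMr ?exprn_gt0//.
    have : k%:R <= 2 ^+ k :> R by rewrite -natrX ler_nat ltnW// ltn_expl.
    move: kr; rewrite ltr_pdivrMr//; nra.
  have : k%:R <= 2 ^+ k :> R by rewrite -natrX ler_nat ltnW// ltn_expl.
  move: kr; rewrite ltr_pdivrMr//; nra.
have := qbad k; rewrite /bad ltNge => /negP; apply.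
have := q1 0%N k; have := q2 0%N k; rewrite addn0 /= expr0 !divr1 => Q2 Q1.
apply: Hr; rewrite ?wk0 ?hk0 ?Hx ?Hy//; lra.
Qed.

End goursat.

(* By the Cauchy-Riemann equations the integral of [P] over a period in [y] does not
   depend on [x]. *)
Lemma periodic_mean_comparison P Q (a b T x1 x2 : R) : 0 < T ->
  (forall x y, a < x < b -> exists p q,
     lin_approx P x y p (- q) /\ lin_approx Q x y q p) ->
  (forall x, Q x T = Q x 0) ->
  a < x1 -> x1 < x2 -> x2 < b ->
  ~ (forall y, P x2 y < P x1 y).
Proof.
move=> T0 PQ QT ax1 x12 x2b Plt.
pose a' := (a + x1) / 2; pose b' := (b + x2) / 2.
have a'x1 : a < a' < x1 by rewrite /a'; lra.
have x2b' : x2 < b' < b by rewrite /b'; lra.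
pose AD (f : R -> R) (l r : R) : R -> R :=
  if pselect (exists F : R -> R, forall x, l < x < r -> is_derive x 1 F (f x)) is left e
  then projT1 (cid e) else f.
have ADP (f : R -> R) l r : (forall x, l <= x <= r -> {for x, continuous f}) ->
    forall x, l < x < r -> is_derive x 1 (AD f l r) (f x).
  move=> /antiderivative; rewrite /AD; case: pselect => // e _.
  by case: cid.
pose U x y := AD (Q^~ y) a' b' x.
pose V x y := AD (P x) (- 1) (T + 1) y.
have abW x : a' <= x <= b' -> a < x < b by lra.
have dU' x y : a' < x < b' -> - 1 < y < T + 1 -> is_derive x 1 (U^~ y) (Q x y).
  move=> xab _; apply: (@ADP (Q^~ y)) => // z /abW zab.
  by have [p [q [_ /lin_approx_contl]]] := PQ z y zab.
have dV' x y : a' < x < b' -> - 1 < y < T + 1 -> is_derive y 1 (V x) (P x y).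
  move=> xab ycd; apply: (@ADP (P x)) => // z _.
  have xab' : a < x < b by lra.
  by have [p [q [/lin_approx_contr]]] := PQ x z xab'.
have AB' x y : a' < x < b' -> - 1 < y < T + 1 ->
    exists p m q, lin_approx Q x y p m /\ lin_approx P x y m q.
  move=> xab ycd; have xab' : a < x < b by lra.
  by have [p [q [HP HQ]]] := PQ x y xab'; exists q, p, (- q).
have H : V x2 T - V x2 0 - V x1 T + V x1 0 = 0.
  rewrite (@goursat Q P U V a' b' (- 1) (T + 1) dU' dV' AB' x1 x2 0 T); try lra.
  (* [AD] depends only on the function it is given, so the equal slices [Q^~ T] and [Q^~ 0] receive
     the same primitive and no constant has to be adjusted. *)
  have UT x : U x T = U x 0.
    by rewrite /U (_ : Q^~ T = Q^~ 0)//; exact/funext.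
  by rewrite !UT; ring.
have dVx (x y : R) : a < x < b -> -1 < y < T + 1 -> is_derive y 1 (V x) (P x y).
  move=> xab ycd; apply: (@ADP (P x)) => // z _.
  by have [p [q [/lin_approx_contr]]] := PQ x z xab.
have [||c cT E] := @mvt_segment (fun t => V x2 t - V x1 t)
    (fun t => P x2 t - P x1 t) 0 T.
- exact: ltW.
- by move=> t tT; apply: is_deriveB; apply: dVx; lra.
have := Plt c; have := H; move: E; rewrite subr0; nra.
Qed.

End RealGoursat.

(** * Complex differentiability with real radii *)

Section EpsDelta.
Variable R : realType.
Local Notation C := (R[i]^o).

Lemma real_derive_approx (f : R -> R) (x df : R) : is_derive x 1 f df ->
  forall e : R, 0 < e -> exists2 d : R, 0 < d &
    forall h, `|h| < d -> `|f (x + h) - f x - df * h| <= e * `|h|.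
Proof.
move=> [fx <-] e e0; have := fx => /cvgrPdist_le /(_ e e0).
move=> /nbhs_ballP[d /= d0 H]; exists d => // h hd.
have [->|h0] := eqVneq h 0; first by rewrite addr0 mulr0 subrr subr0 normr0 mulr0.
have := H h; rewrite /ball/= sub0r normrN => /(_ hd h0).
rewrite /GRing.scale/= mulr1 distrC => {}H.
rewrite (_ : _ - _ - _ = (h^-1 * (f (h + x) - f x) - 'D_1 f x) * h).
  by rewrite normrM ler_wpM2r.
by rewrite (addrC x h) mulrBl mulrAC mulVf// mul1r.
Qed.

Definition cdiff (V : normedModType R[i]) (f : C -> V) (a : C) (l : V) :=
  forall e : R, 0 < e -> exists2 d : R, 0 < d &
    forall h, nrm h < d -> nrm (f (a + h) - f a - h *: l) <= e * nrm h.

Lemma derivable_cdiff (V : normedModType R[i]) (f : C -> V) a :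
  derivable f a 1 -> exists l, cdiff f a l.
Proof.
move=> fa; exists (lim ((fun h => h^-1 *: ((f \o shift a) (h *: 1) - f a)) @ 0^')) => e e0.
set l := lim _.
have e0' : 0 < e%:C by rewrite ltcR.
have := fa => /cvgrPdist_le /(_ e%:C e0') /nbhs_nrmP[d d0 H].
exists d => // h hd.
have [->|h0] := eqVneq h 0; first by rewrite addr0 scale0r subrr subr0 !nrm0 mulr0.
have := H h; rewrite subr0 => /(_ hd h0).
have hA : h *: (1 : C) = h by rewrite /GRing.scale/= mulr1.
rewrite nrmE lecR/= hA nrmB => {}H.
rewrite (_ : _ - _ - _ = h *: (h^-1 *: (f (h + a) - f a) - l)).
  by rewrite nrmZ mulrC ler_wpM2r// nrm_ge0.
by rewrite (addrC a h) [in RHS]scalerBr scalerA divff// scale1r.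
Qed.

Lemma cdiff_is_derive (V : normedModType R[i]) (f : C -> V) a l :
  cdiff f a l -> derivable f a 1 /\ lim ((fun h => h^-1 *: (f (h + a) - f a)) @ 0^') = l.
Proof.
move=> fa.
have H : (fun h => h^-1 *: (f (h + a) - f a)) @ 0^' --> l.
  apply/cvgrPdist_le => e; rewrite ltcE/= => /andP[/eqP ei e0].
  have [d d0 H] := fa _ e0.
  apply/nbhs_nrmP; exists d => // h; rewrite subr0 => hd h0.
  rewrite nrmE lecE/= ei eqxx/= nrmB.
  have h0' : 0 < nrm h by rewrite nrm_gt0.
  rewrite -(ler_pM2l h0') -nrmZ scalerBr scalerA divff// scale1r.
  by rewrite (addrC h a) [leRHS]mulrC; exact: H.
split; last by apply/cvg_lim.
rewrite /derivable; apply/cvg_ex; exists l.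
rewrite (_ : (fun h => _) = (fun h => h^-1 *: (f (h + a) - f a)))//.
apply/funext => h /=; congr (_ *: (f (_ + a) - _)).
by rewrite /GRing.scale/= mulr1.
Qed.

Lemma cdiff_cont (V : normedModType R[i]) (f : C -> V) a l : cdiff f a l ->
  forall e : R, 0 < e -> exists2 d : R, 0 < d &
    forall z, nrm (z - a) < d -> nrm (f z - f a) < e.
Proof.
move=> /(_ 1 ltr01)[d d0 H] e e0.
have l1 : 0 < 1 + nrm l by rewrite ltr_pwDl// nrm_ge0.
exists (Num.min d (e / (1 + nrm l))); first by rewrite lt_min d0 divr_gt0.
move=> z; rewrite lt_min => /andP[zd ze].
have := H _ zd; rewrite subrKC mul1r => {}H.
rewrite -[f z - f a](subrK ((z - a) *: l)) (le_lt_trans (nrmD _ _))//.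
rewrite nrmZ; move: ze; rewrite ltr_pdivlMr//.
have := nrm_ge0 (z - a); lra.
Qed.

Lemma cdiffM (f g : C -> C) a l m : cdiff f a l -> cdiff g a m ->
  cdiff (fun z => f z * g z) a (l * g a + f a * m).
Proof.
move=> hf hg e e0.
pose S := nrm l + nrm m + nrm (f a) + nrm (g a) + 1.
have S1 : 1 <= S by rewrite /S lerDr; rewrite !addr_ge0 ?nrm_ge0.
have S0 : 0 < S by rewrite (lt_le_trans ltr01).
pose e' := Num.min 1 (e / (4 * S)).
have e'0 : 0 < e' by rewrite lt_min ltr01 divr_gt0// mulr_gt0.
have e'1 : e' <= 1 by rewrite ge_min lexx.
have e'2 : 4 * S * e' <= e.
  by rewrite mulrC -ler_pdivlMr ?mulr_gt0// ge_min lexx orbT.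
have [d1 d10 H1] := hf _ e'0; have [d2 d20 H2] := hg _ e'0.
have [d3 d30 H3] := cdiff_cont hg e'0.
exists (Num.min d1 (Num.min d2 d3)); first by rewrite !lt_min d10 d20.
move=> h; rewrite !lt_min => /and3P[hd1 hd2 hd3].
have := H1 _ hd1; have := H2 _ hd2.
have := H3 (a + h); rewrite addrAC subrr add0r => /(_ hd3).
set df := f (a + h) - f a - _; set dg := g (a + h) - g a - _.
move=> G3 G2 G1.
have -> : f (a + h) * g (a + h) - f a * g a - h *: (l * g a + f a * m) =
   df * (g a) + df * (g (a + h) - g a) + h * l * (g (a + h) - g a) + f a * dg.
  by rewrite /df /dg /GRing.scale/=; ring.
rewrite (le_trans (nrmD _ _))//.
have B1 : nrm (df * g a) <= e' * nrm h * S.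
  rewrite nrmM ler_pM ?nrm_ge0// /S.
  have := nrm_ge0 l; have := nrm_ge0 m; have := nrm_ge0 (f a); lra.
have B2 : nrm (df * (g (a + h) - g a)) <= e' * nrm h * S.
  rewrite nrmM ler_pM ?nrm_ge0//; lra.
have B3 : nrm (h * l * (g (a + h) - g a)) <= e' * nrm h * S.
  rewrite !nrmM mulrC -mulrA ler_pM ?mulr_ge0 ?nrm_ge0//; first exact: ltW.
  rewrite ler_wpM2l ?nrm_ge0// /S.
  have := nrm_ge0 (g a); have := nrm_ge0 m; have := nrm_ge0 (f a); lra.
have B4 : nrm (f a * dg) <= e' * nrm h * S.
  rewrite nrmM mulrC ler_pM ?nrm_ge0// /S.
  have := nrm_ge0 l; have := nrm_ge0 m; have := nrm_ge0 (g a); lra.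
have -> : e * nrm h = nrm h * e by rewrite mulrC.
have := ler_wpM2l (nrm_ge0 h) e'2.
have := nrmD (df * g a + df * (g (a + h) - g a)) (h * l * (g (a + h) - g a)).
have := nrmD (df * g a) (df * (g (a + h) - g a)).
set X := e' * _ * S in B1 B2 B3 B4.
have -> : nrm h * (4 * S * e') = 4 * X by rewrite /X; ring.
lra.
Qed.

Lemma cdiffD (V : normedModType R[i]) (f g : C -> V) a l m :
  cdiff f a l -> cdiff g a m -> cdiff (fun z => f z + g z) a (l + m).
Proof.
move=> hf hg e e0; have e20 : 0 < e / 2 by rewrite divr_gt0.
have [d1 d10 H1] := hf _ e20; have [d2 d20 H2] := hg _ e20.
exists (Num.min d1 d2) => [|h]; rewrite lt_min ?d10// => /andP[/H1 G1 /H2 G2].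
rewrite scalerDr !opprD (addrACA (f (a + h)) (g (a + h)) (- f a))
  (addrACA (f (a + h) - f a)).
by rewrite (le_trans (nrmD _ _))//; lra.
Qed.

Lemma cdiff_cst (V : normedModType R[i]) (c : V) a : cdiff (fun=> c) a 0.
Proof.
move=> e e0; exists 1 => // h _.
by rewrite subrr scaler0 subr0 nrm0 mulr_ge0 ?nrm_ge0// ltW.
Qed.

Lemma cdiff_scale (V : normedModType R[i]) (c : V) a : cdiff (fun z => z *: c) a c.
Proof.
move=> e e0; exists 1 => // h _.
by rewrite scalerDl addrAC addrK subrr nrm0 mulr_ge0 ?nrm_ge0// ltW.
Qed.

Lemma cdiff_inv (a : C) : a != 0 -> cdiff (fun z : C => z^-1 : C) a (- (a ^- 2) : C).
Proof.
move=> a0 e e0; have na0 : 0 < nrm a by rewrite nrm_gt0.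
pose d := Num.min (nrm a / 2) (e * nrm a ^+ 3 / 2).
exists d; first by rewrite lt_min !divr_gt0// mulr_gt0// exprn_gt0.
move=> h; rewrite lt_min => /andP[h1 h2].
have ah : nrm a / 2 <= nrm (a + h).
  have := nrm_lb a h; lra.
have ah0 : a + h != 0 by rewrite -nrm_gt0; lra.
have -> : (a + h)^-1 - a^-1 - h *: - a ^- 2 = h * (h * ((a + h)^-1 * a ^- 2)) :> C.
  by rewrite /GRing.scale/=; field; rewrite a0.
have nV (z : C) : z != 0 -> nrm z * nrm (z^-1 : C) = 1.
  by move=> z0; rewrite -nrmM divff// nrm1.
rewrite nrmM mulrC ler_wpM2r ?nrm_ge0// !nrmM.
have := nV _ ah0; have : nrm (a ^+ 2) * nrm (a ^- 2 : C) = 1 by rewrite nV// expf_neq0.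
rewrite nrmX => V1 V2.
have v10 : 0 <= nrm (a ^- 2 : C) by exact: nrm_ge0.
have v20 : 0 <= nrm ((a + h)^-1 : C) by exact: nrm_ge0.
have h0 := nrm_ge0 h.
set x := nrm a in na0 h1 h2 ah V1 *; set y := nrm (a + h) in ah V2 *.
set v := nrm (a ^- 2 : C) in V1 v10 *; set w := nrm ((a + h)^-1 : C) in V2 v20 *.
have W : w * x <= 2 by nra.
have P : nrm h * (w * v) * (x ^+ 3) <= e * x ^+ 3.
  have -> : nrm h * (w * v) * (x ^+ 3) = nrm h * (w * x) * (x ^+ 2 * v) by ring.
  rewrite V1 mulr1; nra.
by move: P; rewrite ler_pM2r// exprn_gt0.
Qed.

Lemma cdiff_eq (V : normedModType R[i]) (f g : C -> V) a l (d : R) : 0 < d ->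
  (forall z, nrm (z - a) < d -> f z = g z) -> cdiff f a l -> cdiff g a l.
Proof.
move=> d0 fg hf e e0; have [d' d'0 H] := hf e e0.
exists (Num.min d d') => [|h]; rewrite lt_min ?d0// => /andP[hd hd'].
rewrite -!fg ?subrr ?nrm0//; first exact: H.
by rewrite addrAC subrr add0r.
Qed.

Lemma compact_max (V : normedModType R[i]) (A : set V) (f : V -> R) :
  A !=set0 -> compact A ->
  (forall x, A x -> forall e : R, 0 < e -> exists2 d : R, 0 < d &
     forall y, A y -> nrm (y - x) < d -> `|f y - f x| < e) ->
  exists2 c, A c & forall t, A t -> f t <= f c.
Proof.
move=> A0 Ac fc; have [|c /set_mem Ac' H] := compact_EVT_max A0 Ac (f := f).
  apply/subspace_continuousP => x Ax; apply/cvgrPdist_lt => e e0.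
  have [d d0 H] := fc x Ax e e0.
  by apply/nbhs_nrmP; exists d => // y yd Ay /=; rewrite distrC; exact: H.
by exists c => // t At; apply: H; rewrite inE.
Qed.

Lemma closed_nrm_le (V : normedModType R[i]) (c : V) (r : R) :
  closed [set z | nrm (z - c) <= r].
Proof.
rewrite -openC openE => z /= /negP; rewrite -ltNge => rz.
apply/nbhs_nrmP; exists (nrm (z - c) - r); first by rewrite subr_gt0.
move=> y yz /=; apply/negP; rewrite -ltNge.
have := nrm_triangle y z c; rewrite (nrmB z y); lra.
Qed.

Lemma compact_disc (r : R) : compact [set z : C | nrm z <= r].
Proof.
have : closed [set z : C | nrm z <= r].
  rewrite (_ : [set _ | _] = [set z : C | nrm (z - 0) <= r]); last first.
    by apply/seteqP; split => z /=; rewrite subr0.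
  exact: closed_nrm_le.
move=> cl; apply: (subclosed_compact cl (@compact_cdisc R r)) => z /= zr.
by split; [apply: le_trans (Re_le_nrm _) _|apply: le_trans (Im_le_nrm _) _].
Qed.

End EpsDelta.

(** * Logarithmic polar coordinates, maximum principle, Schwarz lemma *)

Section Schwarz.
Variable R : realType.
Local Notation C := (R[i]^o).
Implicit Types (x y u v : R) (z a : C) (f g H : C -> C).

Lemma expi0 : expi 0 = 1 :> C.
Proof. by rewrite /expi cos0 sin0. Qed.

Lemma expiD x y : expi (x + y) = expi x * expi y :> C.
Proof.
by rewrite /expi; apply: cplx_eq => /=; rewrite ?cosD ?sinD//; ring.
Qed.

Lemma expi2pi : expi (2 * pi) = 1 :> C.
Proof. by rewrite /expi mulr_natl cos2pi sin2pi. Qed.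

Lemma nrm_expi x : nrm (expi x : C) = 1.
Proof. by rewrite nrmCE/= cos2Dsin2 sqrtr1. Qed.

(** The complex exponential of [x + iy]. Circles around a centre become segments [x = const] of
    length [2 pi], and composition with it preserves the Cauchy-Riemann equations. *)
Definition polar x y : C := (expR x)%:C * expi y.

Lemma polarD x y u v : polar (x + u) (y + v) = polar x y * polar u v.
Proof. by rewrite /polar expRD expiD rmorphM/=; ring. Qed.

Lemma nrm_polar x y : nrm (polar x y) = expR x.
Proof. by rewrite nrmM nrm_expi mulr1 nrmR ger0_norm// expR_ge0. Qed.

Lemma polar_approx0 (e : R) : 0 < e -> exists2 d : R, 0 < d & forall u v,
  `|u| < d -> `|v| < d -> nrm (polar u v - 1 - (u +i* v) : C) <= e * (`|u| + `|v|).
Proof.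
move=> e0; have e5 : 0 < e / 5 by rewrite divr_gt0.
have [d1 d10 H1] := real_derive_approx (is_derive_expR 0) e5.
have [d2 d20 H2] := real_derive_approx (is_derive_cos 0) e5.
have [d3 d30 H3] := real_derive_approx (is_derive_sin 0) e5.
exists (Num.min (Num.min 1 (e / 5)) (Num.min d1 (Num.min d2 d3))).
  by rewrite !lt_min ltr01 e5 d10 d20.
move=> u v; rewrite !lt_min => /andP[/andP[u1 ue] /and3P[ud1 _ _]].
move=> /andP[_ /and3P[_ vd2 vd3]].
have := H1 _ ud1; have := H2 _ vd2; have := H3 _ vd3.
rewrite !add0r expR0 cos0 sin0 oppr0 mul0r !subr0 ?addr0 !mul1r => G3 G2 G1.
rewrite (le_trans (nrm_le_ReIm _))//.
have -> : complex.Re (polar u v - 1 - (u +i* v) : C) =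
   (expR u - 1 - u) * cos v + (1 + u) * (cos v - 1).
  by rewrite /polar /expi /=; ring.
have -> : complex.Im (polar u v - 1 - (u +i* v) : C) =
   (expR u - 1 - u) * sin v + (1 + u) * (sin v - v) + u * v.
  by rewrite /polar /expi /=; ring.
have bu : `|1 + u| <= 2 by rewrite (le_trans (ler_normD _ _))// normr1; lra.
have b1 : `|(expR u - 1 - u) * cos v| <= e / 5 * `|u|.
  by rewrite normrM -[leRHS]mulr1 ler_pM// ler_norml cos_geN1 cos_le1.
have b2 : `|(expR u - 1 - u) * sin v| <= e / 5 * `|u|.
  by rewrite normrM -[leRHS]mulr1 ler_pM// ler_norml sin_geN1 sin_le1.
have b3 : `|(1 + u) * (cos v - 1)| <= 2 * (e / 5 * `|v|) by rewrite normrM ler_pM.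
have b4 : `|(1 + u) * (sin v - v)| <= 2 * (e / 5 * `|v|) by rewrite normrM ler_pM.
have b5 : `|u * v| <= e / 5 * `|v|.
  by rewrite normrM ler_wpM2r// (ltW ue).
have t1 := ler_normD ((expR u - 1 - u) * cos v) ((1 + u) * (cos v - 1)).
have t2 := ler_normD ((expR u - 1 - u) * sin v + (1 + u) * (sin v - v)) (u * v).
have t3 := ler_normD ((expR u - 1 - u) * sin v) ((1 + u) * (sin v - v)).
have := normr_ge0 u; have := normr_ge0 v; move: e0; nra.
Qed.

(** Chain rule for [H] composed with [z0 + exp]. The differential is multiplication by the complex
    number [polar x y * l]; its real and imaginary parts supply the coefficients that
    [periodic_mean_comparison] asks for. *)
Lemma cdiff_polar H (z0 : C) x y l : cdiff H (z0 + polar x y) l ->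
  forall e : R, 0 < e -> exists2 d : R, 0 < d & forall x' y',
    `|x' - x| < d -> `|y' - y| < d ->
    nrm (H (z0 + polar x' y') - H (z0 + polar x y)
         - ((x' - x) +i* (y' - y)) * (polar x y * l) : C)
      <= e * (`|x' - x| + `|y' - y|).
Proof.
move=> hH e e0; set r := expR x; have r0 : 0 < r by exact: expR_gt0.
have nl := nrm_ge0 l.
have e20 : 0 < e / (4 * r) by rewrite divr_gt0// mulr_gt0.
have [d1 d10 H1] := hH _ e20.
pose e3 := Num.min 1 (e / (2 * r * (1 + nrm l))).
have nl1 : 0 < 1 + nrm l by lra.
have e30 : 0 < e3 by rewrite lt_min ltr01 divr_gt0// !mulr_gt0.
have [d2 d20 H2] := polar_approx0 e30.
exists (Num.min d2 (d1 / (4 * r))); first by rewrite lt_min d20 divr_gt0// mulr_gt0.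
move=> x' y'; rewrite !lt_min => /andP[x2 x1] /andP[y2 y1].
have {H2} := H2 _ _ x2 y2.
set u := x' - x in x1 x2 *; set v := y' - y in y1 y2 *; move=> H2.
have -> : x' = x + u by rewrite /u subrKC.
have -> : y' = y + v by rewrite /v subrKC.
have np : nrm (polar x y) = r by exact: nrm_polar.
rewrite polarD; set p := polar x y in np *; set w : C := u +i* v.
set rest : C := polar u v - 1 - w.
have nw : nrm w <= `|u| + `|v| by exact: nrm_le_ReIm.
have nh : p * polar u v = p + p * (w + rest) by rewrite /rest; ring.
have s0 : 0 <= `|u| + `|v| by rewrite addr_ge0.
have nrest1 : nrm rest <= `|u| + `|v|.
  by rewrite (le_trans H2)// ler_piMl// ge_min lexx.
have nrest2 : r * (1 + nrm l) * nrm rest <= e / 2 * (`|u| + `|v|).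
  have : e3 <= e / (2 * r * (1 + nrm l)) by rewrite ge_min lexx orbT.
  rewrite ler_pdivlMr ?mulr_gt0// => He3.
  have := ler_wpM2l (ltW (mulr_gt0 r0 nl1)) H2; nra.
have nwr : nrm (p * (w + rest)) <= 2 * r * (`|u| + `|v|).
  rewrite nrmM np -mulrA mulrCA ler_wpM2l ?(ltW r0)//.
  have := nrmD w rest; lra.
have hd : nrm (p * (w + rest)) < d1.
  rewrite (le_lt_trans nwr)//; move: x1 y1; rewrite !ltr_pdivlMr ?mulr_gt0//; nra.
have {H1} := H1 _ hd; rewrite -/p nh (addrA z0 p) => H1.
rewrite /GRing.scale/= in H1; set q : C := H _ - H _ in H1 *.
rewrite (_ : _ - _ = (q - p * (w + rest) * l) + p * rest * l); last by ring.
rewrite (le_trans (nrmD _ _))// [nrm (p * rest * l)]nrmM [nrm (p * rest)]nrmM np.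
have nr0 := nrm_ge0 rest.
have E1 : e / (4 * r) * nrm (p * (w + rest)) <= e / 2 * (`|u| + `|v|).
  rewrite (le_trans (ler_wpM2l (ltW e20) nwr))// le_eqVlt; apply/orP; left; apply/eqP.
  by field; rewrite gt_eqF.
have E2 : r * nrm rest * nrm l <= r * (1 + nrm l) * nrm rest.
  by rewrite mulrAC ler_wpM2r// ler_wpM2l ?(ltW r0)// lerDr.
rewrite (le_trans (lerD (le_trans H1 E1) (le_trans E2 nrest2)))//; lra.
Qed.

(** The means of [Re H] over the circle of radius [rho] and over a tiny circle agree, yet by
    continuity at [z0] the integrand on the tiny circle exceeds [Re (H z0) - c]. The centre is
    excluded from differentiability so that difference quotients can be treated. *)
Lemma circle_mean_comparison H (z0 : C) (r rho c : R) : 0 < rho -> rho < r -> 0 < c ->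
  (forall z, 0 < nrm (z - z0) -> nrm (z - z0) < r -> exists l, cdiff H z l) ->
  (forall e : R, 0 < e -> exists2 d : R, 0 < d &
    forall z, nrm (z - z0) < d -> nrm (H z - H z0) < e) ->
  ~ (forall z, nrm (z - z0) = rho -> complex.Re (H z) <= complex.Re (H z0) - c).
Proof.
move=> rho0 rhor c0 dH cH Hle.
have [d d0 {}cH] := cH _ c0.
have r0 : 0 < r by exact: lt_trans rhor.
pose m := Num.min d rho / 2.
have m0 : 0 < m by rewrite divr_gt0// lt_min d0.
have md : m < d by have := ge_min d d rho; rewrite lexx /= /m; lra.
have mrho : m < rho by have := ge_min rho d rho; rewrite lexx orbT /= /m; lra.
pose P x y := complex.Re (H (z0 + polar x y)).
pose Q x y := complex.Im (H (z0 + polar x y)).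
apply: (@periodic_mean_comparison R P Q (ln m - 1) (ln r) (2 * pi) (ln m) (ln rho)).
- by rewrite mulr_gt0// pi_gt0.
- move=> x y /andP[_ xr].
  have [l hl] : exists l, cdiff H (z0 + polar x y) l.
    apply: dH; rewrite addrAC subrr add0r nrm_polar ?expR_gt0//.
    by rewrite -[ltRHS]lnK// ltr_expR.
  set L := polar x y * l.
  exists (complex.Re L), (complex.Im L); split=> e e0;
    have [d' d'0 H'] := cdiff_polar hl e0; exists d' => // x' y' x'd y'd;
    apply: le_trans (H' x' y' x'd y'd).
  + apply: le_trans (Re_le_nrm _); rewrite -/L /P.
    rewrite le_eqVlt; apply/orP; left; apply/eqP; congr `|_|.
    by case: (H _) (H _) L => [? ?] [? ?] [? ?] /=; ring.
  + apply: le_trans (Im_le_nrm _); rewrite -/L /Q.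
    rewrite le_eqVlt; apply/orP; left; apply/eqP; congr `|_|.
    by case: (H _) (H _) L => [? ?] [? ?] [? ?] /=; ring.
- by move=> x; rewrite /Q /polar expi2pi expi0.
- lra.
- by rewrite ltr_ln.
- by rewrite ltr_ln.
move=> y; rewrite /P (le_lt_trans (Hle _ _))//.
  by rewrite addrAC subrr add0r nrm_polar lnK.
have := cH (z0 + polar (ln m) y); rewrite addrAC subrr add0r nrm_polar lnK//.
move=> /(_ md); have := Re_le_nrm (H (z0 + polar (ln m) y) - H z0).
rewrite ler_norml raddfB/=; lra.
Qed.

(** Splits [|z|^2] at [a] into the real part of a holomorphic affine function and the strictly
    convex remainder [|z - a|^2], so that a quadratic perturbation can be exchanged for a
    holomorphic one. *)
Lemma Re_conj_mul_expand (a z : C) :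
  nrm z ^+ 2 = nrm a ^+ 2 + 2 * complex.Re (a^* * (z - a)) + nrm (z - a) ^+ 2.
Proof. by rewrite !sqr_nrm; case: a z => [? ?] [? ?] /=; ring. Qed.

(* At a maximum [z0] of [|g| + eps |z|^2] the function
   [c g + 2 eps z0^* (z - z0)], with [c] unimodular, violates the mean comparison
   on small circles around [z0]. *)
Lemma max_principle g (r M : R) : 0 < r ->
  (forall z, z != 0 -> nrm z <= r -> exists l, cdiff g z l) ->
  (forall e : R, 0 < e -> exists2 d : R, 0 < d &
    forall z, nrm z < d -> nrm (g z - g 0) < e) ->
  (forall z, nrm z = r -> nrm (g z) <= M) ->
  forall z, nrm z < r -> nrm (g z) <= M.
Proof.
move=> r0 dg cg gM a ar; rewrite leNgt; apply/negP => Ma.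
have cg' z : nrm z <= r -> forall e : R, 0 < e -> exists2 d : R, 0 < d &
    forall y : C, nrm (y - z) < d -> nrm (g y - g z) < e.
  move=> zr; have [->|z0] := eqVneq z 0.
    by move=> e /cg[d d0 H]; exists d => // y; rewrite subr0; exact: H.
  by have [l /cdiff_cont] := dg z z0 zr.
have r20 : 0 < r ^+ 2 by rewrite exprn_gt0.
(* On the circle the perturbation costs half of the gap [nrm (g a) - M], so the maximum of [psi]
   cannot lie there. *)
have [eps eps0 epsE] : exists2 eps : R, 0 < eps & eps * r ^+ 2 = (nrm (g a) - M) / 2.
  exists ((nrm (g a) - M) / (2 * r ^+ 2)); first by rewrite divr_gt0 ?subr_gt0// mulr_gt0.
  by field; rewrite gt_eqF.
pose psi z := nrm (g z) + eps * nrm z ^+ 2.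
have [||z0 /= z0r zmax] := @compact_max R C [set z | nrm z <= r] psi _ (@compact_disc R r).
- by exists 0; rewrite /= nrm0 ltW.
- move=> z /= zr e e0; have e20 : 0 < e / 2 by rewrite divr_gt0.
  have [d d0 H] := cg' z zr _ e20.
  pose d' := e / (2 * (2 * r * eps)).
  have d'0 : 0 < d' by rewrite divr_gt0// !mulr_gt0.
  exists (Num.min d d'); first by rewrite lt_min d0.
  move=> y yr; rewrite lt_min => /andP[yd yd'].
  have gyz : `|nrm (g y) - nrm (g z)| <= nrm (g y - g z).
    have h1 := nrm_lb (g y) (- g z); have h2 := nrm_lb (g z) (- g y).
    by move: h1 h2; rewrite !nrmN (nrmB (g z)) ler_norml; lra.
  have yz : `|nrm y - nrm z| <= nrm (y - z).
    have h1 := nrm_lb y (- z); have h2 := nrm_lb z (- y).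
    by move: h1 h2; rewrite !nrmN (nrmB z) ler_norml; lra.
  have -> : psi y - psi z = (nrm (g y) - nrm (g z)) +
      eps * (nrm y + nrm z) * (nrm y - nrm z) by rewrite /psi; ring.
  rewrite (le_lt_trans (ler_normD _ _))//.
  have : `|eps * (nrm y + nrm z) * (nrm y - nrm z)| <= e / 2.
    rewrite !normrM (gtr0_norm eps0) ger0_norm ?addr_ge0 ?nrm_ge0//.
    move: yd'; rewrite ltr_pdivlMr ?mulr_gt0// => yd'.
    have h0 := nrm_ge0 (y - z).
    have : eps * (nrm y + nrm z) * `|nrm y - nrm z| <= eps * (2 * r) * nrm (y - z).
      apply: ler_pM; rewrite ?mulr_ge0 ?addr_ge0 ?nrm_ge0 ?(ltW eps0)//.
      by rewrite ler_pM2l//; lra.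
    nra.
  have := H _ yd; lra.
have z0r' : nrm z0 < r.
  rewrite lt_neqAle z0r andbT; apply/eqP => z0E.
  have := zmax a (ltW ar); rewrite /psi z0E epsE.
  have := gM _ z0E; have : 0 <= eps * nrm a ^+ 2 by rewrite mulr_ge0 ?sqr_ge0 ?ltW.
  lra.
have [c cn cE] : exists2 c : C, nrm c = 1 & complex.Re (c * g z0) = nrm (g z0).
  have [g0|g0] := eqVneq (g z0) 0.
    by exists 1; rewrite ?nrm1// g0 mulr0 nrm0.
  have ng0 : 0 < nrm (g z0) by rewrite nrm_gt0.
  exists ((nrm (g z0))^-1%:C * (g z0)^*).
    have -> : nrm ((nrm (g z0))^-1%:C * (g z0)^* : C) = (nrm (g z0))^-1 * nrm (g z0).
      rewrite nrmM nrmR gtr0_norm ?invr_gt0//; congr (_ * _).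
      by rewrite !nrmCE; case: (g z0) => ? ? /=; rewrite sqrrN.
    by rewrite mulVf// gt_eqF.
  have -> : complex.Re ((nrm (g z0))^-1%:C * (g z0)^* * g z0) = (nrm (g z0))^-1 * nrm (g z0) ^+ 2.
    by rewrite sqr_nrm; case: (g z0) (nrm _) => ? ? ? /=; ring.
  by rewrite expr2 mulrA mulVf ?mul1r// gt_eqF.
pose H z := c * g z + (2 * eps)%:C * z0^* * (z - z0).
(* The punctured disc around [z0] must avoid 0, where [g] is only known to be continuous; [z0 = 0]
   itself is allowed as the centre. *)
have [rr [rr0 rr1 rr2]] : exists rr : R, [/\ 0 < rr, nrm z0 + rr <= r &
    forall z, 0 < nrm (z - z0) -> nrm (z - z0) < rr -> z != 0].
  have [z00|z00] := eqVneq z0 0.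
    exists r; split=> //; first by rewrite z00 nrm0 add0r.
    by move=> z; rewrite z00 subr0 nrm_gt0.
  exists (Num.min (r - nrm z0) (nrm z0)); split.
  - by rewrite lt_min subr_gt0 z0r' nrm_gt0.
  - by rewrite -lerBrDl ge_min lexx.
  - move=> z _; apply: contraPneq => ->; rewrite sub0r nrmN lt_min.
    by rewrite ltxx andbF.
have hrr : rr / 2 < rr by lra.
have hrr0 : 0 < rr / 2 by lra.
have hc : 0 < eps * (rr / 2) ^+ 2 by rewrite mulr_gt0// exprn_gt0.
have H0 : H z0 = c * g z0 by rewrite /H subrr mulr0 addr0.
apply: (@circle_mean_comparison H z0 rr (rr / 2) _ hrr0 hrr hc).
- move=> z zz1 zz2; have z0' := rr2 z zz1 zz2.
  have zr : nrm z <= r.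
    by have := nrmD (z - z0) z0; rewrite subrK; lra.
  have [l hl] := dg z z0' zr.
  have h1 := cdiffM (cdiff_cst c z) hl.
  have h2 := cdiffM (cdiff_cst ((2 * eps)%:C * z0^* : C) z)
    (cdiffD (cdiff_scale (1 : C) z) (cdiff_cst (- z0) z)).
  have := cdiffD h1 h2.
  set l' := (X in cdiff _ _ X) => h3; exists l'; move: h3.
  apply: (@cdiff_eq _ _ _ _ _ _ 1) => // y _; rewrite /H /GRing.scale/= mulr1//.
- move=> e e0; have e20 : 0 < e / 2 by rewrite divr_gt0.
  have [d d0 Hd] := cg' z0 z0r _ e20.
  have k0 : 0 < 2 * eps * r by rewrite !mulr_gt0.
  exists (Num.min d (e / 2 / (2 * eps * r))).
    by rewrite lt_min d0 divr_gt0.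
  move=> z; rewrite lt_min => /andP[/Hd gz zz].
  rewrite H0 /H addrAC -mulrBr (le_lt_trans (nrmD _ _))// nrmM cn mul1r.
  move: zz; rewrite ltr_pdivlMr// => zz.
  have : nrm ((2 * eps)%:C * z0^* * (z - z0) : C) <= 2 * eps * r * nrm (z - z0).
    rewrite !nrmM nrmR gtr0_norm ?mulr_gt0// ler_wpM2r ?nrm_ge0// ler_wpM2l ?mulr_ge0 ?(ltW eps0)//.
    suff -> : nrm (z0^* : C) = nrm z0 by [].
    by rewrite !nrmCE; case: (z0) => ? ? /=; rewrite sqrrN.
  lra.
move=> z zz; rewrite H0 cE.
have zr : nrm z <= r.
  by have := nrmD (z - z0) z0; rewrite subrK zz; lra.
have := zmax z zr; rewrite /psi (Re_conj_mul_expand z0 z) zz => hz.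
have -> : complex.Re (H z) = complex.Re (c * g z) + 2 * eps * complex.Re (z0^* * (z - z0)).
  have ReE (k : R) (s t w : C) : complex.Re (w + k%:C * s * t) = complex.Re w + k * complex.Re (s * t).
    by case: s t w => [? ?] [? ?] [? ?] /=; ring.
  by rewrite /H ReE.
have : complex.Re (c * g z) <= nrm (g z).
  by rewrite -[leRHS]mul1r -cn -nrmM (le_trans (ler_norm _))// Re_le_nrm.
lra.
Qed.

(** The difference quotient at 0, completed by the derivative, satisfies the maximum principle on
    the disc of radius 1/2, on whose boundary it is at most [2 B / (1/2) = 4 B]. For [nrm a >= 1/2]
    the trivial bound [2 B] suffices. *)
Lemma schwarz_lipschitz f (B : R) :
  (forall z, nrm z < 1 -> exists l, cdiff f z l) ->
  (forall z, nrm z < 1 -> nrm (f z) <= B) ->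
  forall a, nrm a < 1 -> nrm (f a - f 0) <= 4 * B * nrm a.
Proof.
move=> df fB a a1.
have B0 : 0 <= B by apply: le_trans (nrm_ge0 (f 0)) (fB _ _); rewrite nrm0.
have fd z : nrm z < 1 -> nrm (f z - f 0) <= 2 * B.
  move=> z1; have := fB z z1; have := fB 0; rewrite nrm0 => /(_ ltr01).
  have := nrmD (f z) (- f 0); rewrite nrmN; lra.
have [a2|a2] := ltP (nrm a) (2^-1); last first.
  have := fd a a1; nra.
have [l hl] : exists l, cdiff f 0 l by apply: df; rewrite nrm0.
pose g z : C := if z == 0 then l else (f z - f 0) * z^-1.
have [a0|a0] := eqVneq a 0; first by rewrite a0 subrr !nrm0 mulr0.
suff : nrm (g a) <= 4 * B.
  rewrite /g (negbTE a0) => H.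
  have -> : f a - f 0 = (f a - f 0) * a^-1 * a by rewrite mulfVK.
  by rewrite nrmM ler_wpM2r// nrm_ge0.
have h20 : 0 < 2^-1 :> R by rewrite invr_gt0.
apply: (@max_principle g 2^-1) => //.
- move=> z z0 z2; have [m hm] : exists m, cdiff f z m by apply: df; lra.
  have := cdiffM (cdiffD hm (cdiff_cst (- f 0) z)) (cdiff_inv z0).
  set l' := (X in cdiff _ _ X) => h3; exists l'; move: h3.
  apply: (@cdiff_eq _ _ _ _ _ _ (nrm z)); first by rewrite nrm_gt0.
  move=> y; rewrite /g; case: eqP => // ->; by rewrite sub0r nrmN ltxx.
- move=> e e0; have e20 : 0 < e / 2 by rewrite divr_gt0.
  have [d d0 H] := hl _ e20; exists d => // z zd; rewrite /g eqxx.
  have [_|z0] := eqVneq z 0; first by rewrite subrr nrm0.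
  have nz : 0 < nrm z by rewrite nrm_gt0.
  rewrite -(ltr_pM2l nz) -nrmM mulrBr mulrCA divff// mulr1.
  have := H z zd; rewrite add0r => H'; rewrite (le_lt_trans H')// mulrC ltr_pM2l//; lra.
- move=> z z2; have z0 : z != 0 by rewrite -nrm_gt0 z2.
  rewrite /g (negbTE z0) nrmM.
  have -> : nrm (z^-1 : C) = 2.
    have : nrm z * nrm (z^-1 : C) = 1 by rewrite -nrmM divff// nrm1.
    rewrite z2; lra.
  have : nrm z < 1 by rewrite z2; lra.
  by move=> /fd; lra.
Qed.

End Schwarz.

(** * Second order Taylor expansion of defining functions *)

Section RealLinear.
Variables (R : realType) (n : nat).
Local Notation C := (R[i]^o).
Local Notation Cn := ('C^n(R)).

Definition rlin (F : Cn -> R) :=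
  (forall h k, F (h + k) = F h + F k) /\
  (forall (a : R) h, F (a%:C *: h) = a * F h).

Definition rbasis (t : 'I_n * bool) : Cn :=
  (if t.2 then 'i else 1 : C) *: delta_mx 0 t.1.

Definition rcoord (h : Cn) (t : 'I_n * bool) : R :=
  if t.2 then complex.Im (h 0 t.1) else complex.Re (h 0 t.1).

Lemma rcoord_le h t : `|rcoord h t| <= nrm h.
Proof.
rewrite /rcoord (le_trans _ (nrm_coord h t.1))//.
by case: t.2; [exact: Im_le_nrm|exact: Re_le_nrm].
Qed.

Lemma rlin_sum F (I : Type) (s : seq I) (a : I -> R) (b : I -> Cn) : rlin F ->
  F (\sum_(i <- s) (a i)%:C *: b i) = \sum_(i <- s) a i * F (b i).
Proof.
move=> [FD FZ]; elim: s => [|i s ih]; last by rewrite !big_cons FD FZ ih.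
by rewrite !big_nil -[0 in LHS](scale0r (0 : Cn)) -[0 in LHS]/(0%:C) FZ mul0r.
Qed.

Lemma rbasisE t k : rbasis t 0 k = (if t.2 then 'i else 1 : C) * (t.1 == k)%:R.
Proof. by rewrite /rbasis mxE mxE eqxx eq_sym. Qed.

Lemma rcoord_sum h : h = \sum_t (rcoord h t)%:C *: rbasis t.
Proof.
apply/rowP => k; rewrite summxE.
under eq_bigr => t _ do rewrite mxE rbasisE.
rewrite -(pair_bigA _ (fun j b => (rcoord h (j, b))%:C *
   ((if b then 'i else 1 : C) * (j == k)%:R) : C)).
rewrite (bigD1 k)//= [X in _ + X]big1 => [|j jk].
  rewrite addr0 big_bool eqxx !mulr1 /rcoord.
  by apply: cplx_eq => /=; ring.
by rewrite big1 // => b _; rewrite (negbTE jk) !mulr0.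
Qed.

Lemma rlin_bound F h : rlin F -> `|F h| <= nrm h * \sum_t `|F (rbasis t)|.
Proof.
move=> Fl; rewrite {1}(rcoord_sum h) rlin_sum// mulr_sumr.
rewrite (le_trans (ler_norm_sum _ _ _))// ler_sum// => t _.
by rewrite normrM ler_wpM2r// rcoord_le.
Qed.

Lemma rbilin_bound (B : Cn -> Cn -> R) h k :
  (forall k, rlin (B^~ k)) -> (forall h, rlin (B h)) ->
  `|B h k| <= nrm h * nrm k * \sum_t \sum_s `|B (rbasis t) (rbasis s)|.
Proof.
move=> Bl Br; rewrite (le_trans (rlin_bound h (Bl k)))// -mulrA.
rewrite ler_wpM2l ?nrm_ge0// mulr_sumr ler_sum// => t _.
exact: rlin_bound.
Qed.

Lemma quad_form_lipschitz (B : Cn -> Cn -> R) (M : R) h k :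
  (forall k, rlin (B^~ k)) -> (forall h, rlin (B h)) ->
  (forall h k, `|B h k| <= nrm h * nrm k * M) ->
  `|B (h + k) (h + k) - B h h| <= 2 * M * nrm k * (nrm h + nrm k).
Proof.
move=> Bl Br bB; rewrite (Br (h + k)).1 (Bl h).1 (Bl k).1.
rewrite (_ : _ - _ = B k h + B h k + B k k); last by ring.
have := bB k h; have := bB h k; have := bB k k.
have := ler_normD (B k h + B h k) (B k k).
have := ler_normD (B k h) (B h k).
have : 0 <= nrm k * nrm k * M by rewrite (le_trans _ (bB k k)).
have := nrm_ge0 h; have := nrm_ge0 k; nra.
Qed.

Lemma rlin0 F : rlin F -> F 0 = 0.
Proof. by move=> [FD _]; have := FD 0 0; rewrite addr0; lra. Qed.

Lemma rlinN F h : rlin F -> F (- h) = - F h.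
Proof. by move=> Fl; have := Fl.1 h (- h); rewrite subrr rlin0//; lra. Qed.

Lemma rlinB F G : rlin F -> rlin G -> rlin (fun h => F h - G h).
Proof.
move=> [FD FZ] [GD GZ]; split => [h k|a h]; first by rewrite FD GD; ring.
by rewrite FZ GZ; ring.
Qed.

Lemma open_nrm (V : normedModType R[i]) (U : set V) p : open U -> U p ->
  exists2 d : R, 0 < d & forall z, nrm (z - p) < d -> U z.
Proof. by move=> oU Up; apply/nbhs_nrmP; apply: open_nbhs_nbhs. Qed.

Lemma continuous_nrm (V : normedModType R[i]) (f : V -> R) p :
  {for p, continuous f} -> forall e : R, 0 < e -> exists2 d : R, 0 < d &
    forall z, nrm (z - p) < d -> `|f z - f p| < e.
Proof.
move=> fp e e0; have := fp => /cvgrPdist_lt /(_ e e0) /nbhs_nrmP[d d0 H].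
by exists d => // z /H; rewrite distrC.
Qed.

Lemma finite_radius (V : normedModType R[i]) (I : finType) (P : I -> V -> Prop) p :
  (forall i, exists2 d : R, 0 < d & forall z, nrm (z - p) < d -> P i z) ->
  exists2 d : R, 0 < d & forall z, nrm (z - p) < d -> forall i, P i z.
Proof.
move=> H; apply/nbhs_nrmP; apply: filter_forall => i.
by apply/nbhs_nrmP; exact: H.
Qed.

End RealLinear.

Section C1calculus.
Variables (R : realType) (n : nat).
Local Notation C := (R[i]^o).
Local Notation Cn := ('C^n(R)).
Variable U : set Cn.
Hypothesis oU : open U.
Implicit Types (f g : Cn -> R) (z h k : Cn).

Lemma real_derive_val f h z (d : R) : is_derive (0 : R) (1 : R) (real_line f h z) d ->
  real_derive f h z = d.
Proof. by move=> [_ <-]; rewrite /real_derive derive1E. Qed.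

Lemma C1_is_derive f z h (t : R) : C1_on U f -> U (z + t%:C *: h) ->
  is_derive t 1 (fun s : R => f (z + s%:C *: h)) (real_derive f h (z + t%:C *: h)).
Proof.
move=> fC1 Uz; have [dl _] := fC1 h _ Uz.
have H1 : is_derive (t - t) 1 (real_line f h (z + t%:C *: h))
    (real_derive f h (z + t%:C *: h)).
  by rewrite subrr /real_derive derive1E; exact: derivableP.
have := @is_derive1_comp R _ (fun s => s - t) t _ 1 H1.
rewrite mulr1 => H.
rewrite (_ : (fun s => _) = real_line f h (z + t%:C *: h) \o (fun s => s - t)).
  by apply: H; apply: is_derive_eq; rewrite subr0.
by apply/funext => s /=; rewrite /real_line rmorphB/= scalerBl -addrA subrKC.
Qed.

Lemma C1_line_mvt f z h : C1_on U f ->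
  (forall t : R, 0 <= t <= 1 -> U (z + t%:C *: h)) ->
  exists2 t : R, 0 <= t <= 1 & f (z + h) - f z = real_derive f h (z + t%:C *: h).
Proof.
move=> fC1 Uz.
have [t t01] := @mvt_segment R (fun s => f (z + s%:C *: h))
  (fun s => real_derive f h (z + s%:C *: h)) 0 1 ler01 (fun t t01 => C1_is_derive fC1 (Uz t t01)).
by rewrite subr0 mulr1 scale1r scale0r addr0 => E; exists t.
Qed.

Lemma real_deriveZ f h z (a : R) : C1_on U f -> U z ->
  real_derive f (a%:C *: h) z = a * real_derive f h z.
Proof.
move=> fC1 Uz; apply: real_derive_val.
have [dl _] := fC1 h _ Uz.
have H1 : is_derive (a * 0) 1 (real_line f h z) (real_derive f h z).
  by rewrite mulr0 /real_derive derive1E; exact: derivableP.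
have := @is_derive1_comp R _ (fun s => a * s) 0 _ a H1.
rewrite mulrC => H.
rewrite (_ : real_line _ _ _ = real_line f h z \o (fun s => a * s)).
  by apply: H; apply: is_derive_eq; rewrite /GRing.scale/= mulr1.
by apply/funext => s /=; rewrite /real_line rmorphM/= mulrC scalerA.
Qed.

Lemma C1_approx f h z : C1_on U f -> U z -> forall e : R, 0 < e ->
  exists2 d : R, 0 < d & forall t : R, `|t| < d ->
    `|f (z + t%:C *: h) - f z - real_derive f h z * t| <= e * `|t|.
Proof.
move=> fC1 Uz e e0; have zE : z + 0%:C *: h = z by rewrite scale0r addr0.
have D : is_derive (0 : R) (1 : R) (fun s : R => f (z + s%:C *: h)) (real_derive f h z).
  by rewrite -[in X in is_derive _ _ _ X]zE; apply: C1_is_derive; rewrite ?zE.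
have [d d0 H] := real_derive_approx D e0; exists d => // t /H.
by rewrite add0r zE.
Qed.

Let derivative_sum_estimate (e t Da Db Dh Dk D : R) : 0 < t ->
  `|Da - Dh| < e / 3 -> `|Db - Dk| < e / 3 ->
  `|t * Da + t * Db - D * t| <= e / 3 * t -> `|D - (Dh + Dk)| <= e.
Proof.
move=> t0; rewrite -mulrDr [D * t]mulrC -mulrBr normrM gtr0_norm// [leRHS]mulrC ler_pM2l//.
rewrite !(ltr_norml, ler_norml) => /andP[? ?] /andP[? ?] /andP[? ?]; lra.
Qed.

(** [C1_on] provides only directional derivatives, each continuous in the base point. Additivity
    comes from reaching [z + t (h + k)] through [z + t k] and applying the mean value theorem to
    both legs. *)
Lemma real_deriveD f h k z : C1_on U f -> U z ->
  real_derive f (h + k) z = real_derive f h z + real_derive f k z.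
Proof.
move=> fC1 Uz; apply/eqP; rewrite -subr_eq0 -normr_le0.
apply/ler_addgt0Pr => e e0; rewrite add0r.
have e30 : 0 < e / 3 by rewrite divr_gt0.
have [d1 d10 H1] := open_nrm oU Uz.
have [d2 d20 H2] := continuous_nrm (fC1 h z Uz).2 e30.
have [d3 d30 H3] := continuous_nrm (fC1 k z Uz).2 e30.
have [d4 d40 H4] := C1_approx (h + k) fC1 Uz e30.
pose m := Num.min d1 (Num.min d2 d3).
have m0 : 0 < m by rewrite !lt_min d10 d20.
pose N := nrm h + nrm k + 1.
have N0 : 0 < N by rewrite /N; have := nrm_ge0 h; have := nrm_ge0 k; lra.
pose t := Num.min (m / N) d4 / 2.
have tt0 : 0 < Num.min (m / N) d4 by rewrite lt_min d40 divr_gt0.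
have t0 : 0 < t by rewrite divr_gt0.
have t4 : t < d4.
  by have := ge_min d4 (m / N) d4; rewrite lexx orbT /t => /idP; lra.
have tN : t * N < m.
  rewrite -ltr_pdivlMr//.
  by have := ge_min (m / N) (m / N) d4; rewrite lexx /= /t => /idP; lra.
have bnd (a b : R) : 0 <= a <= 1 -> 0 <= b <= 1 ->
    nrm (z + t%:C *: (a%:C *: h + b%:C *: k) - z) < m.
  move=> /andP[a0 a1] /andP[b0 b1]; rewrite addrAC subrr add0r.
  rewrite nrmZ nrmR gtr0_norm// (le_lt_trans _ tN)// ler_wpM2l ?(ltW t0)//.
  rewrite (le_trans (nrmD _ _))// !nrmZ !nrmR !ger0_norm// /N.
  by have := nrm_ge0 h; have := nrm_ge0 k; nra.
have mlt x : x < m -> [/\ x < d1, x < d2 & x < d3].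
  by rewrite !lt_min => /and3P[].
have c1 : (0 : R) <= (1 : R) <= 1 by rewrite ler01 lexx.
have c0 : (0 : R) <= (0 : R) <= 1 by rewrite ler01 lexx.
have Pa (a : R) : z + t%:C *: k + a%:C *: (t%:C *: h) = z + t%:C *: (a%:C *: h + 1%:C *: k).
  by rewrite scale1r scalerDr addrA addrAC [in RHS]scalerA [in RHS]mulrC -[in RHS]scalerA.
have Pb (b : R) : z + b%:C *: (t%:C *: k) = z + t%:C *: (0%:C *: h + b%:C *: k).
  by rewrite scale0r add0r [in RHS]scalerA [in RHS]mulrC -[in RHS]scalerA.
have Ua (a : R) : 0 <= a <= 1 -> U (z + t%:C *: k + a%:C *: (t%:C *: h)).
  by move=> a01; rewrite Pa; apply: H1; have [] := mlt _ (bnd _ _ a01 c1).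
have Ub (b : R) : 0 <= b <= 1 -> U (z + b%:C *: (t%:C *: k)).
  by move=> b01; rewrite Pb; apply: H1; have [] := mlt _ (bnd _ _ c0 b01).
have [a a01] := C1_line_mvt fC1 Ua.
have [b b01] := C1_line_mvt fC1 Ub.
rewrite (real_deriveZ k t fC1 (Ub b b01)) (real_deriveZ h t fC1 (Ua a a01)) Pa Pb => Eb Ea.
have [u1 u2 _] := mlt _ (bnd _ _ a01 c1); have [v1 _ v3] := mlt _ (bnd _ _ c0 b01).
have E : f (z + t%:C *: (h + k)) - f z =
  t * real_derive f h (z + t%:C *: (a%:C *: h + 1%:C *: k)) +
  t * real_derive f k (z + t%:C *: (0%:C *: h + b%:C *: k)).
  have tele (x y w : R) : x - w = (x - y) + (y - w) by ring.
  have -> : z + t%:C *: (h + k) = z + t%:C *: k + t%:C *: h.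
    by rewrite scalerDr (addrC (t%:C *: h)) addrA.
  by rewrite (tele _ (f (z + t%:C *: k))) Ea Eb.
have G1 := H2 _ u2; have G2 := H3 _ v3.
have := H4 t; rewrite gtr0_norm// => /(_ t4).
rewrite E; apply: derivative_sum_estimate t0 G1 G2.
Qed.

Lemma real_derive_rlin f z : C1_on U f -> U z -> rlin (fun h => real_derive f h z).
Proof. by split=> *; [exact: real_deriveD|exact: real_deriveZ]. Qed.

Lemma real_derive_near f g h z : U z -> (forall y, U y -> f y = g y) ->
  real_derive f h z = real_derive g h z.
Proof.
move=> Uz fg; rewrite /real_derive !derive1E; apply: near_eq_derive.
have [d d0 H] := open_nrm oU Uz.
have nh : 0 < nrm h + 1 by have := nrm_ge0 h; lra.
apply/nbhs_ballP; exists (d / (nrm h + 1)) => /=; first by rewrite divr_gt0.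
move=> s; rewrite /ball/= sub0r normrN ltr_pdivlMr// => sd.
rewrite /real_line fg//; apply: H; rewrite addrAC subrr add0r nrmZ nrmR.
have := nrm_ge0 h; have := normr_ge0 s; nra.
Qed.

Lemma real_deriveDf f g h z : C1_on U f -> C1_on U g -> U z ->
  real_derive (fun y => f y + g y) h z = real_derive f h z + real_derive g h z.
Proof.
move=> fC1 gC1 Uz; apply: real_derive_val.
have Uz' : U (z + 0%:C *: h) by rewrite scale0r addr0.
have H1 := C1_is_derive fC1 Uz'; have H2 := C1_is_derive gC1 Uz'.
by have := is_deriveD H1 H2; rewrite scale0r addr0.
Qed.

Lemma real_deriveZf f h z (a : R) : C1_on U f -> U z ->
  real_derive (fun y => a * f y) h z = a * real_derive f h z.
Proof.
move=> fC1 Uz; apply: real_derive_val.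
have Uz' : U (z + 0%:C *: h) by rewrite scale0r addr0.
have H1 := C1_is_derive fC1 Uz'.
by have := is_deriveZ a H1; rewrite scale0r addr0.
Qed.

End C1calculus.

Section Taylor.
Variables (R : realType) (n : nat).
Local Notation C := (R[i]^o).
Local Notation Cn := ('C^n(R)).

(** What the sequel uses of a C^2 function near [p]. [H] is the quadratic form of the real Hessian
    at [p]. The expansion is centred at any [z] near [p] but keeps this one form, so that its error
    is uniform along a curve. *)
Record taylor2 (U : set Cn) (r : Cn -> R) (p : Cn) (H : Cn -> R) (M : R) : Prop := Taylor2 {
  taylor_M : 0 <= M ;
  taylor_rlin : exists2 d : R, 0 < d & forall z, nrm (z - p) < d ->
    U z /\ rlin (fun h => real_derive r h z) ;
  taylor_cont : forall e : R, 0 < e -> exists2 d : R, 0 < d & forall z, nrm (z - p) < d ->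
    forall h, `|real_derive r h z - real_derive r h p| <= e * nrm h ;
  taylor_expansion : forall e : R, 0 < e -> exists2 d : R, 0 < d & forall z h,
    nrm (z - p) < d -> nrm h < d ->
    `|r (z + h) - r z - real_derive r h z - H h / 2| <= e * nrm h ^+ 2 ;
  taylor_HD : forall h k, `|H (h + k) - H h| <= M * nrm k * (nrm h + nrm k) ;
  taylor_HZ : forall (a : R) h, H (a%:C *: h) = a ^+ 2 * H h }.

(** Two applications of the mean value theorem bring the remainder to the Hessian form at a point
    near [p]. It is close to the form at [p], uniformly in the direction, because the finitely many
    entries in a real basis are continuous. *)
Lemma C2_taylor (U : set Cn) (r : Cn -> R) (p : Cn) : open U -> U p -> C2_on U r ->
  exists H M, taylor2 U r p H M.
Proof.
move=> oU Up [r1 r2].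
pose B z h k := real_derive (real_derive r k) h z.
have Bl z : U z -> forall k, rlin ((B z)^~ k).
  by move=> Uz k; apply: (real_derive_rlin oU (r2 k) Uz).
have Br z : U z -> forall h, rlin (B z h).
  move=> Uz h; split=> [k k'|a k]; rewrite /B.
    rewrite -(real_deriveDf h (r2 k) (r2 k') Uz).
    by apply: (real_derive_near oU) => // y Uy; rewrite (real_deriveD oU).
  rewrite -(real_deriveZf h a (r2 k) Uz).
  by apply: (real_derive_near oU) => // y Uy; rewrite (@real_deriveZ _ _ U).
have cL (e : R) : 0 < e -> exists2 d : R, 0 < d & forall z, nrm (z - p) < d ->
    forall h, `|real_derive r h z - real_derive r h p| <= e * nrm h.
  move=> e0; pose K := #|{: 'I_n * bool}|%:R + 1 : R.
  have K0 : 0 < K by rewrite /K ltr_wpDl.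
  have eK : 0 < e / K by rewrite divr_gt0.
  have [d1 d10 H1] := open_nrm oU Up.
  have [t|d2 d20 H2] := @finite_radius R Cn ('I_n * bool)%type (fun t z =>
      `|real_derive r (rbasis R t) z - real_derive r (rbasis R t) p| < e / K) p.
    exact: continuous_nrm (r1 _ p Up).2 _ eK.
  exists (Num.min d1 d2); first by rewrite lt_min d10.
  move=> z; rewrite lt_min => /andP[/H1 Uz /H2 zd] h.
  rewrite (le_trans (rlin_bound h (rlinB (real_derive_rlin oU r1 Uz) (real_derive_rlin oU r1 Up))))//.
  rewrite mulrC ler_wpM2r ?nrm_ge0//.
  rewrite (le_trans (ler_sum _ (fun t _ => ltW (zd t))))// sumr_const.
  rewrite -mulr_natl mulrCA ler_piMr ?(ltW e0)// ler_pdivrMr// mul1r /K.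
  by rewrite lerDl.
have cB (e : R) : 0 < e -> exists2 d : R, 0 < d & forall z, nrm (z - p) < d ->
    U z /\ forall h, `|B z h h - B p h h| <= e * nrm h ^+ 2.
  move=> e0; pose K := #|{: ('I_n * bool) * ('I_n * bool)}|%:R + 1 : R.
  have K0 : 0 < K by rewrite /K ltr_wpDl.
  have eK : 0 < e / K by rewrite divr_gt0.
  have [d1 d10 H1] := open_nrm oU Up.
  have [t|d2 d20 H2] := @finite_radius R Cn (('I_n * bool) * ('I_n * bool))%type
      (fun t z => `|B z (rbasis R t.1) (rbasis R t.2) - B p (rbasis R t.1) (rbasis R t.2)| < e / K) p.
    exact: continuous_nrm (r2 _ _ p Up).2 _ eK.
  exists (Num.min d1 d2); first by rewrite lt_min d10.
  move=> z; rewrite lt_min => /andP[/H1 Uz /H2 zd]; split=> // h.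
  have := @rbilin_bound R n (fun h k => B z h k - B p h k) h h
    (fun k => rlinB (Bl z Uz k) (Bl p Up k)) (fun h => rlinB (Br z Uz h) (Br p Up h)).
  move=> /le_trans; apply; rewrite -expr2 mulrC ler_wpM2r ?exprn_ge0 ?nrm_ge0//.
  rewrite pair_bigA/= (le_trans (ler_sum _ (fun t _ => ltW (zd t))))// sumr_const.
  rewrite -mulr_natl mulrCA ler_piMr ?(ltW e0)// ler_pdivrMr// mul1r /K.
  by rewrite lerDl.
pose M := \sum_t \sum_s `|B p (rbasis R t) (rbasis R s)|.
have M0 : 0 <= M by rewrite /M sumr_ge0// => t _; rewrite sumr_ge0.
have bB h k : `|B p h k| <= nrm h * nrm k * M.
  by apply: rbilin_bound; [exact: Bl|exact: Br].
exists (fun h => B p h h), (2 * M); split=> //.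
- by rewrite mulr_ge0.
- have [d d0 H] := open_nrm oU Up; exists d => // z /H Uz; split=> //.
  exact: real_derive_rlin Uz.
- move=> e e0; have [d d0 H] := cB e e0.
  exists (d / 2); first by rewrite divr_gt0.
  move=> z h zd hd.
  have Hz (t : R) : 0 <= t <= 1 -> nrm (z + t%:C *: h - p) < d.
    move=> /andP[t0 t1]; rewrite addrAC (le_lt_trans (nrmD _ _))// nrmZ nrmR ger0_norm//.
    have := nrm_ge0 h; nra.
  have Uz (t : R) : 0 <= t <= 1 -> U (z + t%:C *: h).
    by move=> /Hz /H[].
  pose c := B p h h.
  (* The derivative of [phi] vanishes at 0 and is an increment of the first derivative minus
     [t * c]; the second mean value theorem makes it [t] times a difference of Hessian forms. *)
  pose phi t := r (z + t%:C *: h) - t * real_derive r h z - t ^+ 2 * (c / 2).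
  pose dphi t := real_derive r h (z + t%:C *: h) - real_derive r h z - t * c.
  have dphiP (t : R) : 0 <= t <= 1 -> is_derive t 1 phi (dphi t).
    move=> t01; have D1 := C1_is_derive r1 (Uz t t01).
    apply: is_derive_eq; rewrite /dphi; set L := real_derive r h (_ + _); set L0 := real_derive r h z.
    by rewrite /GRing.scale/=; field.
  have [t t01 Et] := @mvt_segment R phi dphi 0 1 ler01 dphiP.
  have ts (s : R) : 0 <= s <= t -> 0 <= s <= 1.
    by move=> /andP[-> st] /=; case/andP: t01 => _; exact: le_trans.
  have t0 : 0 <= t by case/andP: t01.
  have [s s0t Es] := @mvt_segment R (fun s => real_derive r h (z + s%:C *: h))
    (fun s => B (z + s%:C *: h) h h) 0 t t0
    (fun s s0t => C1_is_derive (r2 h) (Uz s (ts s s0t))).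
  have -> : r (z + h) - r z - real_derive r h z - B p h h / 2 = phi 1 - phi 0.
    by rewrite /phi scale1r scale0r addr0 /c; ring.
  rewrite Et /dphi.
  have -> : real_derive r h (z + t%:C *: h) - real_derive r h z = B (z + s%:C *: h) h h * t.
    by move: Es; rewrite scale0r addr0 subr0.
  rewrite subr0 mulr1 (_ : _ - _ = t * (B (z + s%:C *: h) h h - c)); last by ring.
  rewrite normrM (ger0_norm t0).
  have := (H _ (Hz s (ts s s0t))).2 h.
  rewrite -/c; set X := `|_ - c| => HX.
  by case/andP: t01 => _ t1; rewrite (le_trans _ HX)// ler_piMl// normr_ge0.
- by move=> h k; apply: quad_form_lipschitz bB; [exact: Bl|exact: Br].
- move=> a h; have [_ BZ] := Br p Up (a%:C *: h); rewrite BZ.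
  by have [_ ->] := Bl p Up h; ring.
Qed.

End Taylor.

(** * Discs touching the boundary *)

Section Levi.
Variables (R : realType) (n : nat).
Local Notation C := (R[i]^o).
Local Notation Cn := ('C^n(R)).

(* Failure of the Levi condition at [p]: the punctured disc lies in [Omega] with
   a quadratic margin. *)
Definition disc_contact (Omega : set Cn) (p v w : Cn) (c t0 : R) :=
  forall s : C, nrm s <= t0 -> forall y,
    nrm (y - (p + s *: v + s ^+ 2 *: w)) < c * nrm s ^+ 2 -> Omega y.

(** Division by [t], then by [t ^+ 2]. It reads off the first and second order coefficients of a
    defining function along a real ray of a touching disc. *)
Lemma asymptotic_le0 (a b K : R) :
  (forall e : R, 0 < e -> exists2 d : R, 0 < d &
     forall t, 0 < t < d -> t * a + t ^+ 2 * b <= e * t ^+ 2 + K * t ^+ 3) ->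
  a <= 0 /\ (a = 0 -> b <= 0).
Proof.
move=> H; split.
  rewrite leNgt; apply/negP => a0.
  have [d d0 {}H] := H 1 ltr01.
  pose S := 1 + `|b| + `|K|; have S0 : 0 < S by rewrite /S; have := normr_ge0 b; have := normr_ge0 K; lra.
  pose t := Num.min (Num.min 1 d) (a / S) / 2.
  have m0 : 0 < Num.min (Num.min 1 d) (a / S) by rewrite !lt_min ltr01 d0 divr_gt0.
  have m1 : Num.min (Num.min 1 d) (a / S) <= 1 by rewrite !ge_min lexx.
  have m2 : Num.min (Num.min 1 d) (a / S) <= d by rewrite !ge_min lexx orbT.
  have m3 : Num.min (Num.min 1 d) (a / S) <= a / S by rewrite !ge_min lexx orbT.
  have t0 : 0 < t by rewrite divr_gt0.
  have t1 : t <= 1 by rewrite /t; lra.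
  have td : t < d by rewrite /t; lra.
  have ta : t * S < a by rewrite -ltr_pdivlMr// /t; lra.
  have := H t; rewrite t0 td => /(_ isT).
  rewrite (_ : t * a + _ = t * (a + t * b)); last by ring.
  rewrite (_ : 1 * _ + _ = t * (t + K * t ^+ 2)); last by ring.
  rewrite ler_pM2l// => E.
  have := ler_norm (- b); have := ler_norm K; rewrite normrN.
  have : K * t ^+ 2 <= `|K| * t.
    rewrite (le_trans (ler_wpM2r (sqr_ge0 _) (ler_norm K)))// ler_wpM2l//.
    by rewrite expr2 ler_piMl// ltW.
  move: ta E; rewrite /S; nra.
move=> a0; apply/ler_addgt0Pr => e e0; rewrite add0r.
have e20 : 0 < e / 2 by rewrite divr_gt0.
have [d d0 {}H] := H _ e20.
have K0 : 0 < 1 + `|K| by rewrite ltr_pwDl.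
pose t := Num.min d (e / 2 / (1 + `|K|)) / 2.
have m0 : 0 < Num.min d (e / 2 / (1 + `|K|)) by rewrite lt_min d0 divr_gt0.
have m1 : Num.min d (e / 2 / (1 + `|K|)) <= d by rewrite ge_min lexx.
have m2 : Num.min d (e / 2 / (1 + `|K|)) <= e / 2 / (1 + `|K|) by rewrite ge_min lexx orbT.
have t0 : 0 < t by rewrite divr_gt0.
have td : t < d by rewrite /t; lra.
have te : t * (1 + `|K|) < e / 2 by rewrite -ltr_pdivlMr// /t; lra.
have := H t; rewrite t0 td a0 mulr0 add0r => /(_ isT).
rewrite (_ : e / 2 * _ + _ = t ^+ 2 * (e / 2 + K * t)); last by ring.
rewrite ler_pM2l ?exprn_gt0// => E.
have := ler_norm K; nra.
Qed.

Variables (Omega U : set Cn) (r : Cn -> R) (p : Cn) (H : Cn -> R) (M : R).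
Hypothesis T2 : taylor2 U r p H M.
Let L z h := real_derive r h z.

Let Lp : rlin (L p).
Proof.
have [d d0 /(_ p)] := taylor_rlin T2.
by rewrite subrr nrm0 => /(_ d0)[].
Qed.

Lemma taylor_H0 : H 0 = 0.
Proof. by have := taylor_HZ T2 0 0; rewrite scaler0 expr0n mul0r. Qed.

Lemma taylor_H_le h : `|H h| <= M * nrm h ^+ 2.
Proof. by have := taylor_HD T2 0 h; rewrite add0r taylor_H0 subr0 nrm0 add0r expr2 mulrA. Qed.

(** On the ray [t s] the quadratic margin leaves room for an outward displacement by a multiple of
    [t^2 N], and [r] is still negative there. The first order term [L p (s v)] is thus nonpositive
    for [s] and [- s], hence zero; the second order term, which contains the displacement, yields
    the strict constant [c']. *)
Lemma contact_levi (N v w : Cn) (c t0 : R) :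
  Omega `&` U = [set z | U z /\ r z < 0] -> r p = 0 -> 0 < L p N ->
  0 < c -> 0 < t0 -> disc_contact Omega p v w c t0 ->
  (forall s : C, L p (s *: v) = 0) /\
  exists2 c' : R, 0 < c' &
    forall s : C, L p (s ^+ 2 *: w) + H (s *: v) / 2 <= - c' * nrm s ^+ 2.
Proof.
move=> OU rp LN c0 t00 ct.
have nN : 0 < nrm N.
  by rewrite nrm_gt0; apply: contraTneq LN => ->; rewrite rlin0// ltxx.
have main (s : C) : s != 0 ->
   L p (s *: v) <= 0 /\ (L p (s *: v) = 0 ->
     L p (s ^+ 2 *: w) + H (s *: v) / 2 <= - (c / 2 * (L p N / nrm N)) * nrm s ^+ 2).
  move=> s0; have ns : 0 < nrm s by rewrite nrm_gt0.
  (* Half of the margin: [ka * nrm N = c / 2 * nrm s ^+ 2]. *)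
  pose ka : R := c / 2 * nrm s ^+ 2 / nrm N.
  pose k := s ^+ 2 *: w + ka%:C *: N.
  pose A := nrm (s *: v) + nrm k + 1.
  have A1 : 1 <= A by rewrite /A; have := nrm_ge0 (s *: v); have := nrm_ge0 k; lra.
  have A0 : 0 < A by lra.
  have HA : nrm (s *: v) <= A /\ nrm k <= A.
    by rewrite /A; have := nrm_ge0 (s *: v); have := nrm_ge0 k; lra.
  have [|La Lb] := @asymptotic_le0 (L p (s *: v)) (L p k + H (s *: v) / 2) (M * A ^+ 2).
    move=> e e0; have eA : 0 < e / A ^+ 2 by rewrite divr_gt0// exprn_gt0.
    have [d1 d10 H1] := taylor_expansion T2 eA.
    have [d2 d20 H2] := taylor_rlin T2.
    pose D := Num.min 1 (Num.min (t0 / nrm s) (Num.min (d1 / A) (d2 / A))).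
    exists D; first by rewrite !lt_min ltr01 !divr_gt0.
    move=> t; rewrite !lt_min => /andP[tt0 /and4P[t1]].
    rewrite !ltr_pdivlMr// => ts td1 td2.
    pose h := t%:C *: (s *: v) + (t ^+ 2)%:C *: k.
    have nh : nrm h <= t * A.
      rewrite (le_trans (nrmD _ _))// (nrmZ t%:C (s *: v)) (nrmZ _ k) !nrmR.
      rewrite !ger0_norm ?exprn_ge0 ?(ltW tt0)//.
      have : t ^+ 2 * nrm k <= t * nrm k.
        by rewrite ler_wpM2r ?nrm_ge0// expr2 ler_piMl ?(ltW tt0)// ltW.
      rewrite /A; lra.
    have Uph : U (p + h) by apply: (H2 _ _).1; rewrite addrAC subrr add0r; lra.
    have rph : r (p + h) < 0.
      suff : (Omega `&` U) (p + h) by rewrite OU => -[].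
      split=> //; apply: (ct (t%:C * s)).
        by rewrite nrmM nrmR gtr0_norm// ltW.
      rewrite (_ : p + h - _ = (t ^+ 2 * ka)%:C *: N).
        rewrite nrmZ nrmM !nrmR gtr0_norm ?mulr_gt0 ?divr_gt0 ?exprn_gt0 ?invr_gt0//.
        rewrite (gtr0_norm tt0) (_ : _ * _ = c / 2 * (t * nrm s) ^+ 2).
          by rewrite ltr_pM2r ?exprn_gt0 ?mulr_gt0//; lra.
        by rewrite /ka; field; rewrite gt_eqF.
      have tele (a b d : Cn) : p + (a + (b + d)) - (p + a + b) = d.
        by apply/eqP; rewrite subr_eq [X in _ == X]addrC !addrA.
      by rewrite /h /k scalerDr !scalerA exprMn -rmorphXn -rmorphM tele.
    have pp : nrm (p - p) < d1 by rewrite subrr nrm0.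
    have hd1 : nrm h < d1 by rewrite (le_lt_trans nh).
    have := H1 p h pp hd1; rewrite rp subr0 ler_norml => /andP[+ _].
    have [LD LZ] := Lp; rewrite -/(L p h) /h LD !LZ -/h => T.
    have : `|H h - t ^+ 2 * H (s *: v)| <= M * A ^+ 2 * t ^+ 3 + M * A ^+ 2 * t ^+ 3.
      rewrite -(taylor_HZ T2) /h (le_trans (taylor_HD T2 _ _))//.
      have -> : nrm ((t ^+ 2)%:C *: k) = t ^+ 2 * nrm k.
        by rewrite nrmZ nrmR ger0_norm// exprn_ge0// ltW.
      have -> : nrm (t%:C *: (s *: v)) = t * nrm (s *: v).
        by rewrite nrmZ nrmR gtr0_norm.
      have M0 := taylor_M T2.
      have k0 := nrm_ge0 k; have sv0 := nrm_ge0 (s *: v); case: HA => HA1 HA2.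
      rewrite (_ : M * _ * _ = M * t ^+ 3 * (nrm k * (nrm (s *: v) + t * nrm k))); last by ring.
      rewrite (_ : _ + _ = M * t ^+ 3 * (A * (A + A))); last by ring.
      rewrite ler_wpM2l ?mulr_ge0 ?exprn_ge0 ?(ltW tt0)// ler_pM ?addr_ge0 ?mulr_ge0 ?(ltW tt0)//.
      by rewrite lerD// (le_trans _ HA2)// ler_piMl// ltW.
    rewrite ler_norml => /andP[HH _].
    have eh : e / A ^+ 2 * nrm h ^+ 2 <= e * t ^+ 2.
      rewrite -mulrA ler_pM2l// mulrC ler_pdivrMr ?exprn_gt0// -exprMn.
      by rewrite ler_pXn2r// nnegrE ?nrm_ge0 ?mulr_ge0 ?ltW.
    move: T HH eh rph; set X := e / _ * _; move: (r _) (H h) (H (s *: v)) => r' h' h''.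
    move: (L p k) (L p (s *: v)) => l1 l2 T HH eh rph; lra.
  split=> // /Lb; have [LD LZ] := Lp; rewrite /k LD LZ => {}Lb.
  have E : c / 2 * (L p N / nrm N) * nrm s ^+ 2 = ka * L p N.
    by rewrite /ka; field; rewrite gt_eqF.
  by rewrite mulNr E -subr_le0 opprK addrAC.
have L0 (s : C) : L p (s *: v) = 0.
  have [->|s0] := eqVneq s 0; first by rewrite scale0r rlin0.
  have s0' : - s != 0 by rewrite oppr_eq0.
  apply/eqP; rewrite eq_le (main s s0).1 /=.
  by have := (main _ s0').1; rewrite scaleNr rlinN// oppr_le0.
split=> //; exists (c / 2 * (L p N / nrm N)); first by rewrite mulr_gt0 ?divr_gt0.
move=> s; have [->|s0] := eqVneq s 0.
  by rewrite nrm0 !expr0n/= mulr0 !scale0r rlin0// taylor_H0 mul0r addr0.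
by have [_ ->] := main s s0.
Qed.

(* For [v = 0] the values at [s = 1] and [s = i] have opposite signs. *)
Lemma contact_nonzero (v w : Cn) (c : R) : 0 < c ->
  (forall s : C, L p (s ^+ 2 *: w) + H (s *: v) / 2 <= - c * nrm s ^+ 2) -> v != 0.
Proof.
move=> c0 Hc; apply/eqP => v0.
have E s : L p (s ^+ 2 *: w) <= - c * nrm s ^+ 2.
  by have := Hc s; rewrite v0 scaler0 taylor_H0 mul0r addr0.
have E1 := E (1 : C); have Ei := E ('i : C).
have w1 : (1 : C) ^+ 2 *: w = w by rewrite expr1n scale1r.
have wi : ('i : C) ^+ 2 *: w = - w by rewrite [_ ^+ 2]sqr_i scaleN1r.
move: E1 Ei; rewrite w1 wi nrm1 nrmi (rlinN w Lp).
by move: (L p w) => x; lra.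
Qed.

(** [A h = L z h - i L z (i h)] is the complex linear functional with real part [L z]. Subtracting
    the right complex multiple of [N] from [v] moves it into the kernel of [A]. The correction is
    small because near [p] the value [A v] is small while [A N] stays away from 0. *)
Lemma complex_tangent_frame (N v : Cn) : 0 < L p N -> (forall s : C, L p (s *: v) = 0) ->
  forall e : R, 0 < e -> exists2 d : R, 0 < d & forall z, nrm (z - p) < d ->
    exists2 X, nrm (X - v) <= e & forall s : C, L z (s *: X) = 0.
Proof.
move=> LN Lv e e0.
have nN := nrm_ge0 N; have nv := nrm_ge0 v.
pose K := 4 * (nrm N + 1) * (nrm v + 1).
have K0 : 0 < K by rewrite /K !mulr_gt0//; lra.
pose e1 := Num.min (L p N / (2 * (nrm N + 1))) (e * L p N / K).
have e10 : 0 < e1 by rewrite lt_min !divr_gt0 ?mulr_gt0//; lra.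
have e1N : e1 * (2 * (nrm N + 1)) <= L p N.
  by rewrite -ler_pdivlMr ?mulr_gt0// ?ge_min ?lexx//; lra.
have e1K : e1 * K <= e * L p N by rewrite -ler_pdivlMr// ge_min lexx orbT.
have [d1 d10 H1] := taylor_rlin T2; have [d2 d20 H2] := taylor_cont T2 e10.
exists (Num.min d1 d2); first by rewrite lt_min d10.
move=> z; rewrite lt_min => /andP[/H1[_ Lz] /H2 {H1}H2].
have Lzs (s : C) h : L z (s *: h) = complex.Re s * L z h + complex.Im s * L z ('i *: h).
  have sE : s *: h = (complex.Re s)%:C *: h + (complex.Im s)%:C *: ('i *: h).
    by rewrite scalerA -scalerDl; congr (_ *: h); apply: cplx_eq => /=; ring.
  by have [LD LZ] := Lz; rewrite [in LHS]sE /L LD (LZ (complex.Re s)) (LZ (complex.Im s)).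
pose A h : C := L z h -i* L z ('i *: h).
have AZ (s : C) h : A (s *: h) = s * A h.
  have iE : L z ('i *: (s *: h)) = complex.Re s * L z ('i *: h) - complex.Im s * L z h.
    by rewrite scalerA Lzs; case: (s) => a b /=; ring.
  rewrite /A iE (Lzs s); case: (s) => a b.
  by apply: cplx_eq => /=; ring.
have AD h k : A (h + k) = A h + A k.
  by have [LD _] := Lz; rewrite /A /L scalerDr !LD; apply: cplx_eq => //=; rewrite opprD.
have zN : L p N / 2 <= L z N.
  have := H2 N; rewrite -/(L z N) -/(L p N) ler_norml => /andP[+ _].
  have : e1 * nrm N <= L p N / 2 by have := ltW e10; nra.
  lra.
have AN : L p N / 2 <= nrm (A N).
  by rewrite (le_trans zN)// (le_trans _ (Re_le_nrm _))// ler_norm.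
have AN0 : A N != 0 by rewrite -nrm_gt0; lra.
have Av : nrm (A v) <= 2 * (e1 * nrm v).
  rewrite (le_trans (nrm_le_ReIm _))//= normrN.
  have := H2 v; have := H2 ('i *: v); have := Lv 'i; have := Lv 1.
  rewrite scale1r nrmZ nrmi mul1r /L => -> ->; rewrite !subr0; lra.
have AR h : complex.Re (A h) = L z h by [].
clearbody A; exists (v - (A v / A N) *: N).
  rewrite addrAC subrr add0r nrmN nrmZ.
  have E : nrm (A v / A N : C) * nrm (A N) = nrm (A v) by rewrite -nrmM divfK.
  have q0 := nrm_ge0 (A v / A N : C).
  have : nrm (A v / A N : C) * (L p N / 2) <= 2 * (e1 * nrm v).
    by apply: le_trans Av; rewrite -E; exact: ler_wpM2l.
  set q := nrm _ in q0 * => Hq.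
  have {}Hq : q * L p N <= 4 * (e1 * nrm v) by lra.
  rewrite -(ler_pM2r LN) mulrAC (le_trans (ler_wpM2r nN Hq))// (le_trans _ e1K)//.
  rewrite (_ : _ * nrm N = e1 * (4 * nrm N * nrm v)); last by ring.
  by rewrite ler_pM2l// /K ler_pM ?mulr_ge0// ?ler_pM2l// lerDl.
move=> s; have : A (s *: (v - A v / A N *: N)) = 0.
  by rewrite AZ -scaleNr AD AZ mulNr divfK// subrr mulr0.
by move=> /(congr1 (@complex.Re R)); rewrite AR.
Qed.

End Levi.

(** Here [t] is the position on an edge starting at [z] and [s] the parameter of a disc centred at
    that position. Tangency at [z] removes the first order term of [(s + t) X] for all complex [s];
    the Levi bound [- c |s|^2] absorbs every error of order [|s|^2], which leaves errors
    proportional to [h]. For real steps alone the change of [r] is quadratic. *)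
Lemma tangent_disc_family (R : realType) (n : nat) (U : set 'C^n(R)) (r : 'C^n(R) -> R)
    (p : 'C^n(R)) (H : 'C^n(R) -> R) (M : R) (v w : 'C^n(R)) (c : R) :
  taylor2 U r p H M -> 0 < c ->
  (forall s : R[i]^o, real_derive r (s ^+ 2 *: w) p + H (s *: v) / 2 <= - c * nrm s ^+ 2) ->
  forall e : R, 0 < e -> exists e0 m K : R, [/\ 0 < e0, e0 <= e, 0 < m, 0 < K &
  forall z X, nrm (z - p) < m -> nrm (X - v) <= e0 ->
    (forall s : R[i]^o, real_derive r (s *: X) z = 0) ->
    (forall (s : R[i]^o) (t h : R), nrm s <= m -> 0 <= t -> t <= h -> h <= m ->
       U (z + ((s + t%:C) *: X + s ^+ 2 *: w)) /\
       r (z + ((s + t%:C) *: X + s ^+ 2 *: w)) <= r z + K * h) /\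
    (forall t : R, 0 <= t -> t <= m -> `|r (z + t%:C *: X) - r z| <= K * t ^+ 2)].
Proof.
pose L z h := real_derive r h z.
move=> T2 c0 Hc e e0; have M0 := taylor_M T2.
pose B := nrm v + nrm w + 1.
have nv := nrm_ge0 v; have nw := nrm_ge0 w.
have B1 : 1 <= B by rewrite /B; lra.
have B0 : 0 < B by lra.
have e2B : Num.min (Num.min 1 e) (c / (6 * (M + 1) * B)) <= B.
  by rewrite (le_trans _ B1)// !ge_min lexx.
have vB : nrm v <= B by rewrite /B; lra.
have wB : nrm w <= B by rewrite /B; lra.
(* [e1] controls the Taylor remainder and the variation of the differential, [e2] the replacement of
   [X] by [v] in the Hessian form. Each uses up at most half of [c * nrm s ^+ 2]. *)
pose e1 := Num.min 1 (c / (20 * B ^+ 2)).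
have e10 : 0 < e1 by rewrite lt_min ltr01 divr_gt0// mulr_gt0// exprn_gt0.
have e11 : e1 <= 1 by rewrite ge_min lexx.
have e1c : e1 * (20 * B ^+ 2) <= c.
  by rewrite -ler_pdivlMr ?mulr_gt0 ?exprn_gt0// ge_min lexx orbT.
pose e2 := Num.min (Num.min 1 e) (c / (6 * (M + 1) * B)).
have MB0 : 0 < 6 * (M + 1) * B by rewrite !mulr_gt0//; lra.
have e20 : 0 < e2 by rewrite !lt_min ltr01 e0 divr_gt0.
have e21 : e2 <= 1 by rewrite !ge_min lexx.
have e2c : e2 * (6 * (M + 1) * B) <= c by rewrite -ler_pdivlMr// ge_min lexx orbT.
have [d1 d10 H1] := taylor_rlin T2; have [d2 d20 H2] := taylor_cont T2 e10.
have [d3 d30 H3] := taylor_expansion T2 e10.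
pose d := Num.min d1 (Num.min d2 d3).
have d0 : 0 < d by rewrite !lt_min d10 d20.
have dd x : x < d -> [/\ x < d1, x < d2 & x < d3] by rewrite !lt_min => /and3P[].
pose m := Num.min (Num.min 1 (e2 / B)) (d / (10 * B)).
have m0 : 0 < m by rewrite !lt_min ltr01 !divr_gt0// mulr_gt0.
have m1 : m <= 1 by rewrite !ge_min lexx.
have mB : m * B <= e2 by rewrite -ler_pdivlMr// !ge_min lexx orbT.
have md : m * (10 * B) <= d by rewrite -ler_pdivlMr ?mulr_gt0// !ge_min lexx orbT.
pose K := 3 * M * B ^+ 2 + 7 * B ^+ 2.
have BB : 0 < B ^+ 2 by rewrite exprn_gt0.
have K0 : 0 < K by rewrite /K ltr_wpDl ?mulr_ge0 ?mulr_gt0// ltW.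
exists e2, m, K; split=> //; first by rewrite !ge_min lexx orbT.
move=> z X zm XV LX.
have zd : nrm (z - p) < d.
  by apply: lt_le_trans zm _; apply: le_trans md; rewrite ler_peMr ?(ltW m0)//; lra.
have [zd1 zd2 zd3] := dd _ zd; have [Uz [LD LZ]] := H1 _ zd1.
have nX : nrm X <= B.
  by have := nrmD (X - v) v; rewrite subrK /B; lra.
split=> [s t h sm t0 th hm|t t0 tm].
  set hh := (s + t%:C) *: X + s ^+ 2 *: w.
  set si := nrm s in sm *; have si0 : 0 <= si by exact: nrm_ge0.
  have si1 : si <= 1 by exact: le_trans m1.
  pose k := s *: (X - v) + t%:C *: X + s ^+ 2 *: w.
  have hk : hh = s *: v + k.
    have tele (a b c' d' : 'C^n(R)) : a + (b - a + c' + d') = b + c' + d'.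
      by rewrite !addrA (addrAC a) subrr add0r.
    by rewrite /hh /k scalerBr scalerDl tele.
  have nk : nrm k <= 2 * e2 * si + h * B.
    rewrite (le_trans (nrmD _ _))// (le_trans (lerD (nrmD _ _) (lexx _)))//.
    rewrite (nrmZ s (X - v)) (nrmZ t%:C X) (nrmZ (s ^+ 2) w) nrmR nrmX -/si ger0_norm//.
    have a1 : si * nrm (X - v) <= e2 * si by rewrite mulrC ler_wpM2r.
    have a2 : t * nrm X <= h * B by rewrite ler_pM// nrm_ge0.
    have a3 : si ^+ 2 * nrm w <= e2 * si.
      rewrite expr2 -mulrA mulrC ler_wpM2r// (le_trans _ mB)// ler_pM//.
    clear -a1 a2 a3; lra.
  have nsv : nrm (s *: v) <= si * B by rewrite nrmZ ler_wpM2l.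
  have nhh : nrm hh <= 3 * B * si + B * h.
    rewrite hk (le_trans (nrmD _ _))//.
    have e2s : e2 * si <= B * si by rewrite ler_wpM2r.
    clear -e2s nsv nk; lra.
  have h0 : 0 <= h by exact: le_trans th.
  have h1 : h <= 1 by exact: le_trans m1.
  have hhd : nrm hh < d.
    have a1 : 3 * B * si <= 3 * B * m by rewrite ler_pM2l// mulr_gt0.
    have a2 : B * h <= B * m by rewrite ler_pM2l.
    have a3 : 0 < B * m by rewrite mulr_gt0.
    clear -a1 a2 a3 nhh md; lra.
  have Uzh : U (z + hh).
    apply: (H1 _ _).1; rewrite addrAC (le_lt_trans (nrmD _ _))//.
    have a1 : 3 * B * si <= 3 * B * m by rewrite ler_pM2l// mulr_gt0.
    have a2 : B * h <= B * m by rewrite ler_pM2l.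
    have a5 : 0 < B * m by rewrite mulr_gt0.
    have a3 : m <= B * m by rewrite ler_peMl// ltW.
    have a4 : nrm (z - p) + nrm hh < d by clear -zm nhh a1 a2 a3 a5 md; lra.
    by have [] := dd _ a4.
  split=> //.
  have [_ _ hd3] := dd _ hhd.
  have := H3 z hh zd3 hd3; rewrite ler_norml => /andP[_ T].
  have Lhh : real_derive r hh z <= L p (s ^+ 2 *: w) + e1 * (si ^+ 2 * B).
    have -> : real_derive r hh z = real_derive r (s ^+ 2 *: w) z.
      apply: etrans (LD ((s + t%:C) *: X) (s ^+ 2 *: w)) _.
      by apply: etrans (congr1 (fun y => y + _) (LX (s + t%:C))) _; exact: add0r.
    have := H2 z zd2 (s ^+ 2 *: w); rewrite ler_norml => /andP[_ HL].
    rewrite -lerBlDl (le_trans HL)// ler_wpM2l ?(ltW e10)//.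
    by rewrite nrmZ nrmX ler_wpM2l ?exprn_ge0.
  have Hhh : H hh <= H (s *: v) + M * (6 * e2 * B * si ^+ 2 + 6 * B ^+ 2 * h).
    have := taylor_HD T2 (s *: v) k; rewrite -hk ler_norml => /andP[_].
    have k0 := nrm_ge0 k; have sv0 := nrm_ge0 (s *: v).
    have : nrm k * (nrm (s *: v) + nrm k) <= 6 * e2 * B * si ^+ 2 + 6 * B ^+ 2 * h.
      have e2s : e2 * si <= B * si by rewrite ler_wpM2r.
      apply: (@le_trans _ _ ((2 * e2 * si + h * B) * (3 * B * si + B * h))).
        by rewrite ler_pM ?addr_ge0//; clear -nsv nk e2s; lra.
      rewrite (_ : _ * _ = 6 * e2 * B * si ^+ 2 + h * B * (2 * e2 * si + 3 * B * si + B * h)); last by ring.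
      rewrite lerD2l (_ : 6 * _ * _ = h * B * (6 * B)); last by ring.
      rewrite ler_wpM2l ?mulr_ge0 ?(ltW B0)//.
      have b1 : B * si <= B * 1 by rewrite ler_pM2l.
      have b2 : B * h <= B * 1 by rewrite ler_pM2l.
      clear -e2s b1 b2; lra.
    move=> /(ler_wpM2l M0); rewrite mulrA => X1 X2.
    by rewrite -lerBlDl (le_trans X2).
  have Ehh : e1 * nrm hh ^+ 2 <= e1 * (9 * B ^+ 2 * si ^+ 2) + 7 * B ^+ 2 * h.
    apply: (@le_trans _ _ (e1 * (9 * B ^+ 2 * si ^+ 2 + 7 * B ^+ 2 * h))).
      rewrite ler_pM2l//; apply: (@le_trans _ _ ((3 * B * si + B * h) ^+ 2)).
        by rewrite ler_pXn2r// nnegrE ?nrm_ge0 ?addr_ge0 ?mulr_ge0 ?(ltW B0).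
      rewrite (_ : _ ^+ 2 = 9 * B ^+ 2 * si ^+ 2 + B ^+ 2 * h * (6 * si + h)); last by ring.
      rewrite lerD2l (_ : 7 * _ * _ = B ^+ 2 * h * 7); last by ring.
      rewrite ler_wpM2l ?(mulr_ge0 (ltW BB) h0)//; clear -si1 h1; lra.
    by rewrite mulrDr lerD2l ler_piMl// mulr_ge0// mulr_ge0// ltW.
  have Q := Hc s; rewrite -/si in Q.
  have F1 : e1 * (si ^+ 2 * B) + e1 * (9 * B ^+ 2 * si ^+ 2) <= c / 2 * si ^+ 2.
    have -> : e1 * (si ^+ 2 * B) + e1 * (9 * B ^+ 2 * si ^+ 2) = (e1 * B + 9 * (e1 * B ^+ 2)) * si ^+ 2 by ring.
    rewrite ler_wpM2r ?exprn_ge0//.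
    have : e1 * B <= e1 * B ^+ 2 by rewrite ler_pM2l// expr2 ler_peMl// ltW.
    move: e1c; rewrite mulrCA; move: (e1 * B) (e1 * B ^+ 2) => y1 y2 y3 y4; clear -y3 y4; lra.
  have F2 : M * (6 * e2 * B * si ^+ 2) <= c * si ^+ 2.
    rewrite (_ : M * _ = e2 * (6 * M * B) * si ^+ 2); last by ring.
    by rewrite ler_wpM2r ?exprn_ge0// (le_trans _ e2c)// ler_pM2l// ler_pM2r// ler_pM2l// lerDl.
  move: T Lhh Hhh Ehh Q F1 F2; rewrite /K /L.
  move: (r (z + hh)) (r z) (real_derive r hh z) (H hh) (H (s *: v)) (real_derive r _ p) => a1 a2 a3 a4 a5 a6.
  move: (e1 * nrm hh ^+ 2 : R) => a7.
  move=> T Lhh Hhh Ehh Q F1 F2; clear -T Lhh Hhh Ehh Q F1 F2.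
  clearbody B e1 e2 si; lra.
have nt : nrm (t%:C *: X) <= t * B by rewrite nrmZ nrmR ger0_norm// ler_wpM2l.
have ntd : nrm (t%:C *: X) < d.
  have a1 : t * B <= m * B by rewrite ler_wpM2r// ltW.
  have a2 : 0 < m * B by rewrite mulr_gt0.
  lra.
have [_ _ td3] := dd _ ntd.
have := H3 z _ zd3 td3; rewrite LX subr0.
have nt2 : nrm (t%:C *: X) ^+ 2 <= t ^+ 2 * B ^+ 2.
  by rewrite -exprMn ler_pXn2r// nnegrE ?nrm_ge0 ?mulr_ge0 ?(ltW B0).
have := taylor_H_le T2 (t%:C *: X).
have a1 : M * nrm (t%:C *: X) ^+ 2 <= M * (t ^+ 2 * B ^+ 2) by rewrite ler_wpM2l.
have a2 : e1 * nrm (t%:C *: X) ^+ 2 <= t ^+ 2 * B ^+ 2.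
  by rewrite (le_trans _ nt2)// ler_piMl// exprn_ge0// nrm_ge0.
have a3 : 0 <= t ^+ 2 * B ^+ 2 by rewrite mulr_ge0 ?exprn_ge0 ?(ltW B0).
have a4 : 0 <= M * (t ^+ 2 * B ^+ 2) by rewrite mulr_ge0.
have -> : K * t ^+ 2 = 3 * (M * (t ^+ 2 * B ^+ 2)) + 7 * (t ^+ 2 * B ^+ 2).
  by rewrite /K; ring.
move: a1 a2; move: (r (_ + _)) (r z) (H _) (nrm _ ^+ 2) => b1 b2 b3 b4.
move: (M * b4) (e1 * b4) (M * _) (t ^+ 2 * _) a3 a4 => b5 b6 b7 b8 a3 a4 a1 a2.
rewrite !ler_norml; clear -a1 a2 a3 a4; lra.
Qed.

(** * Curves of complex tangential directions *)

Section Polygon.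
Variables (R : realType) (n : nat).
Local Notation C := (R[i]^o).
Local Notation Cn := ('C^n(R)).

(** At [x = t - i * eta] it is the time spent on edge [i] up to time [t]. *)
Definition clamp (x eta : R) : R := Num.min (Num.max x 0) eta.

Lemma clamp_sum (eta t : R) (k : nat) : 0 <= eta ->
  \sum_(i < k) clamp (t - i%:R * eta) eta = Num.min (Num.max t 0) (k%:R * eta).
Proof.
move=> eta0; elim: k => [|k ih].
  by rewrite big_ord0 mul0r; apply/esym/min_idPr; rewrite le_max lexx orbT.
rewrite big_ord_recr /= {}ih -[k.+1]addn1 natrD mulrDl mul1r /clamp.
have k0 : 0 <= k%:R * eta by rewrite mulr_ge0.
move: (k%:R * eta) k0 => x x0; rewrite !(minElt, maxElt).
by do ![case: ifPn; rewrite -?leNgt]; lra.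
Qed.

Lemma clamp_le (x y eta : R) : x <= y -> clamp x eta <= clamp y eta.
Proof.
move=> xy; rewrite /clamp !(minElt, maxElt).
by do ![case: ifPn; rewrite -?leNgt]; lra.
Qed.

Section polygon.
Variables (z0 : Cn) (X : Cn -> Cn) (eta : R).
Hypothesis eta0 : 0 < eta.

Fixpoint euler (i : nat) : Cn :=
  if i is j.+1 then euler j + eta%:C *: X (euler j) else z0.

(** One formula for all times: an increment over any interval is a sum of clamped durations times
    edge vectors, with no case distinction on the edges met. *)
Definition polygon (k : nat) (t : R) : Cn :=
  z0 + \sum_(i < k) (clamp (t - i%:R * eta) eta)%:C *: X (euler i).

Lemma eulerE i : euler i = z0 + \sum_(j < i) eta%:C *: X (euler j).
Proof.
elim: i => [|i ih]; first by rewrite big_ord0 addr0.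
by rewrite big_ord_recr /= addrA -ih.
Qed.

Lemma polygon_stable k i t : (i <= k)%N -> t <= i%:R * eta -> polygon k t = polygon i t.
Proof.
move=> ik ti; rewrite /polygon -!(big_mkord xpredT (fun i => (clamp (t - i%:R * eta) eta)%:C *: X (euler i))).
rewrite (big_cat_nat _ ik)//= [X in _ + (_ + X)]big_nat_cond.
rewrite [X in _ + (_ + X)]big1 ?addr0// => j /andP[/andP[ij _] _].
rewrite (_ : clamp _ _ = 0) ?scale0r// /clamp.
have : t <= j%:R * eta by rewrite (le_trans ti)// ler_pM2r// ler_nat.
by rewrite -subr_le0 => /max_idPr ->; apply/min_idPl/ltW.
Qed.

Lemma polygon_full i t : i%:R * eta <= t -> polygon i t = euler i.
Proof.
move=> it; rewrite eulerE; congr (_ + _); apply: eq_bigr => j _.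
congr (_%:C *: _); rewrite /clamp; apply/min_idPr.
rewrite le_max; apply/orP; left.
have : j.+1%:R * eta <= i%:R * eta by rewrite ler_pM2r// ler_nat.
rewrite -[j.+1]addn1 natrD mulrDl mul1r; lra.
Qed.

Lemma polygon_piece k i t : (i < k)%N -> i%:R * eta <= t <= i.+1%:R * eta ->
  polygon k t = euler i + (t - i%:R * eta)%:C *: X (euler i).
Proof.
move=> ik /andP[it ti]; rewrite (polygon_stable ik ti).
rewrite /polygon big_ord_recr addrA; congr (_ + _); first exact: polygon_full.
congr (_%:C *: _); rewrite /clamp.
have -> : Num.max (t - i%:R * eta) 0 = t - i%:R * eta.
  by apply/max_idPl; rewrite subr_ge0.
apply/min_idPl.
by move: ti; rewrite -[i.+1]addn1 natrD mulrDl mul1r -lerBlDl.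
Qed.

Lemma polygon_piece_ex k t : (0 < k)%N -> 0 <= t <= k%:R * eta ->
  exists2 i, (i < k)%N & i%:R * eta <= t <= i.+1%:R * eta.
Proof.
move=> + /andP[t0]; elim: k => // k ih _ tk.
have [tk'|kt] := leP t (k%:R * eta); last by exists k => //; rewrite ltW.
have [k0|k0] := posnP k.
  by exists 0%N; rewrite // mul0r t0 (le_trans tk')// ler_pM2r// ler_nat k0.
by have [i ik Hi] := ih k0 tk'; exists i => //; rewrite ltnS ltnW.
Qed.

(** An increment is a weighted sum of edge vectors with total weight [t - u]. With [c = v] it bounds
    the speed from below, with [c = 0] from above. *)
Lemma polygon_diff k (c : Cn) (e t u : R) :
  (forall i, (i < k)%N -> nrm (X (euler i) - c) <= e) -> 0 <= u -> u <= t -> t <= k%:R * eta ->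
  nrm (polygon k t - polygon k u - (t - u)%:C *: c) <= e * (t - u).
Proof.
move=> Xc u0 ut tk; have t0 := le_trans u0 ut.
have tuE : t - u = \sum_(i < k) (clamp (t - i%:R * eta) eta - clamp (u - i%:R * eta) eta).
  rewrite sumrB !clamp_sum ?(ltW eta0)//.
  rewrite (max_idPl t0) (max_idPl u0) (min_idPl tk).
  by rewrite (min_idPl (le_trans ut tk)).
rewrite /polygon opprD addrACA subrr add0r -sumrB.
rewrite {1}tuE rmorph_sum scaler_suml -sumrB (le_trans (nrm_sum _ _ _))//.
rewrite tuE mulr_sumr ler_sum// => i _.
rewrite -scalerBl -rmorphB -scalerBr nrmZ nrmR ger0_norm ?subr_ge0 ?clamp_le ?lerD2r//.
by rewrite mulrC ler_wpM2r ?subr_ge0 ?clamp_le ?lerD2r// Xc.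
Qed.

End polygon.

Lemma velocity_affine (g : R -> Cn) (a b : Cn) (t t1 t2 c : R) : t1 < t < t2 ->
  (forall s, t1 < s < t2 -> g s = a + (s - c)%:C *: b) -> velocity g t = b.
Proof.
move=> tt gE; apply/rowP => j; rewrite !mxE.
have D (f : R -> R) (x y : R) : (forall s, t1 < s < t2 -> f s = x + (s - c) * y) -> derive1 f t = y.
  move=> fE; rewrite derive1E (@near_eq_derive _ _ _ _ (fun s => x + (s - c) * y)).
    have : is_derive t 1 (fun s : R => x + (s - c) * y) y.
      by apply: is_derive_eq; rewrite /GRing.scale/=; ring.
    by move=> [_ ->].
  move/andP: tt => [tt1 tt2].
  near=> s; apply: fE; apply/andP; split; near: s.
    exact: lt_nbhsr.
  exact: lt_nbhsl.
have gj s : t1 < s < t2 -> g s 0 j = a 0 j + (s - c)%:C * b 0 j.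
  by move=> /gE ->; rewrite !mxE.
apply: cplx_eq => /=.
  apply: (D _ (complex.Re (a 0 j))) => s /gj ->.
  by case: (a 0 j) (b 0 j) => [? ?] [? ?] /=; ring.
apply: (D _ (complex.Im (a 0 j))) => s /gj ->.
by case: (a 0 j) (b 0 j) => [? ?] [? ?] /=; ring.
Unshelve. all: by end_near.
Qed.

Lemma cdiff_sqr (w : Cn) (a : C) : cdiff (fun z : C => z ^+ 2 *: w) a ((2 * a) *: w).
Proof.
move=> e e0; have w0 := nrm_ge0 w.
exists (e / (nrm w + 1)); first by rewrite divr_gt0//; lra.
move=> h; rewrite ltr_pdivlMr; last by lra.
move=> hd; rewrite scalerA -!scalerBl.
have -> : (a + h) ^+ 2 - a ^+ 2 - h * (2 * a) = h * h by ring.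
rewrite nrmZ nrmM mulrAC ler_wpM2r ?nrm_ge0//.
have := nrm_ge0 h; nra.
Qed.

(** The competitor is the bent disc reparametrised by [s = m z], whose derivative at 0 is [m v]. *)
Lemma kobayashi_royden_le (Omega : set Cn) (x v w : Cn) (m : R) : 0 < m ->
  (forall s : C, nrm s < m -> Omega (x + s *: v + s ^+ 2 *: w)) ->
  (kobayashi_royden Omega x v <= (m^-1)%:E)%E.
Proof.
move=> m0 Om; apply: ereal_inf_lbound.
pose phi (z : C) : Cn := (x + z *: (m%:C *: v)) + z ^+ 2 *: ((m ^+ 2)%:C *: w).
have dphi (a : C) : cdiff phi a ((0 + m%:C *: v) + (2 * a) *: ((m ^+ 2)%:C *: w)).
  by apply: cdiffD (cdiffD _ _) _; [exact: cdiff_cst|exact: cdiff_scale|exact: cdiff_sqr].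
exists (m^-1)%:C => /=; last first.
  by rewrite /cmod; congr EFin; have := nrmR m^-1; rewrite /nrm => ->; rewrite gtr0_norm// invr_gt0.
exists phi; split.
- move=> a a1; split; first by have [] := cdiff_is_derive (dphi a).
  rewrite /phi !scalerA (_ : a ^+ 2 * _ = (a * m%:C) ^+ 2); last first.
    by rewrite exprMn rmorphXn.
  apply: Om; rewrite nrmM nrmR gtr0_norm// gtr_pMl//.
  by move: a1; rewrite nrmE ltcR.
- by rewrite /phi !scale0r expr0n /= scale0r !addr0.
- have [_ E] := cdiff_is_derive (dphi 0).
  rewrite /derive1 E add0r mulr0 scale0r addr0 scalerA -rmorphM mulVf ?gt_eqF//.
  by rewrite scale1r.
Qed.

End Polygon.

Section TangentCurves.
Variables (R : realType) (n : nat).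
Local Notation C := (R[i]^o).
Local Notation Cn := ('C^n(R)).

Lemma taylor2_continuous (U : set Cn) (r : Cn -> R) p H M : taylor2 U r p H M ->
  exists2 d : R, 0 < d & forall q, nrm (q - p) < d -> U q /\
    forall e : R, 0 < e -> exists2 d' : R, 0 < d' &
      forall z, nrm (z - q) < d' -> `|r z - r q| < e.
Proof.
move=> T2; have [d1 d10 H1] := taylor_rlin T2.
have [d2 d20 H2] := taylor_expansion T2 (ltr01 : 0 < 1 :> R).
have M0 := taylor_M T2.
exists (Num.min d1 d2); first by rewrite lt_min d10.
move=> q; rewrite lt_min => /andP[/H1[Uq Lq] qd]; split=> // e e0.
pose S := \sum_t `|real_derive r (rbasis R t) q|.
have S0 : 0 <= S by rewrite sumr_ge0.
pose K := S + M + 1; have K0 : 0 < K by rewrite /K; lra.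
exists (Num.min (Num.min 1 d2) (e / K)); first by rewrite !lt_min ltr01 d20 divr_gt0.
move=> z; rewrite !lt_min => /andP[/andP[z1 zd] ze].
have := H2 q (z - q) qd zd; rewrite subrKC.
have := rlin_bound (z - q) Lq; rewrite -/S.
have := taylor_H_le T2 (z - q).
move: ze; rewrite ltr_pdivlMr//.
have := nrm_ge0 (z - q); move: z1.
set x := nrm _; move: (real_derive r _ q) (H _) (r z) (r q) => a b y1 y2 x1 x0 xe.
have xx : x ^+ 2 <= x by rewrite expr2 ler_piMl// ltW.
have Mx : M * x ^+ 2 <= M * x by rewrite ler_wpM2l.
rewrite mul1r !ler_norml ltr_norml => /andP[b1 b2] /andP[a1 a2] /andP[h1 h2].
have Mx0 : 0 <= M * x by rewrite mulr_ge0.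
move: xe; rewrite /K; clear -Mx0 xx Mx b1 b2 a1 a2 h1 h2 x0 M0 S0.
lra.
Qed.

(** Euler polygons for the field [X], starting at depth about [tau] below [p]. [L], [c1] and [T0]
    come before [T] and [d]: the discs that bound the metric have the fixed radius [m], whatever the
    depth. [S] lists the vertices, where the velocity is not controlled. *)
Lemma tangent_curves (Omega U : set Cn) (r : Cn -> R) (p : Cn) (H : Cn -> R) (M : R)
    (N v w : Cn) (c : R) :
  taylor2 U r p H M -> Omega `&` U = [set z | U z /\ r z < 0] -> r p = 0 ->
  0 < real_derive r N p -> v != 0 -> 0 < c ->
  (forall s : C, real_derive r (s *: v) p = 0) ->
  (forall s : C, real_derive r (s ^+ 2 *: w) p + H (s *: v) / 2 <= - c * nrm s ^+ 2) ->
  forall rho : R, 0 < rho ->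
  exists L c1 T0 : R, [/\ 0 < L, 0 < c1, 0 < T0 &
  forall T d : R, 0 < T -> T <= T0 -> 0 < d -> exists (g : R -> Cn) (S : seq R),
    [/\ forall t, 0 <= t <= T -> [/\ nrm (g t - p) <= rho, Omega (g t) & - d < r (g t) < 0],
        nrm (g 0 - p) < d,
        forall u t, 0 <= u -> u <= t -> t <= T ->
          c1 * (t - u) <= nrm (g t - g u) <= L * (t - u) &
        forall t, 0 <= t <= T -> t \notin S ->
          (kobayashi_royden Omega (g t) (velocity g t) <= L%:E)%E]].
Proof.
move=> T2 OU rp LN v0 c0 Lv HQ rho rho0.
have nv : 0 < nrm v by rewrite nrm_gt0.
have nN := nrm_ge0 N.
have nv2 : 0 < nrm v / 2 by rewrite divr_gt0.
have [e0 [m [K [e00 e0v m0 K0 Hfam]]]] := tangent_disc_family T2 c0 HQ nv2.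
have [dX dX0 HX] := complex_tangent_frame T2 LN Lv e00.
(* The default [v] far from [p] keeps the bound on [X] unconditional, so the length of the polygon
   can be estimated before its vertices are known to stay near [p]. *)
have HX' z : exists Y : Cn, nrm (Y - v) <= e0 /\
    (nrm (z - p) < dX -> forall s : C, real_derive r (s *: Y) z = 0).
  have [zd|zd] := ltP (nrm (z - p)) dX.
    by have [Y Yv HY] := HX z zd; exists Y.
  by exists v; split=> //; rewrite subrr nrm0 ltW.
have [X Xv] := choice HX'.
have [m' [m'0 m'm m'd m'r]] : exists m' : R, [/\ 0 < m', m' <= m, m' <= dX & m' <= rho].
  exists (Num.min m (Num.min dX rho)).
  by rewrite !lt_min m0 dX0 !ge_min !lexx !orbT.
pose B := nrm v + e0; have B0 : 0 < B by rewrite addr_gt0.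
have XB z : nrm (X z - 0) <= B.
  by have [h1 _] := Xv z; have := nrmD (X z - v) v; rewrite subrK subr0 /B; lra.
have mV : 0 < m^-1 by rewrite invr_gt0.
exists (m^-1 + B), (nrm v / 2), (m' / (2 * B)); split=> //.
- exact: addr_gt0.
- by rewrite divr_gt0// mulr_gt0.
move=> T d T0 TT0 d0.
have TB : T * B <= m' / 2.
  by move: TT0; rewrite ler_pdivlMr ?mulr_gt0//; lra.
have [d3 d30 H3] := taylor_expansion T2 (ltr01 : 0 < 1 :> R).
have M0 := taylor_M T2.
have nN1 : 0 < nrm N + 1 by lra.
have [A [A0 AE]] : exists A : R, 0 < A /\ A = (M + 1) * (nrm N + 1) ^+ 2.
  by exists ((M + 1) * (nrm N + 1) ^+ 2); split=> //; rewrite mulr_gt0 ?exprn_gt0//; lra.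
have [LN' [LN'0 LNE]] : exists l : R, 0 < l /\ real_derive r N p = l.
  by exists (real_derive r N p).
pose D := Num.min (Num.min d (Num.min d3 m')) 1.
have D0 : 0 < D by rewrite !lt_min d0 d30 m'0 ltr01.
(* The three bounds keep [z0] within [D / 2] of [p], make the second order terms at most half of the
   first order term [tau * LN'], and keep the depth below [d / 2]. *)
have [tau [tau0 tauN tauA tauL]] : exists tau : R, [/\ 0 < tau, tau * (nrm N + 1) < D / 2,
    tau * A <= LN' / 2 & tau * LN' < d / 4].
  exists (Num.min (D / (4 * (nrm N + 1))) (Num.min (LN' / (2 * A)) (d / (8 * LN')))).
  have a1 : 0 < D / (4 * (nrm N + 1)) by rewrite divr_gt0// mulr_gt0.
  have a2 : 0 < LN' / (2 * A) by rewrite divr_gt0// mulr_gt0.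
  have a3 : 0 < d / (8 * LN') by rewrite divr_gt0// mulr_gt0.
  set tau := Num.min _ _; have tau0 : 0 < tau by rewrite !lt_min a1 a2 a3.
  have t1 : tau <= D / (4 * (nrm N + 1)) by rewrite ge_min lexx.
  have t2 : tau <= LN' / (2 * A) by rewrite !ge_min lexx orbT.
  have t3 : tau <= d / (8 * LN') by rewrite !ge_min lexx !orbT.
  clearbody tau.
  split.
  - by [].
  - move: t1; rewrite ler_pdivlMr ?mulr_gt0//; clear -D0; lra.
  - move: t2; rewrite ler_pdivlMr ?mulr_gt0//; clear; lra.
  - move: t3; rewrite ler_pdivlMr ?mulr_gt0//; clear -d0; lra.
pose z0 := p + (- tau)%:C *: N.
have z0p : nrm (z0 - p) < D / 2.
  rewrite /z0 addrAC subrr add0r nrmZ nrmR normrN gtr0_norm//.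
  by rewrite (le_lt_trans _ tauN)// ler_pM2l// lerDl.
have DD x : x < D -> [/\ x < d, x < d3, x < m' & x < 1].
  by rewrite !lt_min => /andP[/and3P[]].
have DD' x : x < D / 2 -> x < D by move=> h; clear -h D0; lra.
have [r0 r0d] : r z0 <= - (tau * LN' / 2) /\ - (d / 2) < r z0.
  have pp : nrm (p - p) < d3 by rewrite subrr nrm0.
  have Lp : rlin (fun h => real_derive r h p).
    have [dd dd0 /(_ p)] := taylor_rlin T2.
    by rewrite subrr nrm0 => /(_ dd0)[].
  have nt : nrm ((- tau)%:C *: N) = tau * nrm N.
    by rewrite nrmZ nrmR normrN gtr0_norm.
  have tN : nrm ((- tau)%:C *: N) < d3.
    rewrite nt; have [|_ h _ _] := DD (tau * (nrm N + 1)); first exact: DD'.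
    by rewrite (le_lt_trans _ h)// ler_pM2l// lerDl.
  have := H3 p _ pp tN; rewrite -/z0 rp subr0 Lp.2 LNE nt mul1r.
  have := taylor_H_le T2 ((- tau)%:C *: N); rewrite nt.
  have : (tau * nrm N) ^+ 2 <= tau * (tau * (nrm N + 1) ^+ 2).
    rewrite exprMn expr2 -!mulrA !ler_pM2l// ler_pXn2r ?nnegrE//; clear -nN; lra.
  set Q := (tau * nrm N) ^+ 2 => hQ.
  have hQM : M * Q <= M * (tau * (tau * (nrm N + 1) ^+ 2)) by rewrite ler_wpM2l.
  have hA : (M + 1) * (tau * (tau * (nrm N + 1) ^+ 2)) <= tau * (LN' / 2).
    rewrite (_ : (M + 1) * _ = tau * (tau * A)); last by rewrite AE; ring.
    by rewrite ler_pM2l.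
  have Q0 : 0 <= M * Q by rewrite mulr_ge0// sqr_ge0.
  have tL : 0 < tau * LN' by rewrite mulr_gt0.
  move: hQ hQM hA; rewrite mulrDl mul1r.
  move: (tau * (tau * _)) => Q2 hQ hQM hA.
  rewrite !ler_norml => /andP[h1 h2] /andP[h3 h4].
  clear -hQ hQM hA h1 h2 h3 h4 Q0 tL tauL; lra.
have r0neg : r z0 < 0.
  have : 0 < tau * LN' by rewrite mulr_gt0.
  clear -r0; lra.
pose d1 := - r z0; have d10 : 0 < d1 by rewrite oppr_gt0.
(* The step is chosen after the depth [d1]: the drift [T * K * eta] over all edges plus the rise
   [K * eta] along one disc must stay within [d1 / 2]. *)
pose x := Num.min (Num.min 1 m) (d1 / (2 * (T + 2) * K)).
have TK0 : 0 < 2 * (T + 2) * K by rewrite !mulr_gt0//; clear -T0; lra.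
have x0 : 0 < x by rewrite !lt_min ltr01 m0 divr_gt0.
pose k := (Num.bound (T / x)).+1.
have Tx : 0 <= T / x by rewrite divr_ge0// ltW.
have k0 : 0 < k%:R :> R by rewrite ltr0n.
pose eta := T / k%:R; have eta0 : 0 < eta by rewrite divr_gt0.
have keta : k%:R * eta = T by rewrite /eta; field; rewrite gt_eqF.
have etax : eta < x.
  rewrite ltr_pdivrMr// mulrC -ltr_pdivrMr// (lt_trans (archi_boundP Tx))//.
  by rewrite ltr_nat.
have [eta1 etam etaK] : [/\ eta <= 1, eta <= m & (T + 2) * K * eta <= d1 / 2].
  split.
  - by rewrite (le_trans (ltW etax))// !ge_min lexx.
  - by rewrite (le_trans (ltW etax))// !ge_min lexx orbT.
  - have : eta <= d1 / (2 * (T + 2) * K) by rewrite (le_trans (ltW etax))// !ge_min lexx orbT.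
    by rewrite ler_pdivlMr//; clear; lra.
pose z i := euler z0 X eta i.
have poly0 j : polygon z0 X eta j 0 = z0.
  rewrite (@polygon_stable _ _ z0 X eta eta0 j 0 0)// ?mul0r//.
  by rewrite /polygon big_ord0 addr0.
have near_z0 (j : nat) t : 0 <= t -> t <= j%:R * eta -> nrm (polygon z0 X eta j t - z0) <= B * t.
  move=> t0 tj; have := @polygon_diff _ _ z0 X eta eta0 j 0 B t 0 (fun i _ => XB _) (lexx 0) t0 tj.
  by rewrite poly0 scaler0 !subr0.
have ieta (i : nat) : (i <= k)%N -> i%:R * eta <= T.
  by move=> ik; rewrite -keta ler_pM2r// ler_nat.
have m'2 : D / 2 <= m' / 2.
  have : D <= m' by rewrite /D !ge_min lexx !orbT.
  clear; lra.
have zp i : (i <= k)%N -> nrm (z i - p) < m'.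
  move=> ik; have i0 : 0 <= i%:R * eta by rewrite mulr_ge0// ltW.
  have := near_z0 i (i%:R * eta) i0 (lexx _).
  rewrite (polygon_full z0 X eta0 (lexx (i%:R * eta))) -/(z i).
  have := nrm_triangle z0 (z i) p; have := ieta i ik.
  rewrite -(ler_pM2r B0) => h1 h2 h3; clear -h1 h2 h3 TB z0p m'2; lra.
have fam i : (i <= k)%N -> (forall (s : C) (t h : R), nrm s <= m -> 0 <= t -> t <= h -> h <= m ->
       U (z i + ((s + t%:C) *: X (z i) + s ^+ 2 *: w)) /\
       r (z i + ((s + t%:C) *: X (z i) + s ^+ 2 *: w)) <= r (z i) + K * h) /\
    (forall t : R, 0 <= t -> t <= m -> `|r (z i + t%:C *: X (z i)) - r (z i)| <= K * t ^+ 2).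
  move=> ik; have zi := zp i ik; have [Xi1 Xi2] := Xv (z i).
  exact: (Hfam (z i) (X (z i)) (lt_le_trans zi m'm) Xi1 (Xi2 (lt_le_trans zi m'd))).
have rz i : (i <= k)%N -> `|r (z i) - r z0| <= i%:R * (K * eta ^+ 2).
  elim: i => [|i ih] ik; first by rewrite subrr normr0 mul0r.
  have [_ /(_ eta (ltW eta0) etam)] := fam i (ltnW ik).
  have := ih (ltnW ik); rewrite -[i.+1]addn1 natrD mulrDl mul1r addn1 => h1 h2.
  rewrite (_ : r (z i.+1) - r z0 = (r (z i.+1) - r (z i)) + (r (z i) - r z0)); last by rewrite addrA subrK.
  by rewrite (le_trans (ler_normD _ _))// addrC lerD.
have Keta : 0 <= K * eta by rewrite mulr_ge0 ?ltW.
have rz' i : (i <= k)%N -> `|r (z i) - r z0| <= T * (K * eta).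
  move=> ik; rewrite (le_trans (rz i ik))//.
  rewrite (_ : i%:R * _ = i%:R * eta * (K * eta)); last by ring.
  by rewrite ler_wpM2r// ieta.
pose g := polygon z0 X eta k.
have gt_piece t : 0 <= t <= T -> exists i : nat, [/\ (i < k)%N, i%:R * eta <= t <= i.+1%:R * eta,
    g t = z i + (t - i%:R * eta)%:C *: X (z i), 0 <= t - i%:R * eta & t - i%:R * eta <= eta].
  move=> tT; have [//||i ik ti] := @polygon_piece_ex _ eta eta0 k t; first by rewrite keta.
  exists i; split=> //.
  - by rewrite /g (polygon_piece z0 X eta0 ik ti).
  - by case/andP: ti; rewrite subr_ge0.
  - case/andP: ti => _; rewrite -[i.+1]addn1 natrD mulrDl mul1r; clear; lra.
have half_d1 : T * (K * eta) + K * eta <= d1 / 2.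
  by move: etaK Keta; clear; lra.
exists g, [seq i%:R * eta | i <- iota 0 k.+1]; split.
- move=> t tT; have [i [ik ti gE t'0 t'eta]] := gt_piece t tT.
  set t' := t - i%:R * eta in gE t'0 t'eta.
  have [fam1 fam2] := fam i (ltnW ik).
  have t'm := le_trans t'eta etam.
  have Ug : U (g t).
    have := fam1 0 t' m; rewrite nrm0 (ltW m0) => /(_ isT t'0 t'm (lexx _))[].
    by rewrite add0r expr0n /= scale0r addr0 gE.
  have rg : `|r (g t) - r z0| <= d1 / 2.
    have h1 := fam2 t' t'0 t'm; have h2 := rz' i (ltnW ik).
    rewrite (_ : r (g t) - r z0 = (r (g t) - r (z i)) + (r (z i) - r z0)); last by rewrite addrA subrK.
    rewrite (le_trans (ler_normD _ _))// (le_trans _ half_d1)// addrC lerD// gE.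
    rewrite (le_trans h1)// ler_wpM2l ?(ltW K0)// expr2 (le_trans _ t'eta)//.
    by rewrite ler_piMl// (le_trans t'eta).
  have [rg1 rg2] : r (g t) < 0 /\ - d < r (g t).
    move: rg; rewrite /d1 ler_norml => /andP[h1 h2].
    by clear -h1 h2 r0neg r0d; split; lra.
  split.
  + rewrite (le_trans _ m'r)//; case/andP: tT => t0 tT.
    have tk : t <= k%:R * eta by rewrite keta.
    have := near_z0 k t t0 tk; rewrite -/g.
    have := nrm_triangle z0 (g t) p.
    have : t * B <= T * B by rewrite ler_pM2r.
    move=> h1 h2 h3; clear -h1 h2 h3 z0p TB m'2; lra.
  + suff : (Omega `&` U) (g t) by case.
    by rewrite OU.
  + by rewrite rg1 rg2.
- rewrite /g poly0 (lt_le_trans z0p)//.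
  have : D <= d by rewrite !ge_min lexx.
  move: D0; clear; lra.
- move=> u t u0 ut tT; have tu0 : 0 <= t - u by rewrite subr_ge0.
  have tk : t <= k%:R * eta by rewrite keta.
  have := @polygon_diff _ _ z0 X eta eta0 k v e0 t u (fun i _ => (Xv _).1) u0 ut tk.
  rewrite -/g => h1.
  have h2 := @polygon_diff _ _ z0 X eta eta0 k 0 B t u (fun i _ => XB _) u0 ut tk.
  rewrite -/g scaler0 subr0 in h2.
  have h3 : nrm ((t - u)%:C *: v) = (t - u) * nrm v by rewrite nrmZ nrmR ger0_norm.
  have h4 := nrm_lb ((t - u)%:C *: v) (g t - g u - (t - u)%:C *: v).
  rewrite subrKC h3 in h4.
  have h5 : e0 * (t - u) <= nrm v / 2 * (t - u) by rewrite ler_wpM2r.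
  have h6 : 0 <= m^-1 * (t - u) by rewrite mulr_ge0// ltW.
  apply/andP; split; first by clear -h1 h4 h5; lra.
  by rewrite mulrDl; clear -h2 h6; lra.
- move=> t tT tS; have [i [ik ti gE t'0 t'eta]] := gt_piece t tT.
  set t' := t - i%:R * eta in gE t'0 t'eta.
  have tii : i%:R * eta < t < i.+1%:R * eta.
    rewrite !lt_neqAle; case/andP: ti => -> ->; rewrite !andbT.
    apply/andP; split; apply: contraNneq tS.
      by move=> <-; apply: (map_f (fun j : nat => j%:R * eta)); rewrite mem_iota /= add0n ltnS ltnW.
    by move=> ->; apply: (map_f (fun j : nat => j%:R * eta)); rewrite mem_iota /= add0n ltnS.
  have -> : velocity g t = X (z i).
    apply: (@velocity_affine _ _ g (z i) (X (z i)) t (i%:R * eta) (i.+1%:R * eta) (i%:R * eta) tii).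
    by move=> s /andP[s1 s2]; rewrite /g (polygon_piece z0 X eta0 ik)// !ltW.
  apply: (@le_trans _ _ (m^-1)%:E); last by rewrite lee_fin lerDl ltW.
  apply: (@kobayashi_royden_le _ _ Omega _ _ w) => // s sm.
  have [fam1 _] := fam i (ltnW ik).
  (* The disc centred at [g t] is the one attached to the vertex [z i], shifted by [t']; tangency of
     [X (z i)] is only used at the vertex. *)
  have [] := fam1 s t' eta (ltW sm) t'0 t'eta etam.
  rewrite scalerDl (addrC (s *: _)) -!addrA [X in U X -> _]addrA -gE !addrA => Ug rg.
  suff : (Omega `&` U) (g t + s *: X (z i) + s ^+ 2 *: w) by case.
  rewrite OU; split=> //; rewrite gE (le_lt_trans rg)//.
  have := rz' i (ltnW ik); rewrite ler_norml => /andP[_].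
  move: half_d1 d10; rewrite /d1; clear; lra.
Qed.

End TangentCurves.

(** * The Kobayashi distance and visibility *)

Section Kobayashi.
Import HBNNSimple.
Variables (R : realType) (n : nat).
Local Notation C := (R[i]^o).
Local Notation Cn := ('C^n(R)).
Implicit Types Omega : set Cn.

Lemma bounded_set_nrm Omega : bounded_set Omega ->
  exists2 B : R, 0 < B & forall x, Omega x -> nrm x <= B.
Proof.
move=> [M [Mr HM]]; pose M' := `|complex.Re M| + 1.
have ltM : M < M'%:C.
  rewrite -(RRe_real Mr) ltcR /M'; have := ler_norm (complex.Re M); lra.
exists M'; first by rewrite /M' ltr_wpDl.
by move=> x Ox; have /= := HM _ ltM x Ox; rewrite nrmE lecR.
Qed.

Lemma atanh_ge (x : R) : 0 <= x < 1 -> x / 2 <= atanh x.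
Proof.
move=> /andP[x0 x1]; rewrite /atanh ler_pM2r ?invr_gt0//.
have p1 : 0 < 1 + x by lra.
have m1 : 0 < 1 - x by lra.
rewrite -[_ / _]invrK lnV ?posrE ?invr_gt0 ?divr_gt0// invf_div.
have -> : (1 - x) / (1 + x) = 1 + (- (2 * x) / (1 + x)) by field; rewrite gt_eqF.
have h : -1 < - (2 * x) / (1 + x) by rewrite ltr_pdivlMr//; lra.
rewrite lerNr (le_trans (le_ln1Dx h))// ler_pdivrMr//; nra.
Qed.

(** The Schwarz bound holds for each coordinate, and the max norm passes it on with the same
    constant. *)
Lemma hol_disc_lipschitz Omega (phi : C -> Cn) (B : R) (a : C) :
  (forall x, Omega x -> nrm x <= B) -> hol_disc Omega phi -> nrm a < 1 ->
  nrm (phi a - phi 0) <= 4 * B * nrm a.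
Proof.
move=> OB hphi a1.
have cd z : nrm z < 1 -> exists l, cdiff phi z l /\ nrm (phi z) <= B.
  move=> z1; have [] := hphi z; first by rewrite nrmE ltcR.
  by move=> /derivable_cdiff[l hl] /OB ?; exists l.
have B0 : 0 <= B.
  by have [|l [_ h]] := cd 0; [rewrite nrm0|exact: le_trans (nrm_ge0 _) h].
apply: nrm_le_coord => [|j]; first by rewrite !mulr_ge0// nrm_ge0.
rewrite !mxE; apply: (@schwarz_lipschitz _ (fun z => phi z 0 j)) => // z /cd[l [hl hB]].
  exists (l 0 j) => e e0; have [d d0 H] := hl e e0; exists d => // h /H.
  by apply: le_trans; have := nrm_coord (phi (z + h) - phi z - h *: l) j; rewrite !mxE.
exact: le_trans (nrm_coord _ _) hB.
Qed.

(** The max-norm distance divided by [8 B] is itself one of the pseudodistances in the supremum: 4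
    comes from the Schwarz bound, 2 from [atanh x >= x / 2]. *)
Lemma kobayashi_ge Omega : bounded_set Omega ->
  exists2 c : R, 0 < c & forall x y, Omega x -> Omega y ->
    ((c * nrm (x - y))%:E <= kobayashi Omega x y)%E.
Proof.
move=> /bounded_set_nrm[B B0 OB]; exists (8 * B)^-1.
  by rewrite invr_gt0 mulr_gt0.
have c0 : 0 <= (8 * B)^-1 by rewrite invr_ge0 mulr_ge0// ltW.
move=> x y Ox Oy; apply: ereal_sup_ubound.
exists (fun x y => (8 * B)^-1 * nrm (x - y)) => //=; split.
  split.
  - by move=> *; rewrite mulr_ge0// nrm_ge0.
  - by move=> *; rewrite subrr nrm0 mulr0.
  - by move=> *; rewrite nrmB.
  - by move=> *; rewrite -mulrDr ler_wpM2l// nrm_triangle.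
move=> {Ox Oy}x {}y Ox Oy; apply: le_ereal_inf_tmp => _ [a [a1 [phi [hphi p0 pa]]] <-].
rewrite lee_fin; have a1' : nrm a < 1 by move: a1; rewrite nrmE ltcR.
have a01 : 0 <= nrm a < 1 by rewrite nrm_ge0.
apply: le_trans (atanh_ge a01).
have := hol_disc_lipschitz OB hphi a1'; rewrite p0 pa nrmB => h.
rewrite mulrC ler_pdivrMr ?mulr_gt0// (le_trans h)//; have := nrm_ge0 a; lra.
Qed.

Lemma kobayashi_royden_ge0 Omega x v : (0 <= kobayashi_royden Omega x v)%E.
Proof.
by apply: le_ereal_inf_tmp => _ [a _ <-]; rewrite lee_fin; exact: (nrm_ge0 (a : C)).
Qed.

(** Measurability of the integrand is not at hand. The integral of a nonnegative function is a
    supremum over simple functions below it, and each of these is at most [L] off the finite set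
    [S]. *)
Lemma kr_length_le Omega (g : R -> Cn) (S : seq R) (L t1 t2 : R) :
  t1 <= t2 -> 0 <= L ->
  (forall t, t1 <= t <= t2 -> t \notin S ->
    (kobayashi_royden Omega (g t) (velocity g t) <= L%:E)%E) ->
  (kr_length Omega g t1 t2 <= (L * (t2 - t1))%:E)%E.
Proof.
move=> t12 L0 H; rewrite /kr_length ge0_integralE; last first.
  by move=> t _; exact: kobayashi_royden_ge0.
apply: ge_ereal_sup => _ [h hle <-]; rewrite -integralT_nnsfun.
have -> : (L * (t2 - t1))%:E = (\int[lebesgue_measure]_x (L%:E * (\1_(`[t1, t2]) x)%:E))%E.
  rewrite ge0_integralZl//=; last first.
    by apply/measurable_EFinP; exact: measurable_indic.
  rewrite integral_indic// setIT.
  rewrite -[X in (L%:E * X)%E]/(lebesgue_measure (`[t1, t2]%classic : set R)).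
  rewrite lebesgue_measure_itv/= lte_fin.
  case: ltP => h12; first by rewrite EFinM.
  by rewrite mule0 (@le_anti _ _ t1 t2) ?t12// subrr mulr0.
apply: ae_ge0_le_integral => //.
- by move=> x _; rewrite lee_fin; exact: fun_ge0.
- exact/measurable_EFinP.
- by move=> x _; rewrite mule_ge0// lee_fin.
- apply: emeasurable_funM => //; apply/measurable_EFinP; exact: measurable_indic.
have cS : countable [set` S] by apply: finite_set_countable; exact: finite_seq.
exists [set` S]; split.
- by apply: countable_measurable => // t; exact: measurable_set1.
- exact: countable_lebesgue_measure0.
move=> x /= /not_implyP[_ Hx]; apply: contrapT => xS; apply: Hx.
apply: le_trans (hle x) _; rewrite patchE indicE.
case: ifPn => [|_]; last by rewrite mule0.
by rewrite mule1 inE/= in_itv/= => xt; apply: H => //; exact/negP.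
Qed.

Lemma lipschitz_abs_continuous (l L : R) (g : R -> Cn) : 0 < L ->
  (forall u t, 0 <= u -> u <= t -> t <= l -> nrm (g t - g u) <= L * (t - u)) ->
  abs_continuous l g.
Proof.
move=> L0 H e e0; exists (e / L); first by rewrite divr_gt0.
move=> m a b Hab _; rewrite ltr_pdivlMr// => S.
rewrite (eq_bigr (fun i => (nrm (g (b i) - g (a i)))%:C)); last first.
  by move=> i _; rewrite nrmE.
rewrite -rmorph_sum ltcR (le_lt_trans _ S)// mulr_suml ler_sum// => i _.
by have [a0 ab bl] := Hab i; rewrite mulrC H.
Qed.

End Kobayashi.

(** * Contradiction between visibility and touching discs *)

Section Visibility.
Variables (R : realType) (n : nat).
Local Notation C := (R[i]^o).
Local Notation Cn := ('C^n(R)).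

(** [T] is fixed once, then curves of depth below [1 / (j + 1)] are taken for all [j]. Their starts
    tend to [p]; their ends accumulate at a point [q] where [r] vanishes, and visibility is applied
    to the pair [p], [q]. *)
Lemma visibility_no_contact (Omega : set Cn) : open Omega -> bounded_set Omega ->
  C2_boundary Omega ->
  (exists eps : R, 0 < eps /\ visibility Omega 1 eps) \/
    (forall lambda : R, 1 < lambda -> visibility Omega lambda 0) ->
  forall p v w (c t0 : R), boundary Omega p -> 0 < c -> 0 < t0 ->
  ~ disc_contact Omega p v w c t0.
Proof.
move=> oO bO C2 vis p v w c t0 bp c0 t00 ct.
have [U [r [oU Up C2r OU rU]]] := C2 p bp.
have [H [M T2]] := C2_taylor oU Up C2r.
have [dc dc0 Hdc] := taylor2_continuous T2.
have bdP q : boundary Omega q <-> closure Omega q /\ ~ Omega q.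
  by rewrite /boundary /setD /= (interior_id Omega).1.
have rneg q : U q -> Omega q -> r q < 0.
  move=> Uq Oq; have : (Omega `&` U) q by [].
  by rewrite OU => -[].
have negr q : U q -> r q < 0 -> Omega q.
  move=> Uq rq; suff : (Omega `&` U) q by case.
  by rewrite OU.
(* A positive value of [r] at [q] would persist nearby, although points of [Omega], where [r] is
   negative, accumulate at [q]. *)
have bd0 q : nrm (q - p) < dc -> boundary Omega q -> r q = 0.
  move=> qd /bdP[cq nq]; have [Uq rc] := Hdc q qd.
  apply/eqP; rewrite eq_le; apply/andP; split; last first.
    by rewrite leNgt; apply/negP => /(negr _ Uq).
  rewrite leNgt; apply/negP => rq.
  have [d d0 Hd] := rc _ rq; have [d' d'0 Hd'] := open_nrm oU Uq.
  have [] := cq [set z | nrm (z - q) < Num.min d d'].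
    by apply/nbhs_nrmP; exists (Num.min d d') => //; rewrite lt_min d0.
  move=> z [Oz /=]; rewrite lt_min => /andP[/Hd + /Hd' Uz].
  by have := rneg z Uz Oz; rewrite ltr_norml; lra.
have pp : nrm (p - p) < dc by rewrite subrr nrm0.
have rp : r p = 0 by apply: bd0.
have Lp : rlin (fun h => real_derive r h p).
  have [d d0 /(_ p)] := taylor_rlin T2.
  by rewrite subrr nrm0 => /(_ d0)[].
have [N LN] : exists N, 0 < real_derive r N p.
  have [N LN] := rU p Up.
  have [L0|L0] := ltP 0 (real_derive r N p); first by exists N.
  exists (- N); rewrite (rlinN N Lp) oppr_gt0 lt_neqAle LN; exact: L0.
have [Lv [c' c'0 HQ]] := contact_levi T2 OU rp LN c0 t00 ct.
have v0 := contact_nonzero T2 c'0 HQ.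
have dc20 : 0 < dc / 2 by rewrite divr_gt0.
have [L [c1 [T0 [L0 c10 T00 curves]]]] := tangent_curves T2 OU rp LN v0 c'0 Lv HQ dc20.
have [c2 c20 kob] := kobayashi_ge bO.
have [B B0 OB] := bounded_set_nrm bO.
(* The common form of both hypotheses. For [(1, eps)] the time is cut to [eps / L]; for
   [(lambda, 0)] the factor exceeds [L / (c2 * c1)]. *)
have [lam [eps [T [lam0 T0' TT0 Vis geo]]]] : exists lam eps T : R, [/\ 0 <= lam, 0 < T, T <= T0,
    visibility Omega lam eps & forall s, 0 <= s -> s <= T ->
      L * s <= lam * (c2 * (c1 * s)) + eps].
  case: vis => [[eps [eps0 Vis]]|Vis].
    exists 1, eps, (Num.min T0 (eps / L)); split=> //.
    - by rewrite lt_min T00 divr_gt0.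
    - by rewrite ge_min lexx.
    - move=> s s0 sT; have : s <= eps / L by rewrite (le_trans sT)// ge_min lexx orbT.
      rewrite ler_pdivlMr// mulrC => h; rewrite (le_trans h)// lerDr.
      by rewrite !mulr_ge0// ltW.
  exists (L / (c2 * c1) + 2), 0, T0; split=> //.
  - by rewrite addr_ge0// divr_ge0 ?mulr_ge0 ?ltW.
  - by apply: Vis; have : 0 < L / (c2 * c1); [rewrite divr_gt0// mulr_gt0|lra].
  - move=> s s0 _; rewrite addr0 mulrDl !mulrA.
    rewrite (_ : L / (c2 * c1) * c2 * c1 = L); last by field; rewrite !gt_eqF.
    by rewrite lerDl !mulr_ge0// ?(ltW c20) ?(ltW c10).
have dj j : 0 < j.+1%:R^-1 :> R by rewrite invr_gt0.
have cur j : exists g : R -> Cn, exists S : seq R,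
    [/\ forall t, 0 <= t <= T -> [/\ nrm (g t - p) <= dc / 2, Omega (g t) &
          - j.+1%:R^-1 < r (g t) < 0],
        nrm (g 0 - p) < j.+1%:R^-1,
        forall u t, 0 <= u -> u <= t -> t <= T ->
          c1 * (t - u) <= nrm (g t - g u) <= L * (t - u) &
        forall t, 0 <= t <= T -> t \notin S ->
          (kobayashi_royden Omega (g t) (velocity g t) <= L%:E)%E].
  by have [g [S Hg]] := curves T _ T0' TT0 (dj j); exists g, S.
have [g Hg] := choice cur.
have TT : 0 <= T <= T by rewrite (ltW T0') lexx.
have OT : (0 : R) <= (0 : R) <= T by rewrite lexx ltW.
have inv_small (e : R) : 0 < e -> exists J : nat, forall j, (J <= j)%N -> j.+1%:R^-1 < e.
  move=> e0; exists (Num.bound e^-1) => j Jj.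
  have ei : 0 <= e^-1 by rewrite invr_ge0 ltW.
  rewrite invf_plt ?posrE// (lt_le_trans (archi_boundP ei))// ler_nat.
  exact: leq_trans Jj _.
(* the end points accumulate at a boundary point *)
have cA : compact [set z : Cn | nrm (z - 0) <= B].
  apply: (@compact_bounded_closed _ _ _ B); last exact: closed_nrm_le.
  by move=> z /=; rewrite subr0.
have [q [_ clq]] : [set z : Cn | nrm (z - 0) <= B] `&` cluster ((fun j => g j T) @ \oo) !=set0.
  apply: cA; exists 0%N => // j _ /=; rewrite subr0; apply: OB.
  by have [S [/(_ T TT)[]]] := Hg j.
have often (e : R) (J : nat) : 0 < e -> exists2 j, (J <= j)%N & nrm (g j T - q) < e.
  move=> e0; have [] := clq [set z | exists2 j, (J <= j)%N & z = g j T] [set z | nrm (z - q) < e].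
  - by exists J => // j Jj; exists j.
  - by apply/nbhs_nrmP; exists e.
  - by move=> z [[j Jj ->] /= zq]; exists j.
have qp : nrm (q - p) < dc.
  have d40 : 0 < dc / 4 by rewrite divr_gt0.
  have [j _ jq] := often _ 0%N d40.
  have [S [/(_ T TT)[h _ _] _ _ _]] := Hg j.
  have := nrm_triangle (g j T) q p; rewrite (nrmB q (g j T)); clear -h jq dc0; lra.
have [Uq rcq] := Hdc q qp.
have rq : r q = 0.
  apply/eqP; rewrite -normr_le0; apply/ler_addgt0Pr => e e0; rewrite add0r.
  have e20 : 0 < e / 2 by rewrite divr_gt0.
  have [d d0 Hd] := rcq _ e20; have [J HJ] := inv_small _ e20.
  have [j Jj jq] := often d J d0.
  have [S [/(_ T TT)[_ _ h] _ _ _]] := Hg j.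
  move: h (Hd _ jq) (HJ j Jj); move: (_^-1) => x; rewrite ltr_norml ler_norml; clear; lra.
have bq : boundary Omega q.
  apply/bdP; split; last by move=> /(rneg _ Uq); rewrite rq ltxx.
  move=> V /nbhs_nrmP[e e0 HV]; have [j _ jq] := often e 0%N e0.
  exists (g j T); split; last exact: HV.
  by have [S [/(_ T TT)[]]] := Hg j.
have c1T : 0 < c1 * T by rewrite mulr_gt0.
(* The two ends of a curve are at least [c1 * T] apart, a bound independent of [j]. *)
have pq : p <> q.
  move=> pqE; have e0 : 0 < c1 * T / 2 by rewrite divr_gt0.
  have [J HJ] := inv_small _ e0; have [j Jj jq] := often _ J e0.
  have [S [_ h1 /(_ 0 T (lexx 0) (ltW T0') (lexx T)) /andP[h2 _] _]] := Hg j.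
  have := HJ j Jj; have := nrm_triangle q (g j T) (g j 0); rewrite subr0 in h2.
  move: h1; move: (_^-1) => x h1.
  rewrite (nrmB q (g j 0)) -pqE; rewrite -pqE in jq; clear -h1 h2 jq; lra.
have [V1 [V2 [K [pV1 qV2 _ [cK KO] HK]]]] := Vis p q bp bq pq.
(* On the part of [K] in the ball that contains the curves, [r] attains a negative maximum; curves
   of depth below [ka] cannot meet it. The value 1 is a default for an empty intersection. *)
have [ka ka0 Hka] : exists2 ka : R, 0 < ka & forall z, K z -> nrm (z - p) <= dc / 2 -> r z <= - ka.
  pose K' := K `&` [set z | nrm (z - p) <= dc / 2].
  have [K'0|K'0] := pselect (K' !=set0); last first.
    by exists 1 => // z Kz zd; exfalso; apply: K'0; exists z.
  have cK' : compact K' by apply: compact_closedI => //; exact: closed_nrm_le.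
  have near z : K' z -> nrm (z - p) < dc by move=> [_ /= h]; lra.
  have [|z0 [Kz0 z0p] z0max] := compact_max K'0 cK' (f := r).
    move=> z K'z e e0; have [_ /(_ e e0)[d d0 Hd]] := Hdc z (near z K'z).
    by exists d => // y _; exact: Hd.
  have [Uz0 _] := Hdc z0 (near z0 (conj Kz0 z0p)).
  exists (- r z0); first by rewrite oppr_gt0; apply: rneg => //; exact: KO.
  by move=> z Kz zp; rewrite opprK; apply: z0max.
have [e1 e10 He1] := (nbhs_nrmP _ _).1 pV1.
have [e2 e20 He2] := (nbhs_nrmP _ _).1 qV2.
have [J1 HJ1] := inv_small _ e10; have [J2 HJ2] := inv_small _ ka0.
have [j Jj jq] := often _ (maxn J1 J2) e20.
have [S [Hg1 Hg2 Hg3 Hg4]] := Hg j.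
have [|||z [[t + <-] Kz]] := HK T (g j).
- split=> //; first exact: ltW.
  + by move=> t; rewrite in_itv/= => /Hg1[].
  + apply: (lipschitz_abs_continuous L0) => u t u0 ut tT.
    by have /andP[] := Hg3 u t u0 ut tT.
  + move=> t1 t2 t10 t12 t2T; apply: (@le_trans _ _ (L * (t2 - t1))%:E).
      apply: (@kr_length_le _ _ Omega (g j) S L t1 t2 t12 (ltW L0)) => t /andP[t1t tt2] tS.
      by apply: Hg4 tS; rewrite (le_trans t10 t1t) (le_trans tt2 t2T).
    have s0 : 0 <= t2 - t1 by rewrite subr_ge0.
    have sT : t2 - t1 <= T by lra.
    apply: (@le_trans _ _ (lam%:E * (c2 * (c1 * (t2 - t1)))%:E + eps%:E)%E).
      by rewrite -EFinM -EFinD lee_fin geo.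
    rewrite leeD2r// lee_wpmul2l//.
    have O1 : Omega (g j t1) by have [] := Hg1 t1; rewrite ?t10 ?(le_trans t12).
    have O2 : Omega (g j t2) by have [] := Hg1 t2; rewrite ?t2T ?(le_trans t10).
    apply: le_trans (kob _ _ O1 O2); rewrite lee_fin ler_pM2l// nrmB.
    by have /andP[] := Hg3 t1 t2 t10 t12 t2T.
- split; first by have [] := Hg1 0 OT.
  by apply: He1; rewrite (lt_trans Hg2)// HJ1// (leq_trans _ Jj)// leq_maxl.
- by split; [have [] := Hg1 T TT|exact: He2].
rewrite /= in_itv/= => tT; have [tp _ /andP[rt _]] := Hg1 t tT.
have := Hka _ Kz tp; have := HJ2 j; rewrite (leq_trans _ Jj) ?leq_maxr// => /(_ isT).
move: rt; move: (_^-1) => x; clear; lra.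
Qed.

End Visibility.

(** * The distance to the complement *)

Section Distance.
Variables (R : realType) (n : nat).
Local Notation C := (R[i]^o).
Local Notation Cn := ('C^n(R)).
Variable Omega : set Cn.
Hypothesis oO : open Omega.
Hypothesis cO : exists w, ~ Omega w.

Definition dist_compl (z : Cn) : R := inf [set nrm (z - w) | w in ~` Omega].

Let dist_has_inf z : has_inf [set nrm (z - w) | w in ~` Omega].
Proof.
split; first by have [w nw] := cO; exists (nrm (z - w)); exists w.
by exists 0 => _ [w _ <-]; exact: nrm_ge0.
Qed.

Lemma dist_compl_le z w : ~ Omega w -> dist_compl z <= nrm (z - w).
Proof. by move=> nw; apply: ge_inf; [case: (dist_has_inf z)|exists w]. Qed.

Lemma dist_compl_ge z (d : R) : (forall w, ~ Omega w -> d <= nrm (z - w)) -> d <= dist_compl z.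
Proof.
by move=> H; apply: lb_le_inf; [case: (dist_has_inf z)|move=> _ [w /H ? <-]].
Qed.

Lemma dist_compl_lipschitz x y : `|dist_compl x - dist_compl y| <= nrm (x - y).
Proof.
have H (a b : Cn) : dist_compl a - dist_compl b <= nrm (a - b).
  rewrite lerBlDl -lerBlDr; apply: dist_compl_ge => w /(dist_compl_le a) h.
  by rewrite lerBlDr (le_trans h)// [leRHS]addrC nrm_triangle.
by rewrite ler_norml lerNl opprB {1}nrmB !H.
Qed.

Lemma dist_compl_ball z y : nrm (y - z) < dist_compl z -> Omega y.
Proof.
move=> h; apply: contrapT => /(dist_compl_le z); rewrite nrmB leNgt h//.
Qed.

Lemma dist_compl_gt0 z : Omega z -> 0 < dist_compl z.
Proof.
move=> Oz; have [d d0 H] := open_nrm oO Oz.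
apply: (lt_le_trans d0); apply: dist_compl_ge => w nw; rewrite leNgt.
by apply/negP => h; apply/nw/H; rewrite nrmB.
Qed.

Lemma dist_compl_attained z : exists2 p, ~ Omega p & nrm (p - z) = dist_compl z.
Proof.
have [w nw] := cO.
pose A := ~` Omega `&` [set y : Cn | nrm (y - z) <= nrm (w - z)].
have cA : compact A.
  apply: (@compact_bounded_closed _ _ _ (nrm (w - z) + nrm z)).
    move=> y [_ /= h]; have := nrmD (y - z) z; rewrite subrK; lra.
  by apply: closedI; [exact: open_closedC|exact: closed_nrm_le].
have A0 : A !=set0 by exists w; split=> /=.
have [|p [np pz] pmax] := @compact_max R Cn A (fun y => - nrm (y - z)) A0 cA.
  move=> x _ e e0; exists e => // y _ yx.
  have h1 := nrm_triangle x y z; have h2 := nrm_triangle y x z.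
  by rewrite (nrmB x y) in h2; rewrite ltr_norml; lra.
exists p => //; apply/eqP; rewrite eq_le; apply/andP; split; last first.
  by rewrite nrmB; exact: dist_compl_le.
apply: dist_compl_ge => y ny; rewrite (nrmB z).
have [h|h] := leP (nrm (y - z)) (nrm (w - z)).
  by have := pmax y (conj ny h); rewrite lerN2.
by apply: le_trans pz _; exact: ltW.
Qed.

(** Points of the segment from [p] towards [z] are closer to [z] than [dist_compl z], hence in
    [Omega], and they come arbitrarily close to [p]. *)
Lemma nearest_boundary z p : Omega z -> ~ Omega p -> nrm (p - z) = dist_compl z ->
  boundary Omega p.
Proof.
move=> Oz np pz; split; last by rewrite (interior_id Omega).1.
have dz := dist_compl_gt0 Oz.
move=> V /nbhs_nrmP[e e0 HV].
pose t := Num.min 1 (e / (2 * dist_compl z)).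
have t0 : 0 < t by rewrite lt_min ltr01 divr_gt0// mulr_gt0.
have t1 : t <= 1 by rewrite ge_min lexx.
have te : t * (2 * dist_compl z) <= e by rewrite -ler_pdivlMr ?mulr_gt0// ge_min lexx orbT.
exists (p - t%:C *: (p - z)); split; last first.
  apply: HV; rewrite addrAC subrr add0r nrmN nrmZ nrmR gtr0_norm// pz.
  have : 0 < t * dist_compl z by rewrite mulr_gt0.
  by move: te; rewrite mulrCA; move: (t * _) => x; lra.
apply: (@dist_compl_ball z).
have -> : p - t%:C *: (p - z) - z = (1 - t)%:C *: (p - z).
  by rewrite rmorphB scalerBl scale1r addrAC.
rewrite nrmZ nrmR pz ger0_norm ?subr_ge0//.
by rewrite gtr_pMl//; lra.
Qed.

End Distance.

(** * Second order comparison with the exponential *)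

Section ExpBounds.
Variable R : realType.
Local Notation C := (R[i]^o).

Lemma ge0_of_derive (f df : R -> R) (x : R) : (forall y : R, is_derive y 1 f (df y)) ->
  f 0 = 0 -> (forall y, 0 <= y -> 0 <= df y) -> 0 <= x -> 0 <= f x.
Proof.
move=> Df f0 df0 x0; have [y /andP[y0 _]] := mvt_segment x0 (fun y _ => Df y).
by rewrite f0 !subr0 => ->; rewrite mulr_ge0// df0.
Qed.

Lemma expR_ge_quad (x : R) : 0 <= x -> 1 + x + x ^+ 2 / 2 <= expR x.
Proof.
move=> x0; rewrite -subr_ge0.
apply: (@ge0_of_derive (fun y => expR y - (1 + y + y ^+ 2 / 2)) (fun y => expR y - (1 + y))) => //.
- by move=> y; apply: is_derive_eq; rewrite /GRing.scale/=; field.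
- by rewrite /= expR0 expr0n /=; ring.
- by move=> y _; rewrite subr_ge0 expR_ge1Dx.
Qed.

Lemma expRN_ge_cubic (x : R) : 0 <= x -> 1 - x + x ^+ 2 / 2 - x ^+ 3 / 6 <= expR (- x).
Proof.
have D (y : R) : is_derive y 1 (fun y => expR (- y)) (- expR (- y)).
  by apply: is_derive_eq; rewrite /GRing.scale/= mulrN1.
have q (y : R) : 0 <= y -> 0 <= 1 - y + y ^+ 2 / 2 - expR (- y).
  apply: (@ge0_of_derive (fun y => 1 - y + y ^+ 2 / 2 - expR (- y)) (fun y => expR (- y) - (1 - y))).
  - by move=> z; have Dz := D z; apply: is_derive_eq; rewrite /GRing.scale/=; field.
  - by rewrite /= oppr0 expR0 expr0n /=; ring.
  - by move=> z _; rewrite subr_ge0 expR_ge1Dx.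
move=> x0; rewrite -subr_ge0.
apply: (@ge0_of_derive (fun y => expR (- y) - (1 - y + y ^+ 2 / 2 - y ^+ 3 / 6))
  (fun y => 1 - y + y ^+ 2 / 2 - expR (- y))) => //.
- by move=> z; have Dz := D z; apply: is_derive_eq; rewrite /GRing.scale/=; field.
- by rewrite /= oppr0 expR0 !expr0n /=; ring.
Qed.

Lemma expR_ge_cubic (y : R) : 1 + y + y ^+ 2 / 2 - `|y| ^+ 3 <= expR y.
Proof.
have y3 : 0 <= `|y| ^+ 3 by rewrite exprn_ge0.
have [y0|y0] := leP 0 y; first by have := expR_ge_quad y0; lra.
have y0' : 0 <= - y by rewrite oppr_ge0 ltW.
have := expRN_ge_cubic y0'; rewrite opprK sqrrN => h.
by move: y3; rewrite ltr0_norm// => y3; lra.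
Qed.

(* [1 - alpha t + (alpha^2/2 - beta) t^2] is the second order Taylor polynomial of
   [exp (- (alpha t + beta t^2))]. *)
Lemma quadratic_le_exp (alpha beta : C) (e : R) : 0 < e -> exists t0 k : R, [/\ 0 < t0, 0 < k &
  forall t : C, nrm t <= t0 ->
    2^-1 <= nrm (1 - alpha * t + (alpha ^+ 2 / 2 - beta) * t ^+ 2 : C) /\
    nrm (1 - alpha * t + (alpha ^+ 2 / 2 - beta) * t ^+ 2 : C) * (1 + k * nrm t ^+ 2) <=
      expR (- complex.Re (alpha * t + beta * t ^+ 2) + e * nrm t ^+ 2)].
Proof.
move=> e0; set a := nrm alpha; set b := nrm beta.
set d := nrm (alpha ^+ 2 / 2 - beta : C).
have a0 : 0 <= a by exact: nrm_ge0.
have b0 : 0 <= b by exact: nrm_ge0.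
have d0 : 0 <= d by exact: nrm_ge0.
pose K := 2 * a + 2 * b + 2 * e.
have K0 : 0 < K by rewrite /K; lra.
pose K3 := 2 * a * d + d ^+ 2 + K ^+ 3 + 4 * a * (b + e).
have K30 : 0 < K3.
  have p1 : 0 <= 2 * a * d by rewrite !mulr_ge0.
  have p2 : 0 <= 4 * a * (b + e) by rewrite mulr_ge0 ?mulr_ge0// addr_ge0// ltW.
  have p3 : 0 <= d ^+ 2 by rewrite exprn_ge0.
  have p4 : 0 < K ^+ 3 by rewrite exprn_gt0.
  by rewrite /K3; move: p1 p2 p3 p4; move: (_ * d) (4 * _ * _) (d ^+ 2) (K ^+ 3) => *; lra.
have ad0 : 0 < a + d + 1 by lra.
pose t0 := Num.min (Num.min 1 (e / K3)) (1 / (2 * (a + d + 1))).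
have t00 : 0 < t0 by rewrite !lt_min ltr01 !divr_gt0// mulr_gt0.
(* Since [(1 + k x^2)^2 <= 1 + 3 k x^2] and [nrm m ^+ 2 <= 4], the factor costs at most
   [12 k x^2 <= e x^2] in the comparison of squares. *)
pose k := Num.min 1 (e / 12).
have k0 : 0 < k by rewrite lt_min ltr01 divr_gt0.
have k1 : k <= 1 by rewrite ge_min lexx.
have ke : k * 12 <= e by rewrite -ler_pdivlMr// ge_min lexx orbT.
exists t0, k; split=> // t tt0.
set x := nrm t in tt0 *; have x0 : 0 <= x by exact: nrm_ge0.
have x1 : x <= 1 by rewrite (le_trans tt0)// !ge_min lexx.
have xK : x * K3 <= e by rewrite -ler_pdivlMr// (le_trans tt0)// !ge_min lexx orbT.
have xd : x * (2 * (a + d + 1)) <= 1.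
  by rewrite -ler_pdivlMr ?mulr_gt0// (le_trans tt0)// !ge_min lexx orbT.
have K3E : K3 = 2 * a * d + d ^+ 2 + K ^+ 3 + 4 * a * (b + e) by [].
clearbody K3 t0 k.
set m : C := 1 - alpha * t + _.
have xx : x ^+ 2 <= x by rewrite expr2 ler_piMl.
have nA : nrm (alpha * t) = a * x by rewrite nrmM.
have nD : nrm ((alpha ^+ 2 / 2 - beta) * t ^+ 2 : C) = d * x ^+ 2 by rewrite nrmM nrmX.
have Dh : x * (a + d) <= 2^-1 by clear -xd x0; lra.
have nm : 2^-1 <= nrm m <= 2.
  have dx : d * x ^+ 2 <= d * x by rewrite ler_wpM2l.
  have h1 := nrm_lb (1 : C) (- (alpha * t) + (alpha ^+ 2 / 2 - beta) * t ^+ 2).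
  have h2 := nrmD (- (alpha * t)) ((alpha ^+ 2 / 2 - beta) * t ^+ 2).
  have h3 := nrmD (1 : C) (- (alpha * t) + (alpha ^+ 2 / 2 - beta) * t ^+ 2).
  rewrite nrmN nA nD in h2; rewrite addrA -/m nrm1 in h1; rewrite addrA -/m nrm1 in h3.
  apply/andP; split; clear -h1 h2 h3 Dh dx x0; lra.
case/andP: nm => nm1 nm2; split=> //.
pose A1 := complex.Re (alpha * t); pose A2 := complex.Im (alpha * t).
pose B1 := complex.Re (beta * t ^+ 2).
pose D1 := complex.Re ((alpha ^+ 2 / 2 - beta) * t ^+ 2).
pose D2 := complex.Im ((alpha ^+ 2 / 2 - beta) * t ^+ 2).
have hA : A1 ^+ 2 + A2 ^+ 2 = (a * x) ^+ 2 by rewrite -nA sqr_nrm.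
have hD : D1 ^+ 2 + D2 ^+ 2 = (d * x ^+ 2) ^+ 2 by rewrite -nD sqr_nrm.
(* Real part of [(alpha t)^2 / 2 - beta t^2]. It makes the second order terms of [nrm m ^+ 2] equal
   to those of [expR (- 2 Re (alpha t + beta t^2))]. Of the gain [2 e x^2] in the exponent, one half
   pays for the cubic errors collected in [K3], the other for [k]. *)
have hD1 : 2 * D1 = A1 ^+ 2 - A2 ^+ 2 - 2 * B1.
  have -> : D1 = complex.Re ((alpha * t) ^+ 2 / 2 - beta * t ^+ 2 : C).
    by congr complex.Re; ring.
  have -> : (alpha * t) ^+ 2 / 2 = (2^-1)%:C * ((alpha * t) * (alpha * t)) :> C.
    by rewrite mulrC expr2; congr (_ * _); rewrite fmorphV rmorph_nat.
  by rewrite /A1 /A2 /B1; case: (alpha * t) (beta * t ^+ 2) => [p q] [r s] /=; field.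
have bA1 : `|A1| <= a * x by rewrite -nA Re_le_nrm.
have bB1 : `|B1| <= b * x ^+ 2.
  by rewrite (le_trans (Re_le_nrm _))// nrmM nrmX.
have hm : nrm m ^+ 2 <= 1 - 2 * A1 + 2 * A1 ^+ 2 - 2 * B1 + (2 * a * d + d ^+ 2) * x ^+ 3.
  have -> : nrm m ^+ 2 = 1 - 2 * A1 + 2 * A1 ^+ 2 - 2 * B1 - 2 * (A1 * D1 + A2 * D2) + (D1 ^+ 2 + D2 ^+ 2).
    rewrite sqr_nrm.
    have -> : complex.Re m = 1 - A1 + D1 by rewrite /m !raddfD/= raddfN.
    have -> : complex.Im m = D2 - A2 by rewrite /m !raddfD/= raddfN/= sub0r addrC.
    have -> : (1 - A1 + D1) ^+ 2 + (D2 - A2) ^+ 2 =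
      1 - 2 * A1 + (2 * D1) + (A1 ^+ 2 + A2 ^+ 2) - 2 * (A1 * D1 + A2 * D2) + (D1 ^+ 2 + D2 ^+ 2) by ring.
    by rewrite hD1; ring.
  have cs : `|A1 * D1 + A2 * D2| <= a * x * (d * x ^+ 2).
    rewrite -(@ler_pXn2r _ 2)// ?nnegrE ?mulr_ge0 ?exprn_ge0//.
    rewrite real_normK ?num_real// exprMn -hA -hD.
    rewrite -subr_ge0 (_ : _ - _ = (A1 * D2 - A2 * D1) ^+ 2) ?sqr_ge0//; ring.
  have x4 : (d * x ^+ 2) ^+ 2 <= d ^+ 2 * x ^+ 3.
    rewrite exprMn ler_wpM2l ?exprn_ge0// (_ : (x ^+ 2) ^+ 2 = x ^+ 3 * x); last by ring.
    by rewrite ler_piMr// exprn_ge0.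
  move: cs x4; rewrite ler_norml hD => /andP[cs1 _] x4.
  have -> : (2 * a * d + d ^+ 2) * x ^+ 3 = 2 * (a * x * (d * x ^+ 2)) + d ^+ 2 * x ^+ 3 by ring.
  clear -cs1 x4; lra.
pose y := - complex.Re (alpha * t + beta * t ^+ 2) + e * x ^+ 2.
have yE : 2 * y = - 2 * A1 - 2 * (B1 - e * x ^+ 2) by rewrite /y raddfD /A1 /B1 /=; ring.
have x20 : 0 <= x ^+ 2 by rewrite exprn_ge0.
have bBe : `|B1 - e * x ^+ 2| <= (b + e) * x ^+ 2.
  rewrite (le_trans (ler_normB _ _))// mulrDl lerD//.
  by rewrite ger0_norm// mulr_ge0// ltW.
have bY : `|2 * y| <= K * x.
  rewrite yE (le_trans (ler_normB _ _))// !normrM normrN !(ger0_norm (ler0n _ 2)).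
  have : (b + e) * x ^+ 2 <= (b + e) * x by rewrite ler_wpM2l// addr_ge0// ltW.
  rewrite /K; clear -bA1 bBe; lra.
have cross : - (4 * a * (b + e) * x ^+ 3) <= 4 * (A1 * (B1 - e * x ^+ 2)).
  have : `|A1 * (B1 - e * x ^+ 2)| <= a * x * ((b + e) * x ^+ 2) by rewrite normrM ler_pM.
  rewrite ler_norml => /andP[h _].
  have -> : 4 * a * (b + e) * x ^+ 3 = 4 * (a * x * ((b + e) * x ^+ 2)) by ring.
  clear -h; lra.
have hY : 1 - 2 * A1 - 2 * B1 + 2 * (e * x ^+ 2) + 2 * A1 ^+ 2 - (4 * a * (b + e) + K ^+ 3) * x ^+ 3
    <= expR (2 * y).
  rewrite (le_trans _ (expR_ge_cubic (2 * y)))//.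
  have Y3 : `|2 * y| ^+ 3 <= K ^+ 3 * x ^+ 3.
    by rewrite -exprMn ler_pXn2r// nnegrE ?mulr_ge0// ltW.
  have Y2 : (2 * y) ^+ 2 / 2 = 2 * A1 ^+ 2 + 4 * (A1 * (B1 - e * x ^+ 2)) + 2 * (B1 - e * x ^+ 2) ^+ 2.
    by rewrite yE; field.
  have sq : 0 <= (B1 - e * x ^+ 2) ^+ 2 by rewrite sqr_ge0.
  rewrite Y2 (mulrDl _ _ (x ^+ 3)); move: Y3 cross sq; move: (`|2 * y| ^+ 3) => Z.
  rewrite yE; clear; lra.
have K3x : (2 * a * d + d ^+ 2) * x ^+ 3 + (4 * a * (b + e) + K ^+ 3) * x ^+ 3 <= e * x ^+ 2.
  have -> : (2 * a * d + d ^+ 2) * x ^+ 3 + (4 * a * (b + e) + K ^+ 3) * x ^+ 3 = K3 * x ^+ 3.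
    by rewrite K3E; ring.
  by rewrite exprS mulrA (mulrC K3) ler_wpM2r.
have main : nrm m ^+ 2 + e * x ^+ 2 <= expR y ^+ 2.
  have -> : expR y ^+ 2 = expR (2 * y) by rewrite expr2 -expRD mulr_natl mulr2n.
  clear -hm hY K3x; lra.
have fin : (nrm m * (1 + k * x ^+ 2)) ^+ 2 <= nrm m ^+ 2 + e * x ^+ 2.
  rewrite exprMn (_ : (1 + k * x ^+ 2) ^+ 2 = 1 + (2 * k + k * (k * x ^+ 2)) * x ^+ 2); last by ring.
  rewrite mulrDr mulr1 lerD2l [leLHS]mulrA ler_wpM2r//.
  have h1 : 2 * k + k * (k * x ^+ 2) <= 3 * k.
    have : k * (k * x ^+ 2) <= k * 1.
      by rewrite ler_pM2l//; apply: mulr_ile1 => //; [exact: ltW|exact: le_trans xx x1].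
    clear; lra.
  have h2 : nrm m ^+ 2 <= 4.
    rewrite (_ : 4 = 2 ^+ 2); last by ring.
    by rewrite ler_pXn2r// nnegrE ?nrm_ge0.
  rewrite (le_trans _ ke)// (le_trans (ler_pM _ _ h2 h1))// ?exprn_ge0 ?nrm_ge0//.
    by rewrite addr_ge0 ?mulr_ge0 ?(ltW k0)// mulr_ge0// ltW.
  clear; lra.
rewrite -/y -(@ler_pXn2r _ 2)// ?nnegrE ?expR_ge0 ?mulr_ge0 ?nrm_ge0 ?addr_ge0 ?mulr_ge0 ?(ltW k0)//.
exact: le_trans fin main.
Qed.

End ExpBounds.

(** * From a lower bound on the logarithmic distance to a touching disc *)

Section Touching.
Variables (R : realType) (n : nat).
Local Notation C := (R[i]^o).
Local Notation Cn := ('C^n(R)).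

(** The disc is [(a + t b) + m(t) (p - a)], with [m] the quadratic polynomial of [quadratic_le_exp].
    Its distance to [a + t b] is [|m(t)|] times the distance at [a], which falls short of the
    distance from [a + t b] to the complement by a quadratic amount. *)
Lemma touching_contact (Omega : set Cn) (a b : Cn) (alpha beta : C) (e t0 : R) :
  open Omega -> (exists w, ~ Omega w) -> 0 < e -> 0 < t0 ->
  (forall t : C, nrm t <= t0 -> Omega (a + t *: b) /\
     ln (dist_compl Omega a) - complex.Re (alpha * t + beta * t ^+ 2) + e * nrm t ^+ 2 <=
       ln (dist_compl Omega (a + t *: b))) ->
  exists p v w (c t1 : R), [/\ boundary Omega p, 0 < c, 0 < t1 & disc_contact Omega p v w c t1].
Proof.
move=> oO cO e0 t00 H.
have Oa : Omega a.
  by have [|+ _] := H 0; rewrite ?nrm0 ?(ltW t00)// scale0r addr0.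
have da := dist_compl_gt0 oO cO Oa.
have [p np pz] := dist_compl_attained oO cO a.
have bp := nearest_boundary oO cO Oa np pz.
have [t1 [k [t10 k0 Hexp]]] := quadratic_le_exp alpha beta e0.
exists p, (b - alpha *: (p - a)), ((alpha ^+ 2 / 2 - beta) *: (p - a)).
(* The margin is [dist_compl Omega a * nrm m * k * nrm t ^+ 2], and [nrm m] is at least 1/2. *)
exists (dist_compl Omega a * k / 2), (Num.min t0 t1); split=> //.
- by rewrite divr_gt0// mulr_gt0.
- by rewrite lt_min t00.
move=> t; rewrite le_min => /andP[tt0 tt1] y.
have [Ot ut] := H t tt0; have [m1 m2] := Hexp t tt1.
set m : C := 1 - alpha * t + _ in m1 m2.
have -> : p + t *: (b - alpha *: (p - a)) + t ^+ 2 *: ((alpha ^+ 2 / 2 - beta) *: (p - a)) =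
   (a + t *: b) + m *: (p - a).
  rewrite /m; move: (alpha ^+ 2 / 2 - beta) => ga.
  rewrite !scalerDl scaleNr scale1r scalerBr !(scalerA _ _ (p - a)).
  rewrite (mulrC t alpha) (mulrC (t ^+ 2) ga).
  move: (_ *: (p - a)) (_ *: (p - a)) (t *: b) => x1 x2 x3.
  rewrite !addrA; congr (_ + _); congr (_ - _).
  by rewrite [RHS]addrAC [in RHS](addrC a) addrK addrC.
move=> hy; apply: (@dist_compl_ball _ _ Omega cO (a + t *: b)).
have dt := dist_compl_gt0 oO cO Ot.
have dexp : dist_compl Omega a * expR (- complex.Re (alpha * t + beta * t ^+ 2) + e * nrm t ^+ 2)
    <= dist_compl Omega (a + t *: b).
  rewrite -{1}(lnK da) -{1}(lnK dt) -expRD ler_expR.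
  by move: ut; move: (ln _) (complex.Re _) (e * _) (ln _) => x1 x2 x3 x4; clear; lra.
have h1 : nrm (y - (a + t *: b)) <= nrm (y - (a + t *: b + m *: (p - a))) + nrm m * dist_compl Omega a.
  rewrite -pz -nrmZ (le_trans _ (nrmD _ _))//.
  by rewrite (opprD (a + t *: b)) addrA subrK.
have h2 : nrm m * dist_compl Omega a + dist_compl Omega a * k / 2 * nrm t ^+ 2 <=
    dist_compl Omega a * (nrm m * (1 + k * nrm t ^+ 2)).
  rewrite (mulrC (nrm m)) mulrDr mulr1 mulrDr lerD2l.
  have E (x1 x2 x3 : R) : x1 * x2 / 2 * x3 = x1 * (2^-1 * (x2 * x3)) by ring.
  rewrite E ler_pM2l//.
  by rewrite ler_wpM2r// mulr_ge0 ?exprn_ge0 ?nrm_ge0// ltW.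
have h3 : dist_compl Omega a * (nrm m * (1 + k * nrm t ^+ 2)) <= dist_compl Omega (a + t *: b).
  by apply: le_trans dexp; rewrite ler_pM2l.
apply: le_lt_trans h1 _; apply: lt_le_trans (le_trans h2 h3).
by rewrite addrC ltrD2l.
Qed.

End Touching.

(** * Approximation on the unit circle by real parts of polynomials *)

Section CircleIntegral.
Variable R : realType.
Local Notation C := (R[i]^o).
Implicit Types (f g F G V : R -> R).

Definition circ_int f : R := \int[lebesgue_measure]_(t in `[0, 2 * pi]) f t.

(** The larger interval gives two-sided derivatives at 0 and at [2 * pi]. *)
Definition circ_primitive f F :=
  forall t : R, -1 < t < 2 * pi + 1 -> is_derive t 1 F (f t).

Lemma two_pi_gt0 : 0 < 2 * pi :> R.
Proof. by rewrite mulr_gt0// pi_gt0. Qed.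

Lemma circ_int_primitive f F : continuous f -> circ_primitive f F ->
  circ_int f = F (2 * pi) - F 0.
Proof.
move=> fc FP; rewrite /circ_int /Rintegral.
have p0 := two_pi_gt0.
have Fc (t : R) : -1 < t < 2 * pi + 1 -> {for t, continuous F}.
  by move=> /FP[dF _]; apply/differentiable_continuous/derivable1_diffP.
rewrite (@continuous_FTC2 _ f F 0 (2 * pi))//.
- exact: continuous_subspaceT.
- split.
  + move=> t /[!in_itv]/= tt; have tt' : -1 < t < 2 * pi + 1 by clear -tt p0; lra.
    by have [] := FP t tt'.
  + apply: cvg_at_right_filter; apply: Fc; lra.
  + apply: cvg_at_left_filter; apply: Fc; lra.
- move=> t /[!in_itv]/= tt; have tt' : -1 < t < 2 * pi + 1 by clear -tt p0; lra.
  by rewrite derive1E; have [_ ->] := FP t tt'.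
Qed.

Lemma circ_primitive_exists f : continuous f -> exists F, circ_primitive f F.
Proof. by move=> fc; apply: antiderivative => x _; exact: fc. Qed.

Lemma circ_intD f g : continuous f -> continuous g ->
  circ_int (fun t => f t + g t) = circ_int f + circ_int g.
Proof.
move=> fc gc; have [F FP] := circ_primitive_exists fc.
have [G GP] := circ_primitive_exists gc.
rewrite (circ_int_primitive fc FP) (circ_int_primitive gc GP).
rewrite (@circ_int_primitive _ (fun t => F t + G t)); first by ring.
  by move=> t; apply: cvgD; [exact: fc|exact: gc].
by move=> t tt; apply: is_deriveD; [exact: FP|exact: GP].
Qed.

Lemma circ_intZ f (a : R) : continuous f ->
  circ_int (fun t => a * f t) = a * circ_int f.
Proof.
move=> fc; have [F FP] := circ_primitive_exists fc.
rewrite (circ_int_primitive fc FP).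
rewrite (@circ_int_primitive _ (fun t => a * F t)); first by ring.
  by move=> t; apply: cvgM; [exact: cvg_cst|exact: fc].
by move=> t tt; have := is_deriveZ a (FP t tt).
Qed.

Lemma circ_int_cst (a : R) : circ_int (fun=> a) = a * (2 * pi).
Proof.
rewrite (@circ_int_primitive _ (fun t => a * t)); first by ring.
  by move=> t; exact: cvg_cst.
by move=> t _; apply: is_derive_eq; rewrite /GRing.scale/= mulr1.
Qed.

Lemma circ_int_le f g : continuous f -> continuous g -> (forall t, f t <= g t) ->
  circ_int f <= circ_int g.
Proof.
move=> fc gc fg; have [F FP] := circ_primitive_exists fc.
have [G GP] := circ_primitive_exists gc.
rewrite (circ_int_primitive fc FP) (circ_int_primitive gc GP).
have p0 := two_pi_gt0.
have [|t tt] := @mvt_segment R (fun t => G t - F t) (fun t => g t - f t) 0 (2 * pi) (ltW p0).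
  by move=> t tt; apply: is_deriveB; [apply: GP|apply: FP]; lra.
have := fg t; nra.
Qed.

Lemma circ_int_ge_part f (c tau : R) : continuous f -> (forall t, 0 <= f t) ->
  0 <= tau -> tau <= 2 * pi -> (forall t, 0 <= t <= tau -> c <= f t) ->
  tau * c <= circ_int f.
Proof.
move=> fc f0 t0 tp fcc; have [F FP] := circ_primitive_exists fc.
rewrite (circ_int_primitive fc FP).
have [|t tt E1] := @mvt_segment R F f 0 tau t0.
  by move=> t tt; apply: FP; lra.
have [|s ss E2] := @mvt_segment R F f tau (2 * pi) tp.
  by move=> z tt'; apply: FP; clear -tt' t0 tp; lra.
have := fcc t tt; have := f0 s.
have : F (2 * pi) - F 0 = f s * (2 * pi - tau) + f t * tau by move: E1 E2; rewrite subr0; clear; lra.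
move=> -> h1 h2; nra.
Qed.

Lemma sin_period (k : nat) (x : R) : sin (x + k%:R * (2 * pi)) = sin x.
Proof.
elim: k => [|k ih]; first by rewrite mul0r addr0.
rewrite (_ : _ + _ = x + k%:R * (2 * pi) + pi *+ 2); first by rewrite sinD2pi.
by rewrite -addn1 natrD -[pi *+ 2]mulr_natl; ring.
Qed.

(** Even real trigonometric polynomials, presented inductively so that facts on convolution are
    checked on cosines and carried through sums and multiples. *)
Inductive cosspan : (R -> R) -> Prop :=
| cosspan_cos k : cosspan (fun t => cos (k%:R * t))
| cosspan_add f g : cosspan f -> cosspan g -> cosspan (fun t => f t + g t)
| cosspan_scale a f : cosspan f -> cosspan (fun t => a * f t).

Lemma cosspan_mulcos f : cosspan f -> cosspan (fun t => cos t * f t).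
Proof.
elim=> [k|g h _ ih1 _ ih2|a g _ ih].
- case: k => [|k].
    rewrite (_ : (fun _ => _) = fun t => cos (1%:R * t)); first exact: cosspan_cos.
    by apply/funext => t; rewrite mul0r cos0 mulr1 mul1r.
  rewrite (_ : (fun _ => _) = fun t => 2^-1 * (cos (k.+2%:R * t) + cos (k%:R * t))).
    by apply/cosspan_scale/cosspan_add; exact: cosspan_cos.
  apply/funext => t; rewrite (_ : k.+2%:R * t = k.+1%:R * t + t); last first.
    by rewrite -addn1 natrD; ring.
  rewrite (_ : k%:R * t = k.+1%:R * t - t); last by rewrite -[k.+1]addn1 natrD; ring.
  by rewrite cosD cosB; field.
- rewrite (_ : (fun _ => _) = fun t => cos t * g t + cos t * h t); first exact: cosspan_add.
  by apply/funext => t; rewrite mulrDr.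
- rewrite (_ : (fun _ => _) = fun t => a * (cos t * g t)); first exact: cosspan_scale.
  by apply/funext => t; rewrite mulrCA.
Qed.

Lemma cosspan_pow N : cosspan (fun t => (1 + cos t) ^+ N).
Proof.
elim: N => [|N ih].
  rewrite (_ : (fun _ => _) = fun t => cos (0%:R * t)); first exact: cosspan_cos.
  by apply/funext => t; rewrite mul0r cos0.
rewrite (_ : (fun _ => _) = fun t => (1 + cos t) ^+ N + cos t * (1 + cos t) ^+ N).
  by apply: cosspan_add => //; exact: cosspan_mulcos.
by apply/funext => t; rewrite exprS mulrDl mul1r.
Qed.

Lemma continuous_shift f (x : R) : continuous f -> continuous (fun t : R => f (x - t)).
Proof.
move=> fc t; apply: (@continuous_comp _ _ _ (fun t => x - t) f); last exact: fc.
by apply: cvgB; [exact: cvg_cst|exact: cvg_id].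
Qed.

Lemma continuousMr f g : continuous f -> continuous g -> continuous (fun t : R => f t * g t).
Proof. by move=> fc gc t; apply: cvgM; [exact: fc|exact: gc]. Qed.

Lemma continuousDr f g : continuous f -> continuous g -> continuous (fun t : R => f t + g t).
Proof. by move=> fc gc t; apply: cvgD; [exact: fc|exact: gc]. Qed.

Lemma continuous_cosk (k : R) : continuous (fun t : R => cos (k * t)).
Proof.
move=> t; apply: (@continuous_comp _ _ _ (fun t => k * t) cos); last exact: continuous_cos.
by apply: cvgM; [exact: cvg_cst|exact: cvg_id].
Qed.

Lemma continuous_sink (k : R) : continuous (fun t : R => sin (k * t)).
Proof.
move=> t; apply: (@continuous_comp _ _ _ (fun t => k * t) sin); last exact: continuous_sin.
by apply: cvgM; [exact: cvg_cst|exact: cvg_id].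
Qed.

Lemma expiX (k : nat) (t : R) : expi t ^+ k = expi (k%:R * t) :> C.
Proof.
elim: k => [|k ih]; first by rewrite expr0 mul0r expi0.
by rewrite exprS ih -expiD -[k.+1]add1n natrD mulrDl mul1r.
Qed.

(** For [f t = cos (k t)] the convolution is [Re ((A - i B) e^(i k x))], with [A] and [B] the cosine
    and sine coefficients of [V], hence the polynomial [(A - i B) X^k]. [c0] is the mean of [f];
    only [k = 0] contributes to it and to the value at 0. *)
Lemma cosspan_convolution f : cosspan f -> continuous f /\ exists c0 : R,
  (forall x, circ_int (fun t => f (x - t)) = c0 * (2 * pi)) /\
  forall V, continuous V -> exists q : {poly R[i]},
    complex.Re q.[0] = c0 * circ_int V /\
    forall x, complex.Re q.[expi x] = circ_int (fun t => V t * f (x - t)).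
Proof.
elim=> [k|g h _ [gc [c1 [Ig Hg]]] _ [hc [c2 [Ih Hh]]]|a g _ [gc [c1 [Ig Hg]]]].
- split; first exact: continuous_cosk.
  exists (k == 0%N)%:R; split.
    case: k => [|k] x.
      rewrite (_ : (fun _ => _) = fun=> 1) ?circ_int_cst//.
      by apply/funext => t; rewrite mul0r cos0.
    rewrite (@circ_int_primitive _ (fun t => - (k.+1%:R^-1 * sin (k.+1%:R * (x - t))))).
    + have -> : sin (k.+1%:R * (x - 0)) = sin (k.+1%:R * (x - 2 * pi)).
        by rewrite -(sin_period k.+1 (k.+1%:R * (x - 2 * pi))); congr sin; ring.
      by rewrite mul0r; ring.
    + exact: (@continuous_shift (fun t => cos (k.+1%:R * t)) x (@continuous_cosk _)).
    + move=> t _; have k0 : k.+1%:R != 0 :> R by rewrite pnatr_eq0.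
      by apply: is_derive_eq; rewrite /GRing.scale/=; field.
  move=> V Vc; have cV := continuousMr Vc (@continuous_cosk k%:R).
  have sV := continuousMr Vc (@continuous_sink k%:R).
  pose A := circ_int (fun t => V t * cos (k%:R * t)).
  pose B := circ_int (fun t => V t * sin (k%:R * t)).
  exists ((A -i* B) *: 'X^k); split.
    rewrite hornerZ hornerXn expr0n; case: k @A @B {cV sV} => [|k] A B /=.
      rewrite !mulr1 mul1r mulr0 subr0 /A; congr circ_int.
      by apply/funext => t; rewrite mul0r cos0 mulr1.
    by rewrite !mulr0 subr0 mul0r.
  move=> x; rewrite hornerZ hornerXn expiX /expi /=.
  rewrite (_ : (fun t => _) = fun t => cos (k%:R * x) * (V t * cos (k%:R * t)) +
      sin (k%:R * x) * (V t * sin (k%:R * t))); last first.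
    by apply/funext => t; rewrite mulrBr cosB; ring.
  rewrite circ_intD ?circ_intZ//; last first.
  - by apply: continuousMr => // t; exact: cvg_cst.
  - by apply: continuousMr => // t; exact: cvg_cst.
  by rewrite -/A -/B; ring.
- split; first exact: continuousDr.
  exists (c1 + c2); split.
    by move=> x; rewrite circ_intD ?Ig ?Ih; [ring|exact: continuous_shift..].
  move=> V Vc; have [q1 [q10 q1E]] := Hg V Vc; have [q2 [q20 q2E]] := Hh V Vc.
  exists (q1 + q2); split; first by rewrite hornerD raddfD /= q10 q20; ring.
  move=> x; rewrite hornerD raddfD /= q1E q2E -circ_intD.
  + by congr circ_int; apply/funext => t; rewrite mulrDr.
  + by apply: continuousMr => //; exact: continuous_shift.
  + by apply: continuousMr => //; exact: continuous_shift.
- split; first by apply: continuousMr => // t; exact: cvg_cst.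
  exists (a * c1); split.
    by move=> x; rewrite circ_intZ ?Ig; [ring|exact: continuous_shift].
  move=> V Vc; have [q1 [q10 q1E]] := Hg V Vc.
  have ReZ (z : R[i]) : complex.Re (a%:C * z) = a * complex.Re z by case: z => ? ? /=; ring.
  exists (a%:C *: q1); split; first by rewrite hornerZ ReZ q10; ring.
  move=> x; rewrite hornerZ ReZ q1E -circ_intZ.
  + by congr circ_int; apply/funext => t; rewrite mulrCA.
  + by apply: continuousMr => //; exact: continuous_shift.
Qed.

End CircleIntegral.

(** * An approximate identity on the circle *)

Section CircleApproximation.
Variable R : realType.
Local Notation C := (R[i]^o).

Lemma expi_onto (z : C) : nrm z = 1 -> exists t, z = expi t.
Proof.
move=> z1; have := sqr_nrm z; rewrite z1 expr1n.
case: z {z1} => x y /= xy.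
have xB : -1 <= x <= 1 by apply/andP; split; nra.
have cx : cos (acos x) = x by rewrite acosK// in_itv.
have sx : sin (acos x) = `|y|.
  by rewrite sin_acos// (_ : 1 - x ^+ 2 = y ^+ 2) ?sqrtr_sqr// xy; ring.
have [y0|y0] := leP 0 y.
  by exists (acos x); rewrite /expi cx sx ger0_norm.
by exists (- acos x); rewrite /expi cosN sinN cx sx ltr0_norm// opprK.
Qed.

Lemma sqr_nrm_expiB (x y : R) : nrm (expi x - expi y : C) ^+ 2 = 2 - 2 * cos (x - y).
Proof.
rewrite sqr_nrm /= cosB.
have := cos2Dsin2 x; have := cos2Dsin2 y; nra.
Qed.

Lemma compact_circle : compact [set z : C | nrm z = 1].
Proof.
apply: subclosed_compact (@compact_disc R 1) _; last by move=> z /= ->.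
rewrite -openC openE => z /= z1; apply/nbhs_nrmP; exists `|nrm z - 1|.
  by rewrite normr_gt0 subr_eq0; apply/eqP.
move=> y yz /= y1; move: yz; apply/negP; rewrite -leNgt ler_norml.
have := nrm_triangle y z 0; have := nrm_triangle z y 0.
rewrite !subr0 y1 -[nrm (z - y)]nrmN opprB => h1 h2; apply/andP; split; lra.
Qed.

Lemma circle_unif_continuous (U : C -> R) :
  (forall z, nrm z = 1 -> forall e : R, 0 < e -> exists2 d : R, 0 < d &
    forall w, nrm (w - z) < d -> `|U w - U z| < e) ->
  forall e : R, 0 < e -> exists2 d : R, 0 < d &
    forall z w, nrm z = 1 -> nrm (w - z) < d -> `|U w - U z| <= e.
Proof.
move=> Uc e e0; have e2 : 0 < e / 2 by rewrite divr_gt0.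
have /compact_near_coveringP H := compact_circle.
have [|d /= d0 dH] := H R (0 : R)^'+ (fun d z => forall w, nrm (w - z) < d -> `|U w - U z| <= e) _.
  move=> z /= /Uc /(_ _ e2)[d d0 dH].
  have d2 : 0 < d / 2 by rewrite divr_gt0.
  exists ([set w | nrm (w - z) < d / 2], [set x : R | x < d / 2]) => /=.
    split; first by apply/nbhs_nrmP; exists (d / 2).
    exact: nbhs_right_lt.
  move=> [x r] /= [xz rd] w wx.
  have h1 : `|U w - U z| < e / 2 by apply: dH; have := nrm_triangle x w z; lra.
  have h2 : `|U x - U z| < e / 2 by apply: dH; lra.
  rewrite ler_norml; move: h1 h2; rewrite !ltr_norml => /andP[? ?] /andP[? ?].
  by apply/andP; split; lra.
exists (d / 2); first by rewrite divr_gt0.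
move=> z w z1 zw; apply: (dH (d / 2)) => //=.
  by rewrite distrC subr0 gtr0_norm ?divr_gt0//; lra.
by rewrite divr_gt0.
Qed.

Lemma bernoulli (h : R) N : 0 <= h -> 1 + N%:R * h <= (1 + h) ^+ N.
Proof.
move=> h0; elim: N => [|N ih]; first by rewrite mul0r addr0 expr0.
have N0 : 0 <= N%:R :> R by [].
rewrite exprS -addn1 natrD.
have := ler_wpM2l (_ : 0 <= 1 + h) ih; nra.
Qed.

(* The kernels [(1 + cos t)^N], normalised, form an approximate identity. *)
Lemma circle_approx (U : C -> R) :
  (forall z, nrm z = 1 -> forall e : R, 0 < e -> exists2 d : R, 0 < d &
    forall w, nrm (w - z) < d -> `|U w - U z| < e) ->
  forall e : R, 0 < e -> exists q : {poly R[i]},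
    complex.Re q.[0] = (2 * pi)^-1 * circ_int (fun t => U (expi t)) /\
    forall z : C, nrm z = 1 -> `|complex.Re q.[z] - U z| <= e.
Proof.
move=> Uc e e0; have e2 : 0 < e / 2 by rewrite divr_gt0.
have p0 := two_pi_gt0 R.
pose V t := U (expi t).
have [d d0 dH] := circle_unif_continuous Uc e2.
(* By [|e^(ix) - e^(iy)|^2 = 2 - 2 cos (x - y)] the condition [cos (x - y) > 1 - eta] forces a chord
   shorter than [d]. *)
pose eta := Num.min 1 (d ^+ 2 / 2).
have eta0 : 0 < eta by rewrite lt_min ltr01 divr_gt0// exprn_gt0.
have eta1 : eta <= 1 by rewrite ge_min lexx.
have etad : eta <= d ^+ 2 / 2 by rewrite ge_min lexx orbT.
have VH x y : 1 - eta < cos (x - y) -> `|V y - V x| <= e / 2.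
  move=> cxy; apply: dH; rewrite ?nrm_expi//.
  rewrite -(@ltr_pXn2r _ 2)// ?nnegrE ?nrm_ge0 ?(ltW d0)//.
  by rewrite -nrmN opprB sqr_nrm_expiB; clear -cxy etad; lra.
clearbody eta.
have Vc : continuous V.
  move=> t; apply/cvgrPdist_lt => r r0.
  have := Uc (expi t) (nrm_expi _) r r0 => -[d' d'0 dH'].
  have cc : cos ((t - s) : R) @[s --> t] --> cos (t - t).
    apply: (@continuous_comp _ _ _ (fun s => t - s) cos); last exact: continuous_cos.
    by apply: cvgB; [exact: cvg_cst|exact: cvg_id].
  have d'2 : 0 < d' ^+ 2 / 2 by rewrite divr_gt0// exprn_gt0.
  move/cvgrPdist_lt : cc => /(_ _ d'2); rewrite subrr cos0; apply: filterS => s.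
  rewrite ltr_norml => /andP[_ ts].
  rewrite distrC; apply: dH'.
  rewrite -(@ltr_pXn2r _ 2)// ?nnegrE ?nrm_ge0 ?(ltW d'0)//.
  by rewrite -nrmN opprB sqr_nrm_expiB; clear -ts; lra.
have [B B0 VB] : exists2 B, 0 <= B & forall t, `|V t| <= B.
  have [||z z1 zH] := @compact_max R C _ (fun z => `|U z|) _ compact_circle.
  - by exists 1; rewrite /= nrm1.
  - move=> z /= z1 r r0; have [d' d'0 dH'] := Uc z z1 r r0.
    by exists d' => // y _ /dH'; apply: le_lt_trans; exact: ler_dist_dist.
  by exists `|U z| => // t; apply: zH; rewrite /= nrm_expi.
have [tau t0 tH] : exists2 tau, 0 < tau <= 2 * pi & forall t, 0 <= t <= tau -> 1 - eta / 2 <= cos t.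
  have h0 : 0 < eta / 2 by rewrite divr_gt0.
  have /cvgrPdist_lt /(_ _ h0) := @continuous_cos R 0.
  rewrite cos0 => /nbhs_normP[r /= r0 rH].
  exists (Num.min (r / 2) (2 * pi)).
    by rewrite lt_min divr_gt0//= p0 ge_min lexx orbT.
  move=> t; rewrite le_min => /andP[tt0 /andP[tr _]].
  have /= := rH t; rewrite sub0r normrN ger0_norm// ltr_norml.
  move=> /(_ ltac:(lra))/andP[_]; lra.
have /andP[tau0 taup] := t0.
pose h := eta / 4.
have h0 : 0 < h by rewrite divr_gt0.
(* The kernel is at least [(2 - eta / 2) ^+ N] on [[0, tau]] and at most [(2 - eta) ^+ N] where
   [cos <= 1 - eta]. The ratio of the bases is at least [1 + h], so Bernoulli's inequality makes the
   tail small against the mass. *)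
have [N NH] : exists N : nat, 2 * B * (2 * pi) <= e / 2 * tau * (N%:R * h).
  have k0 : 0 < e / 2 * tau * h by rewrite !mulr_gt0.
  exists (Num.bound (2 * B * (2 * pi) / (e / 2 * tau * h))).
  have x0 : 0 <= 2 * B * (2 * pi) / (e / 2 * tau * h) by rewrite divr_ge0 ?(ltW k0)// mulr_ge0 ?(ltW p0)// mulr_ge0.
  have := ltW (archi_boundP x0); rewrite ler_pdivrMr// => /le_trans -> //.
  by rewrite le_eqVlt; apply/orP; left; apply/eqP; ring.
pose f (t : R) := (1 + cos t) ^+ N.
have [fc [c0 [c0E /(_ V Vc)[q [q0 qE]]]]] := cosspan_convolution (cosspan_pow R N).
have f0 t : 0 <= f t by rewrite exprn_ge0//; have := cos_geN1 t; lra.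
rewrite -/f in fc c0E q0 qE.
pose S := c0 * (2 * pi).
have S_ge : tau * (2 - eta / 2) ^+ N <= S.
  rewrite /S -(c0E 0).
  rewrite (_ : (fun _ => _) = f); last by apply/funext => t; rewrite sub0r /f cosN.
  apply: circ_int_ge_part; rewrite ?(ltW tau0)// => t tt.
  by rewrite /f lerXn2r// ?nnegrE; have := tH t tt; lra.
have eN0 : 0 <= (2 - eta) ^+ N by rewrite exprn_ge0//; lra.
have bern : (1 + N%:R * h) * (2 - eta) ^+ N <= (2 - eta / 2) ^+ N.
  have hb := bernoulli N (ltW h0).
  rewrite (le_trans (ler_wpM2r eN0 hb))// -exprMn lerXn2r// ?nnegrE /h; nra.
have S0 : 0 < S.
  apply: lt_le_trans S_ge; rewrite mulr_gt0// exprn_gt0//; lra.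
have tail : 2 * B * (2 - eta) ^+ N * (2 * pi) <= e / 2 * S.
  have := ler_wpM2l (ltW e2) S_ge; have := ler_wpM2r eN0 NH.
  have := ler_wpM2l (ltW (mulr_gt0 e2 tau0)) bern.
  have := mulr_ge0 (ltW (mulr_gt0 e2 tau0)) eN0.
  move: (_ ^+ N) (_ ^+ N) (N%:R) => X Y Z; clear; lra.
(* Dividing by the mass [S = c0 * (2 * pi)] makes the real part at 0 equal to the mean of [U], with
   no error. *)
exists (S^-1%:C *: q); change (fun t => U (expi t)) with V.
have ReZ (a : R) (z : R[i]) : complex.Re (a%:C * z) = a * complex.Re z by case: z => ? ? /=; ring.
split.
  have c00 : c0 != 0 by apply: contraTneq S0; rewrite /S => ->; rewrite mul0r ltxx.
  have pi0 : pi != 0 :> R by rewrite gt_eqF ?pi_gt0.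
  rewrite hornerZ ReZ q0 /S; move: c00 pi0; generalize (circ_int V) c0 (@pi R); clear.
  by move=> a b c b0 c0; field; rewrite b0 c0.
move=> _ /expi_onto[x ->]; rewrite hornerZ ReZ qE -/(V x).
have gc : continuous (fun t : R => f (x - t)) by exact: continuous_shift.
have Vfc := continuousMr Vc gc.
pose T := 2 * B * (2 - eta) ^+ N.
(* Either [V t] is close to [V x], or the kernel is bounded by its tail value. *)
have cmp t : `|V t - V x| * f (x - t) <= e / 2 * f (x - t) + T.
  have [ct|ct] := ltP (1 - eta) (cos (x - t)).
    by rewrite ler_wpDr ?mulr_ge0// ler_wpM2r// distrC; apply: VH; rewrite -cosN opprB.
  have h1 : `|V t - V x| <= 2 * B.
    by have := ler_normB (V t) (V x); have := VB t; have := VB x; lra.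
  have h2 : f (x - t) <= (2 - eta) ^+ N.
    by rewrite lerXn2r// ?nnegrE; have := cos_geN1 (x - t); lra.
  have h3 := ler_pM (normr_ge0 _) (f0 _) h1 h2.
  by rewrite (le_trans h3)// /T lerDr mulr_ge0// ltW.
have cst (a : R) : continuous (fun _ : R => a) by move=> t; exact: cvg_cst.
have int_cmp (a b : R) : circ_int (fun t => a * f (x - t) + b) = a * S + b * (2 * pi).
  rewrite (@circ_intD _ (fun t => a * f (x - t)) (fun=> b))//; last exact: continuousMr.
  by rewrite circ_int_cst circ_intZ// c0E.
have J1 : circ_int (fun t => V t * f (x - t)) <= (V x + e / 2) * S + T * (2 * pi).
  rewrite -int_cmp; apply: circ_int_le => // [|t].
    by apply: continuousDr => //; exact: continuousMr.
  have := cmp t; have := ler_norm (V t - V x); have := f0 (x - t).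
  by move: (f _) => y; clear; nra.
have J2 : (V x - e / 2) * S + - T * (2 * pi) <= circ_int (fun t => V t * f (x - t)).
  rewrite -int_cmp; apply: circ_int_le => // [|t].
    by apply: continuousDr => //; exact: continuousMr.
  have := cmp t; have := ler_norm (- (V t - V x)); have := f0 (x - t).
  by rewrite normrN; move: (f _) => y; clear; nra.
have ST : T * (2 * pi) <= e / 2 * S by exact: tail.
move: (circ_int _) J1 J2 => J J1 J2.
rewrite (_ : _ - _ = (J - V x * S) / S); last by field; rewrite gt_eqF.
rewrite normrM [`|S^-1|]gtr0_norm ?invr_gt0// ler_pdivrMr// ler_norml.
by move: J1 J2 ST; clear; move=> *; apply/andP; split; lra.
Qed.

End CircleApproximation.

Lemma poly_quadratic_expansion (R : realType) (q : {poly R[i]}) (s0 : R[i]^o) :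
  exists (alpha beta : R[i]^o) (D : R), 0 <= D /\ forall t : R[i]^o, nrm t <= 1 ->
    nrm (q.[s0 + t] - q.[s0] - (alpha * t + beta * t ^+ 2) : R[i]^o) <= D * nrm t ^+ 3.
Proof.
elim/poly_ind: q => [|q c [alpha [beta [D [D0 H]]]]].
  exists 0, 0, 0; split=> // t _; rewrite !horner0 !mul0r addr0 !subr0 nrm0//.
exists (q.[s0] + alpha * s0), (alpha + beta * s0), (D * (nrm s0 + 1) + nrm beta).
split; first by rewrite addr_ge0 ?mulr_ge0 ?addr_ge0 ?nrm_ge0.
move=> t t1; have := H t t1; rewrite !hornerMXaddC.
set E : R[i]^o := _ - _ - _ => HE.
rewrite (_ : _ - _ - _ = E * (s0 + t) + beta * t ^+ 3 :> R[i]^o); last first.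
  by rewrite /E; move: (q.[s0 + t]) (q.[s0]) => x y; ring.
have e1 : nrm (E * (s0 + t) : R[i]^o) = nrm E * nrm (s0 + t) by exact: nrmM.
have e2 : nrm (beta * t ^+ 3 : R[i]^o) = nrm beta * nrm t ^+ 3 by rewrite nrmM nrmX.
rewrite (le_trans (nrmD _ _))// e1 e2 [leRHS]mulrDl lerD//.
rewrite [leRHS]mulrAC ler_pM ?nrm_ge0//.
by rewrite (le_trans (nrmD _ _))// lerD.
Qed.

Lemma lipschitz_continuous_at (R : realType) (V : normedModType R[i]) (f : V -> R) p :
  (forall y, `|f y - f p| <= nrm (y - p)) -> {for p, continuous f}.
Proof.
move=> H; apply/cvgrPdist_lt => e e0; apply/nbhs_nrmP; exists e => // y.
by apply: le_lt_trans; rewrite distrC.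
Qed.

(** * Plurisubharmonicity *)

Section LogDistance.
Variables (R : realType) (n : nat).
Local Notation C := (R[i]^o).
Local Notation Cn := ('C^n(R)).
Variable Omega : set Cn.
Hypothesis oO : open Omega.
Hypothesis cO : exists w, ~ Omega w.

Let u (z : Cn) : R := - ln (dist_compl Omega z).

Lemma log_dist_continuous z : Omega z -> {for z, continuous u}.
Proof.
move=> Oz; have d0 := dist_compl_gt0 oO cO Oz.
have dc : {for z, continuous (dist_compl Omega)}.
  apply: lipschitz_continuous_at => y; exact: dist_compl_lipschitz.
exact: cvgN (continuous_comp dc (continuous_ln d0)).
Qed.

Lemma log_dist_sublevel_compact (c : R) : bounded_set Omega ->
  compact [set z | Omega z /\ u z <= c].
Proof.
move=> /bounded_set_nrm[B _ OB].
apply: (@compact_bounded_closed R n _ B) => [x [/OB]//|].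
(* Outside [Omega] the distance is 0 and [ln] takes a default value; the condition on the distance
   excludes these points by itself and is visibly closed. *)
rewrite (_ : [set _ | _] = [set z | expR (- c) <= dist_compl Omega z]); last first.
  apply/seteqP; split => z /=.
    move=> [Oz uz]; have d0 := dist_compl_gt0 oO cO Oz.
    by rewrite -[leRHS]lnK ?posrE// ler_expR lerNl.
  move=> cz; have d0 : 0 < dist_compl Omega z by apply: lt_le_trans cz; exact: expR_gt0.
  split; last by rewrite /u lerNl -[leLHS]expRK ler_ln ?posrE ?expR_gt0.
  apply: contrapT => /(dist_compl_le cO z); rewrite subrr nrm0 leNgt d0//.
rewrite -openC openE => z /= /negP; rewrite -ltNge => zc.
apply/nbhs_nrmP; exists (expR (- c) - dist_compl Omega z); first by rewrite subr_gt0.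
move=> y yz /=; apply/negP; rewrite -ltNge.
have := le_lt_trans (dist_compl_lipschitz cO y z) yz.
rewrite ltr_norml => /andP[_]; lra.
Qed.

(* If the inequality fails, [u - Re q + (g / 4) |s|^2] has an interior maximum on
   the disc, where [q] is a polynomial with [Re q] close to [u] on the circle. *)
Lemma log_dist_submean (a b : Cn) :
  (forall p v w c t0, boundary Omega p -> 0 < c -> 0 < t0 -> ~ disc_contact Omega p v w c t0) ->
  (forall s : C, nrm s <= 1 -> Omega (a + s *: b)) ->
  u a <= (2 * pi)^-1 * circ_int (fun t => u (a + expi t *: b)).
Proof.
move=> nocontact Ob; rewrite leNgt; apply/negP => lt_mean.
pose U (s : C) := u (a + s *: b).
set M := (2 * pi)^-1 * _ in lt_mean.
have [g gE] : exists g, g = u a - M by exists (u a - M).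
have g0 : 0 < g by rewrite gE subr_gt0.
have Uc (z : C) : nrm z <= 1 -> forall e : R, 0 < e -> exists2 d : R, 0 < d &
    forall w, nrm (w - z) < d -> `|U w - U z| < e.
  move=> z1 e e0; have [d d0 dH] := continuous_nrm (log_dist_continuous (Ob z z1)) e0.
  have b0 := nrm_ge0 b; have b1 : 0 < nrm b + 1 by lra.
  exists (d / (nrm b + 1)); first by rewrite divr_gt0.
  move=> w; rewrite ltr_pdivlMr// => wz; apply: dH.
  rewrite (_ : _ - _ = (w - z) *: b); last by rewrite scalerBl opprD addrACA subrr add0r.
  by rewrite nrmZ (le_lt_trans _ wz)// ler_wpM2l ?nrm_ge0//; lra.
have e80 : 0 < g / 8 by rewrite divr_gt0.
have Uc1 (z : C) : nrm z = 1 -> forall e : R, 0 < e -> exists2 d : R, 0 < d &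
    forall w, nrm (w - z) < d -> `|U w - U z| < e.
  by move=> z1; apply: Uc; rewrite z1.
have [q [q0 qU]] := @circle_approx R U Uc1 (g / 8) e80.
(* The value at 0 is exactly [g], because [Re q] equals the circle mean there; on the circle it is
   at most [g / 8 + g / 4]. The maximum is therefore interior. *)
pose W (s : C) := U s - complex.Re q.[s] + g / 4 * nrm s ^+ 2.
have qc (z : C) (e : R) : 0 < e -> exists2 d : R, 0 < d & forall w : C,
    nrm (w - z) < d -> `|complex.Re q.[w] - complex.Re q.[z]| < e.
  move=> e0; have [al [be [D [D0 H]]]] := poly_quadratic_expansion q z.
  have a0 := nrm_ge0 al; have b0 := nrm_ge0 be.
  have K0 : 0 < nrm al + nrm be + D + 1 by lra.
  have X0 := divr_gt0 e0 K0.
  exists (Num.min 1 (e / (nrm al + nrm be + D + 1))); first by rewrite lt_min ltr01.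
  move=> w; rewrite lt_min ltr_pdivlMr// => /andP[/ltW w1 we].
  have := H _ w1; rewrite subrKC => Hw.
  have h0 := nrm_ge0 (w - z).
  have h2 : nrm (w - z) ^+ 2 <= nrm (w - z) by rewrite expr2 ler_piMl.
  have h3 : nrm (w - z) ^+ 3 <= nrm (w - z) by rewrite exprS ler_piMr// expr2 mulr_ile1.
  have e1 : nrm (al * (w - z) + be * (w - z) ^+ 2 : C) <= nrm al * nrm (w - z) + nrm be * nrm (w - z) ^+ 2.
    by rewrite (le_trans (nrmD _ _))// nrmM [nrm (be * _)]nrmM nrmX.
  have e2 : nrm (q.[w] - q.[z] : C) < e.
    rewrite (le_lt_trans _ we)//.
    have := nrmD (q.[w] - q.[z] - (al * (w - z) + be * (w - z) ^+ 2) : C) (al * (w - z) + be * (w - z) ^+ 2 : C).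
    rewrite subrK; have := ler_wpM2l b0 h2; have := ler_wpM2l D0 h3.
    by move: Hw e1 h0; clear; lra.
  have ReB (x y : C) : complex.Re (x - y) = complex.Re x - complex.Re y by case: x y => ? ? [].
  by rewrite -ReB (le_lt_trans (Re_le_nrm _) e2).
have Wc (z : C) : nrm z <= 1 -> forall e : R, 0 < e -> exists2 d : R, 0 < d &
    forall w : C, nrm w <= 1 -> nrm (w - z) < d -> `|W w - W z| < e.
  move=> z1 e e0; have e3 : 0 < e / 3 by rewrite divr_gt0.
  have [d1 d10 H1] := Uc z z1 _ e3; have [d2 d20 H2] := qc z _ e3.
  have d30 : 0 < e / 3 / g by rewrite divr_gt0.
  exists (Num.min d1 (Num.min d2 (e / 3 / g))); first by rewrite !lt_min d10 d20.
  move=> w w1; rewrite !lt_min => /and3P[/H1 + /H2].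
  have := nrm_triangle z w 0; have := nrm_triangle w z 0; rewrite !subr0 -[nrm (z - w)]nrmN opprB.
  rewrite /W; move: (nrm_ge0 z) (nrm_ge0 w).
  move: (nrm (w - z)) (nrm z) (nrm w) z1 w1 (U w) (U z) (complex.Re _) (complex.Re _) => N x y x1 y1 U1 U2 q1 q2.
  move=> x0 y0 h1 h2 h3 h4; rewrite ltr_pdivlMr// => h5.
  have h6 : `|y ^+ 2 - x ^+ 2| <= 2 * N by rewrite ler_norml; apply/andP; split; nra.
  move: h6 h3 h4 h5 g0; rewrite !ler_norml !ltr_norml.
  move=> /andP[? ?] /andP[? ?] /andP[? ?] ? ?; apply/andP; split; nra.
have [||s0 /= s01 Ws0] := @compact_max R C _ W _ (@compact_disc R 1).
- by exists 0; rewrite /= nrm0.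
- exact: Wc.
have W0 : W 0 = g by rewrite gE /W /U scale0r addr0 q0 nrm0 expr0n mulr0 addr0.
have s0lt : nrm s0 < 1.
  rewrite lt_neqAle s01 andbT; apply/eqP => s1.
  have := Ws0 0; rewrite nrm0 W0 /W s1 expr1n => /(_ ler01).
  have := qU _ s1; rewrite ler_norml => /andP[]; clear -g0; lra.
have [al [be [D [D0 H]]]] := poly_quadratic_expansion q s0.
(* Half of the quadratic term [g / 4 * nrm t ^+ 2] is reserved for the cubic remainder of [q], hence
   the bound [D * t0 <= g / 8]. *)
have [t0 [t00 t01 ts tD]] : exists t0 : R, [/\ 0 < t0, t0 <= 1, nrm s0 + t0 <= 1 & D * t0 <= g / 8].
  have X0 : 0 < g / 8 / (D + 1) by rewrite divr_gt0//; lra.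
  have s00 := nrm_ge0 s0; have s10 : 0 < 1 - nrm s0 by lra.
  exists (Num.min (1 - nrm s0) (g / 8 / (D + 1))).
  have h1 : Num.min (1 - nrm s0) (g / 8 / (D + 1)) <= 1 - nrm s0 by rewrite ge_min lexx.
  have h2 : Num.min (1 - nrm s0) (g / 8 / (D + 1)) <= g / 8 / (D + 1) by rewrite ge_min lexx orbT.
  split; first by rewrite lt_min s10.
  - lra.
  - lra.
  - have := ler_wpM2l D0 h2 => /le_trans; apply.
    by rewrite mulrA ler_pdivrMr; nra.
(* Maximality of [W] at [s0] bounds [u] from above, so [ln] of the distance from below. The linear
   part of [g / 4 * nrm s ^+ 2] at [s0] is [g / 2 * Re (s0^* t)], which is moved into the
   coefficient [alpha]. *)
have [|p [v [w [c [t1 [bp c0 t10]]]]]] := @touching_contact R n Omega (a + s0 *: b) b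
  (al - (g / 2)%:C * s0^* ) be (g / 8) t0 oO cO e80 t00; last exact: nocontact.
have combine (L1 L0 Q1 Q0 P B X Y : R) : Q1 - Q0 - B <= g / 8 * Y ->
    - L1 - Q1 + g / 4 * (X + 2 * P + Y) <= - L0 - Q0 + g / 4 * X ->
    L0 - (B - g / 2 * P) + g / 8 * Y <= L1 by clear; lra.
move=> t tt; have st : nrm (s0 + t) <= 1 by rewrite (le_trans (nrmD _ _))//; lra.
have e1 : a + s0 *: b + t *: b = a + (s0 + t) *: b by rewrite scalerDl addrA.
rewrite e1; split; first exact: Ob.
have ReB (x y : C) : complex.Re (x - y) = complex.Re x - complex.Re y by case: x y => ? ? [].
have ReZ (r : R) (z : R[i]) : complex.Re (r%:C * z) = r * complex.Re z by case: z => ? ? /=; ring.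
have t3 : D * nrm t ^+ 3 <= g / 8 * nrm t ^+ 2.
  have Dt : D * nrm t <= g / 8 by apply: le_trans tD; exact: ler_wpM2l.
  have T0 : 0 <= nrm t ^+ 2 by exact: sqr_ge0.
  by have := ler_wpM2r T0 Dt; rewrite -[D * _ * _]mulrA -(exprS (nrm t) 2).
have {}H := le_trans (Re_le_nrm _) (le_trans (H t (le_trans tt t01)) t3).
have {Ws0} := Ws0 _ st; rewrite /W /U /u.
move: H; rewrite !ReB ler_norml => /andP[_ H]; move: H.
have -> : (al - (g / 2)%:C * s0^*) * t + be * t ^+ 2 =
    (al * t + be * t ^+ 2) - (g / 2)%:C * (s0^* * t) :> C by ring.
rewrite ReB ReZ (Re_conj_mul_expand s0 (s0 + t)).
have -> : s0 + t - s0 = t by rewrite addrC addKr.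
exact: combine.
Qed.

End LogDistance.

Theorem theorem1 (R : realType) (n : nat) (Omega : set 'C^n(R))
  (hdom : domain Omega) (hbd : bounded_set Omega) (hC2 : C2_boundary Omega)
  (hvis : (exists eps : R, 0 < eps /\ visibility Omega 1 eps) \/
          (forall lambda : R, 1 < lambda -> visibility Omega lambda 0)) :
  pseudoconvex Omega.
Proof.
have [oO _ _] := hdom.
have [cO|allO] := pselect (exists w, ~ Omega w).
  exists (fun z => - ln (dist_compl Omega z)); last first.
    by move=> c; exact: log_dist_sublevel_compact.
  split; first exact: log_dist_continuous.
  move=> a b Ob; apply: log_dist_submean => //.
    by move=> p v w c t0; exact: visibility_no_contact.
  by move=> s s1; apply: Ob; rewrite nrmE lecR.
(* A bounded [Omega] with empty complement occurs only for [n = 0]; the sublevel sets of a constant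
   are then everything or empty. *)
exists (fun=> 0).
  split; first by move=> z _; apply: lipschitz_continuous_at => y; rewrite subrr normr0 nrm_ge0.
  by move=> a b _; rewrite /Rintegral integral0 mulr0.
move=> c; have [B _ OB] := bounded_set_nrm hbd.
apply: (@compact_bounded_closed R n _ B) => [x [/OB]//|].
have [c0|c0] := leP 0 c.
  rewrite (_ : [set _ | _] = setT); first exact: closedT.
  by apply/seteqP; split=> // z _; split=> //; apply: contrapT => Oz; apply: allO; exists z.
rewrite (_ : [set _ | _] = set0); first exact: closed0.
by apply/seteqP; split=> // z [].
Qed.
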